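(* Let $\mathcal P$ be an admissible point process on $\mathbb R^d$ and $\xi$ a score function. (i) If $\xi$ is exponentially stabilizing on $\mathcal P$ and $(\xi,\mathcal P)$ satisfies the $p$-moment condition for some $p\in(1,\infty)$, then for all $f\in\mathcal B(W_1)$ $$\Bigl|n^{-1}E\mu_n^\xi(f)-E_{\mathbf 0}[\xi(\mathbf 0,\mathcal P)]\,\rho^{(1)}(\mathbf 0)\int_{W_1}f(x)\,dx\Bigr|=O(n^{-1/d}).$$ If $\xi$ is only stabilizing on $\mathcal P$ and satisfies the $p$-moment condition for some $p\in(1,\infty)$, then the right-hand side is $o(1)$. (ii) Assume that the second correlation function $\rho^{(2)}$ of $\mathcal P$ exists and is bounded, that $\xi$ is stabilizing on $\mathcal P$, and that $(\xi,\mathcal P)$ satisfies the $p$-moment condition for some $p\in(2,\infty)$. If the second-order correlations of the $\xi$-weighted measures decay fast, i.e. there are a fast decreasing function $\tilde\phi$ and constants $\tilde C_2<\infty$, $\tilde c_2>0$ such that for all $n\in\mathbb N\cup\{\infty\}$ and distinct $x_1,x_2\in\mathbb R^d$ $$|m_{(2)}(x_1,x_2;n)-m_{(1)}(x_1;n)m_{(1)}(x_2;n)|\le\tilde C_2\tilde\phi(\tilde c_2|x_1-x_2|),$$ then for all $f\in\mathcal B(W_1)$ $$\lim_{n\to\infty}n^{-1}\mathrm{Var}\,\mu_n^\xi(f)=\sigma^2(\xi)\int_{W_1}f(x)^2\,dx\in[0,\infty),$$ whereas for all $f,g\in\mathcal B(W_1)$ $$\lim_{n\to\infty}n^{-1}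\mathrm{Cov}(\mu_n^\xi(f),\mu_n^\xi(g))=\sigma^2(\xi)\int_{W_1}f(x)g(x)\,dx.$$
   Context: Fix $d\ge2$. $\mathcal N$ is the space of locally finite subsets of $\mathbb R^d$ (identified with simple Radon counting measures), with its canonical $\sigma$-algebra; a simple point process $\mathcal P$ is a random element of $\mathcal N$. $B_r(x)$ is the closed Euclidean ball, $B_r^c(x)$ its complement. $\mathcal X^{(k)}$ is the set of $k$-tuples of pairwise distinct points of $\mathcal X$. The $k$-th factorial moment measure is $\alpha^{(k)}(\cdot)=E[\mathrm{card}(\mathcal P^{(k)}\cap\cdot)]$; its Lebesgue density $\rho^{(k)}$ is the $k$-point correlation function. The Palm expectations $E_{x_1,\ldots,x_k}$ (probabilities $P_{x_1,\ldots,x_k}$) are determined $\alpha^{(k)}$-a.e. by $E\sum_{(x_1,\ldots,x_k)\in\mathcal P^{(k)}}f(x_1,\ldots,x_k;\mathcal P)=\int E_{x_1,\ldots,x_k}[f(x_1,\ldots,x_k;\mathcal P)]\,\alpha^{(k)}(dx_1\cdots dx_k)$ for measurable $f\ge0$; expressions involving them are understood almost everywhere and suprema are essential suprema. For stationary $\mathcal P$ the Palm expectation $E_{\mathbf 0}$ at the origin (and hence $m_{(1)}(\mathbf 0)$, $m_{(2)}(\mathbf 0,x)\,dx$ below) is meaningfully defined by translation covariance. $\mathcal P$ is admissible if it is simple, stationary, has intensity $\rho^{(1)}(\mathbf 0)\in(0,\infty)$, and has correlation functions of all orders. $W_n:=[-\frac12n^{1/d},\frac12n^{1/d}]^d$,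 $\mathcal P_n:=\mathcal P\cap W_n$, $W_\infty:=\mathbb R^d$, $\mathcal P_\infty:=\mathcal P$. A fast decreasing function is a non-increasing $\phi:[0,\infty)\to[0,1]$ with $\lim_{x\to\infty}x^m\phi(x)=0$ for all $m\ge1$. A score function is $\xi:\mathbb R^d\times\mathcal N\to\mathbb R$, measurable in each coordinate, with $\xi(x,\mathcal X)=0$ if $x\notin\mathcal X$, and $\xi(\cdot+y,\cdot+y)=\xi(\cdot,\cdot)$ for all $y$. The radius of stabilization $R^\xi(x,\mathcal X)$, $x\in\mathcal X$, is the smallest $r\in\mathbb N$ with $\xi(x,\mathcal X\cap B_r(x))=\xi(x,(\mathcal X\cap B_r(x))\cup(\mathcal A\cap B_r^c(x)))$ for all locally finite $\mathcal A$ ($\infty$ if none). $\xi$ is stabilizing on $\mathcal P$ if there are constants $a_l>0$ and $\varphi:[0,\infty)\to[0,1]$ with $\varphi(t)\downarrow0$ as $t\to\infty$, such that for all $l\in\mathbb N$, $t>0$: $\sup_{1\le n\le\infty}\sup_{x_1,\ldots,x_l\in W_n}P_{x_1,\ldots,x_l}(R^\xi(x_1,\mathcal P_n)>t)\le\varphi(a_lt)$. It is exponentially stabilizing if moreover $\limsup_{t\to\infty}t^{-c}\log\varphi(t)\in(-\infty,0)$ for some $c\in(0,\infty)$. $p$-moment condition ($p\in[1,\infty)$): $\sup_{1\le n\le\infty}\sup_{1\le p'\le\lfloor p\rfloor}\sup_{x_1,\ldots,x_{p'}\in W_n}E_{x_1,\ldots,x_{p'}}\max\{|\xi(x_1,\mathcal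 P_n)|,1\}^p<\infty$. $m_{(1)}(x;n):=E_x[\xi(x,\mathcal P_n)]\rho^{(1)}(x)$ and $m_{(2)}(x,y;n):=E_{x,y}[\xi(x,\mathcal P_n)\xi(y,\mathcal P_n)]\rho^{(2)}(x,y)$; the argument $n$ is omitted when $n=\infty$. $\mu_n^\xi:=\sum_{x\in\mathcal P_n}\xi(x,\mathcal P_n)\delta_{n^{-1/d}x}$ and $\mu(f):=\int f\,d\mu$. $\mathcal B(W_1)$ is the space of bounded measurable functions on $W_1$. $$\sigma^2(\xi):=E_{\mathbf 0}[\xi^2(\mathbf 0,\mathcal P)]\rho^{(1)}(\mathbf 0)+\int_{\mathbb R^d}\bigl(m_{(2)}(\mathbf 0,x)-m_{(1)}(\mathbf 0)^2\bigr)dx.$$ *)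

(* Defs.v *)
From HB Require Import structures.
From mathcomp Require Import all_boot all_order all_algebra.
From mathcomp Require Import all_classical all_reals all_analysis.
From mathcomp Require Import measurable_realfun.
Set Implicit Arguments.
Unset Strict Implicit.
Unset Printing Implicit Defensive.
Import Order.TTheory GRing.Theory Num.Theory.
Import numFieldNormedType.Exports.

Local Open Scope classical_set_scope.
Local Open Scope ring_scope.

(* The left inverse [g] is only there to make the image measure sigma-finite. *)
Definition image_measure d1 d2 (T1 : measurableType d1) (T2 : measurableType d2)
    (R : realType) (mu : set T1 -> \bar R) (f : T1 -> T2) (g : T2 -> T1)
    of measurable_fun [set: T1] f & measurable_fun [set: T2] g & cancel f g :
  set T2 -> \bar R := pushforward mu f.

Section image_measure.
Context d1 d2 (T1 : measurableType d1) (T2 : measurableType d2) (R : realType).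
Variables (mu : {sigma_finite_measure set T1 -> \bar R}) (f : T1 -> T2).
Variable g : T2 -> T1.
Hypotheses (mf : measurable_fun [set: T1] f) (mg : measurable_fun [set: T2] g).
Hypothesis fK : cancel f g.

Let nu := image_measure mu mf mg fK.

Let nu0 : nu set0 = 0%E.
Proof. by rewrite /nu /image_measure /pushforward preimage_set0 measure0. Qed.

Let nu_ge0 A : (0 <= nu A)%E.
Proof. exact: measure_ge0. Qed.

Let nu_semi_sigma_additive : semi_sigma_additive nu.
Proof.
move=> F mF tF mUF; rewrite /nu /image_measure /pushforward preimage_bigcup.
apply: measure_semi_sigma_additive.
- by move=> n; rewrite -[X in measurable X]setTI; exact: mf.
- apply/trivIsetP => /= i j _ _ ij; rewrite -preimage_setI.
  by move/trivIsetP : tF => /(_ _ _ _ _ ij) ->//; rewrite preimage_set0.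
- by rewrite -preimage_bigcup -[X in measurable X]setTI; exact: mf.
Qed.

HB.instance Definition _ := isMeasure.Build _ _ _ (image_measure mu mf mg fK)
  nu0 nu_ge0 nu_semi_sigma_additive.

Let nu_sigma_finite : sigma_finite setT (image_measure mu mf mg fK).
Proof.
have [F UF mF] := sigma_finiteT mu.
exists (fun i => g @^-1` F i); first by rewrite -preimage_bigcup -UF preimage_setT.
move=> i; have [mFi Fi_oo] := mF i.
split; first by rewrite -[X in measurable X]setTI; exact: mg.
rewrite /image_measure /pushforward -comp_preimage.
by rewrite (_ : g \o f = id)//; apply/funext => x /=; rewrite fK.
Qed.

HB.instance Definition _ := Measure_isSigmaFinite.Build _ _ _
  (image_measure mu mf mg fK) nu_sigma_finite.

Definition sigma_finite_image : {sigma_finite_measure set T2 -> \bar R} :=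
  image_measure mu mf mg fK.

End image_measure.

(* A synonym of [\x]: the library's canonical sigma-finite structure on [\x]
   is only found for subprobabilities. *)
Definition prod_measure d1 d2 (T1 : measurableType d1) (T2 : measurableType d2)
    (R : realType) (m1 : set T1 -> \bar R) (m2 : set T2 -> \bar R) :
  set (T1 * T2) -> \bar R := (m1 \x m2)%E.

Section prod_measure.
Context d1 d2 (T1 : measurableType d1) (T2 : measurableType d2) (R : realType).
Variable m1 : {sigma_finite_measure set T1 -> \bar R}.
Variable m2 : {sigma_finite_measure set T2 -> \bar R}.

HB.instance Definition _ := Measure.copy (prod_measure m1 m2) (m1 \x m2)%E.

Let prod_measure_sigma_finite : sigma_finite setT (prod_measure m1 m2).
Proof.
have /sigma_finiteP[F [TF ndF Foo]] := sigma_finiteT m1.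
have /sigma_finiteP[G [TG ndG Goo]] := sigma_finiteT m2.
exists (fun n => F n `*` G n).
  rewrite -setXTT TF TG predeqE => -[x y]; split.
    move=> [/= [n _ Fnx] [k _ Gky]]; exists (maxn n k) => //; split.
    - by move: x Fnx; exact/subsetPset/ndF/leq_maxl.
    - by move: y Gky; exact/subsetPset/ndG/leq_maxr.
  by move=> [n _ []/= ? ?]; split; exists n.
move=> k; have [? ?] := Foo k; have [? ?] := Goo k.
split; first exact: measurableX.
by rewrite /prod_measure product_measure1E// lte_mul_pinfty// ge0_fin_numE.
Qed.

HB.instance Definition _ := Measure_isSigmaFinite.Build _ _ _
  (prod_measure m1 m2) prod_measure_sigma_finite.

Definition sigma_finite_prod :
  {sigma_finite_measure set (T1 * T2)%type -> \bar R} := prod_measure m1 m2.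

End prod_measure.

Section tuple_measure.
Context d (T : measurableType d) (R : realType).
Variable mu : {sigma_finite_measure set T -> \bar R}.

Definition tcons k (p : T * k.-tuple T) : k.+1.-tuple T := [tuple of p.1 :: p.2].
Definition tuncons k (t : k.+1.-tuple T) : T * k.-tuple T :=
  (thead t, [tuple of behead t]).

Lemma tconsK k : cancel (@tcons k) (@tuncons k).
Proof. by move=> [x t]; rewrite /tuncons /tcons theadE; congr pair; exact: val_inj. Qed.

Lemma measurable_tcons k : measurable_fun [set: T * k.-tuple T] (@tcons k).
Proof. exact: measurable_cons. Qed.

Lemma measurable_tuncons k : measurable_fun [set: k.+1.-tuple T] (@tuncons k).
Proof.
apply/measurable_fun_pairP; split => /=.
  exact: (@measurable_tnth _ T k.+1 ord0).
exact: measurable_behead.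
Qed.

Fixpoint tuple_measure k : {sigma_finite_measure set (k.-tuple T) -> \bar R} :=
  match k with
  | 0 => \d_([tuple] : 0.-tuple T)
  | k.+1 => sigma_finite_image (sigma_finite_prod mu (tuple_measure k))
      (@measurable_tcons k) (@measurable_tuncons k) (@tconsK k)
  end.

End tuple_measure.

Section measurable_row.
Context (R : realType) (d : nat).

Let coords (i : 'I_d) (x : 'rV[R]_d) : R := x ord0 i.

Let row_set0 : g_sigma_preimage coords set0.
Proof. exact: sigma_algebra0. Qed.

Let row_setC A : g_sigma_preimage coords A -> g_sigma_preimage coords (~` A).
Proof. exact: sigma_algebraC. Qed.

Let row_bigcup (F : (set 'rV[R]_d)^nat) :
  (forall i, g_sigma_preimage coords (F i)) ->
  g_sigma_preimage coords (\bigcup_i F i).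
Proof. exact: sigma_algebra_bigcup. Qed.

(* On R^d the sigma-algebra generated by the coordinates is the Borel one. *)
HB.instance Definition _ := @isMeasurable.Build
  (measure_tuple_display default_measure_display) 'rV[R]_d
  (g_sigma_preimage coords) row_set0 row_setC row_bigcup.

Definition row_of_tuple (t : d.-tuple R) : 'rV[R]_d := \row_i tnth t i.
Definition tuple_of_row (x : 'rV[R]_d) : d.-tuple R := [tuple x ord0 i | i < d].

Lemma row_of_tupleK : cancel row_of_tuple tuple_of_row.
Proof. by move=> t; apply: eq_from_tnth => i; rewrite tnth_mktuple mxE. Qed.

Let measurable_coord i : measurable_fun [set: 'rV[R]_d] (coords i).
Proof.
move=> _ Y mY; rewrite setTI; apply: sub_sigma_algebra => /=.
rewrite -bigcup_seq/=; exists i => /=; first by rewrite mem_index_enum.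
by exists Y => //; rewrite setTI.
Qed.

Lemma measurable_row_of_tuple : measurable_fun [set: d.-tuple R] row_of_tuple.
Proof.
have coordsE i : coords i \o row_of_tuple = fun t => tnth t i.
  by apply/funext => t /=; rewrite /coords mxE.
apply: (@measurability _ _ _ _ _ _
  (\big[setU/set0]_(i < d) preimage_set_system setT (coords i) measurable)) => //.
move=> _ [B + <-]; rewrite setTI -bigcup_seq => -[i _ [A mA <-]].
rewrite setTI -comp_preimage coordsE -[X in measurable X]setTI.
exact: measurable_tnth.
Qed.

Lemma measurable_tuple_of_row : measurable_fun [set: 'rV[R]_d] tuple_of_row.
Proof.
apply/measurable_fun_tnthP => i.
rewrite (_ : _ \o _ = coords i)//.
by apply/funext => x /=; rewrite tnth_mktuple.
Qed.

Definition lebesgue_row : {sigma_finite_measure set 'rV[R]_d -> \bar R} :=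
  sigma_finite_image (tuple_measure lebesgue_measure d)
    measurable_row_of_tuple measurable_tuple_of_row row_of_tupleK.

Definition enorm (x : 'rV[R]_d) : R := Num.sqrt (\sum_i x ord0 i ^+ 2).

Definition eball (x : 'rV[R]_d) (r : R) : set 'rV[R]_d :=
  [set y | enorm (y - x) <= r].

End measurable_row.

Section configurations.
Context (R : realType) (d : nat).
Notation E := 'rV[R]_d.

(* Points carry no multiplicity, so that configurations are the simple
   locally finite counting measures, and every point process is simple. *)
Definition locally_finite (A : set E) :=
  forall K, compact K -> finite_set (A `&` K).

Record config := Config { points :> set E ; points_lf : locally_finite points }.

HB.instance Definition _ := gen_eqMixin config.
HB.instance Definition _ := gen_choiceMixin config.

Let lf0 : locally_finite set0.
Proof. by move=> K _; rewrite set0I. Qed.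

HB.instance Definition _ := isPointed.Build config (Config lf0).

Definition count_events : set_system config :=
  [set S | exists (B : set E) (n : nat), measurable B /\
     S = [set X : config | counting (X `&` B) = n%:R%:E :> \bar R]].

Let count_set0 : <<s count_events >> set0.
Proof. exact: sigma_algebra0. Qed.

Let count_setC A : <<s count_events >> A -> <<s count_events >> (~` A).
Proof. exact: sigma_algebraC. Qed.

Let count_bigcup (F : (set config)^nat) :
  (forall i, <<s count_events >> (F i)) -> <<s count_events >> (\bigcup_i F i).
Proof. exact: sigma_algebra_bigcup. Qed.

HB.instance Definition _ := @isMeasurable.Build (sigma_display count_events)
  config <<s count_events >> count_set0 count_setC count_bigcup.

Let lf_restrict (X : config) (B : set E) : locally_finite (X `&` B).
Proof.
by move=> K cK; rewrite setIAC; apply: finite_setIl; exact: points_lf.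
Qed.

Definition restrict (X : config) (B : set E) : config :=
  Config (lf_restrict X B).

Let lf_union (X Y : config) : locally_finite (X `|` Y).
Proof.
by move=> K cK; rewrite setIUl finite_setU; split; exact: points_lf.
Qed.

Definition union (X Y : config) : config := Config (lf_union X Y).

Let lf_shift (y : E) (X : config) : locally_finite [set x + y | x in X].
Proof.
move=> K cK.
have cK' : compact [set x - y | x in K].
  apply: continuous_compact => //; apply: continuous_subspaceT => x.
  exact: (cvgB cvg_id (cvg_cst y)).
apply: (@sub_finite_set _ _ [set x + y | x in X `&` [set x - y | x in K]]).
  move=> _ [[x Xx <-] Kxy]; exists x => //; split => //.
  by exists (x + y) => //; rewrite addrK.
by apply: finite_image; exact: points_lf.
Qed.

Definition shift (y : E) (X : config) : config := Config (lf_shift y X).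

Definition shift_tuple k (y : E) (xs : k.-tuple E) : k.-tuple E :=
  [tuple of map (fun x => x + y) xs].

Definition distinct_tuples k (X : config) : set (k.-tuple E) :=
  [set xs : k.-tuple E | uniq xs /\ forall i, points X (tnth xs i)].

End configurations.
Arguments distinct_tuples {R d} k X.

Section point_process.
Context (R : realType) (d : nat).
Context (disp : measure_display) (Omega : measurableType disp).
Context (Pr : probability Omega R) (P : Omega -> config R d).
Notation E := 'rV[R]_d.

Definition stationary := forall (y : E) (A : set (config R d)), measurable A ->
  Pr ((shift y \o P) @^-1` A) = Pr (P @^-1` A).

Definition moment_measure k (B : set (k.-tuple E)) : \bar R :=
  (\int[Pr]_w counting (distinct_tuples k (P w) `&` B))%E.

Record correlation_function k (rho : k.-tuple E -> R) : Prop := {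
  correlation_measurable : measurable_fun setT rho ;
  correlation_ge0 : forall xs, 0 <= rho xs ;
  correlation_density : forall B, measurable B ->
    moment_measure B =
      (\int[tuple_measure (lebesgue_row R d) k]_(xs in B) (rho xs)%:E)%E ;
  (* As the process is stationary, the density can be taken translation
     invariant; this gives a meaning to its values on k-tuples containing 0. *)
  correlation_shift : forall y xs, rho (shift_tuple y xs) = rho xs }.

Record admissible (rho : forall k, k.-tuple E -> R) : Prop := {
  admissible_stationary : stationary ;
  admissible_correlation : forall k, (0 < k)%N -> correlation_function (rho k) ;
  admissible_intensity : 0 < rho 1%N [tuple 0] }.

Record palm_probabilities
    (palm : forall k, k.-tuple E -> probability (config R d) R) : Prop := {
  palm_measurable : forall k A, (0 < k)%N -> measurable A ->
    measurable_fun [set: k.-tuple E] (palm k ^~ A : _ -> \bar R) ;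
  palm_campbell : forall k (f : k.-tuple E * config R d -> \bar R), (0 < k)%N ->
    measurable_fun setT f -> (forall z, 0 <= f z)%E ->
    (\int[Pr]_w \esum_(xs in distinct_tuples k (P w)) f (xs, P w))%E =
    (\int[@moment_measure k]_xs \int[palm k xs]_X f (xs, X))%E ;
  (* Translation covariant version, which is how E_0 is defined for a
     stationary process. *)
  palm_shift : forall k y xs A, (0 < k)%N -> measurable A ->
    palm k (shift_tuple y xs) A = palm k xs (shift y @^-1` A) }.

End point_process.

(* The index n ranges over {1, 2, ..., oo}; [None] stands for oo. *)
Definition valid_index (n : option nat) : bool :=
  if n is Some m then (0 < m)%N else true.

Definition window (R : realType) (d : nat) (n : option nat) : set 'rV[R]_d :=
  if n is Some m then
    [set x | forall i, `|x ord0 i| <= 2^-1 * m%:R `^ d%:R^-1]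
  else setT.
Arguments window {R d} n.

Section scores.
Context (R : realType) (d : nat).
Notation E := 'rV[R]_d.

Record score_function (xi : E -> config R d -> R) : Prop := {
  score_measurable_point : forall X, measurable_fun setT (xi^~ X) ;
  score_measurable_config : forall x, measurable_fun setT (xi x) ;
  score_out : forall x (X : config R d), ~ points X x -> xi x X = 0 ;
  score_shift : forall y x X, xi (x + y) (shift y X) = xi x X }.

Variable xi : E -> config R d -> R.

Definition stabilizes_at x (X : config R d) (r : nat) :=
  forall A : config R d,
    xi x (restrict X (eball x r%:R)) =
    xi x (union (restrict X (eball x r%:R)) (restrict A (~` eball x r%:R))).

(* R^xi(x, X): the infimum is +oo if [xi] does not stabilize *)
Definition radius x (X : config R d) : \bar R :=
  ereal_inf [set r%:R%:E | r in [set r | (0 < r)%N /\ stabilizes_at x X r]].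

End scores.

Definition fast_decreasing (R : realType) (phi : R -> R) :=
  [/\ forall t : R, 0 <= t -> 0 <= phi t <= 1,
      forall s t : R, 0 <= s -> s <= t -> phi t <= phi s &
      forall m, (0 < m)%N -> (fun t => t ^+ m * phi t) @ +oo --> 0].

Section conditions.
Context (R : realType) (d : nat).
Context (disp : measure_display) (Omega : measurableType disp).
Context (Pr : probability Omega R) (P : Omega -> config R d).
Notation E := 'rV[R]_d.
Context (rho : forall k, k.-tuple E -> R).
Context (palm : forall k, k.-tuple E -> probability (config R d) R).
Context (xi : E -> config R d -> R).

Let alpha k : set (k.-tuple E) -> \bar R := @moment_measure _ _ _ _ Pr P k.

(* The event {R^xi > t} involves a quantification over all configurations, so
   that it is only universally measurable: its probability is the outer measure,
   i.e. the value of the completed probability. *)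
Definition stabilizing_with (a : nat -> R) (phi : R -> R) :=
  [/\ forall l, (0 < l)%N -> 0 < a l,
      forall t : R, 0 <= t -> 0 <= phi t <= 1,
      forall s t : R, 0 <= s -> s <= t -> phi t <= phi s,
      phi @ +oo --> 0 &
      forall (l : nat) (n : option nat) (t : R), valid_index n -> 0 < t ->
        {ae @alpha l.+1, forall xs, (forall i, window n (tnth xs i)) ->
          (mu_ext (palm xs)
             [set X | t%:E < radius xi (thead xs) (restrict X (window n))]
           <= (phi (a l.+1 * t))%R%:E)%E}].

Definition stabilizing := exists a phi, stabilizing_with a phi.

Definition exponentially_stabilizing := exists a phi,
  stabilizing_with a phi /\
  exists c : R, 0 < c /\
    (-oo < limf_esup (fun t : R => (t `^ (- c))%R%:E * lne (phi t)%:E)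
             (pinfty_nbhs R) < 0)%E.

Definition moment_condition (p : R) := exists C : R,
  forall (k : nat) (n : option nat), (k.+1 <= Num.truncn p)%N -> valid_index n ->
    {ae @alpha k.+1, forall xs, (forall i, window n (tnth xs i)) ->
      ('E_(palm xs)[(fun X =>
         (Num.max `|xi (thead xs) (restrict X (window n))| 1) `^ p)%R] <= C%:E)%E}.

(* These are densities with respect to Lebesgue measure. *)
Definition m1 (n : option nat) (x : E) : \bar R :=
  ('E_(palm [tuple x])[(fun X => xi x (restrict X (window n)))%R]
   * (rho [tuple x])%:E)%E.

Definition m2 (n : option nat) (x y : E) : \bar R :=
  ('E_(palm [tuple x; y])[(fun X =>
     xi x (restrict X (window n)) * xi y (restrict X (window n)))%R]
   * (rho [tuple x; y])%:E)%E.

Definition bounded_correlation k := exists C : R,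
  {ae tuple_measure (lebesgue_row R d) k, forall xs, rho xs <= C}.

Definition fast_decay2 := exists phi (C c : R),
  [/\ fast_decreasing phi, 0 < c &
      forall n, valid_index n ->
        {ae tuple_measure (lebesgue_row R d) 2, forall xs,
          let x1 := tnth xs ord0 in let x2 := tnth xs ord_max in
          x1 != x2 ->
          (`|m2 n x1 x2 - m1 n x1 * m1 n x2|
           <= (C * phi (c * enorm (x1 - x2)))%R%:E)%E}].

(* The integral of [f] against the finite atomic signed measure mu_n^xi *)
Definition xi_sum (n : nat) (f : E -> R) (w : Omega) : R :=
  let Xn := restrict (P w) (window (Some n)) in
  \sum_(x \in (Xn : set E)) xi x Xn * f (n%:R `^ (- d%:R^-1) *: x).

Definition sigma2 : \bar R :=
  ('E_(palm [tuple 0%R])[(fun X => xi 0 X ^+ 2)%R] * (rho [tuple 0%R])%:E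
   + \int[lebesgue_row R d]_x (m2 None 0%R x - m1 None 0%R ^+ 2))%E.

Definition mean_error (n : nat) (f : E -> R) : \bar R :=
  (`|(n%:R^-1)%R%:E * 'E_Pr[xi_sum n f]
     - 'E_(palm [tuple 0%R])[xi 0%R] * (rho [tuple 0%R])%:E
       * \int[lebesgue_row R d]_(x in window (Some 1%N)) (f x)%:E|)%E.

End conditions.

Definition bounded_measurable (R : realType) (d : nat) (f : 'rV[R]_d -> R) :=
  measurable_fun (window (Some 1%N)) f /\
  [bounded f x | x in window (Some 1%N)].

(* Main.v *)
(* Campbell's formula turns the first two moments of the linear statistics into
   integrals of Palm means over the window W_n. At distance at least t from the
   boundary of W_n, stabilization makes the score in W_n agree with the score in
   the whole space outside an event of Palm probability at most phi(a_l t), and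
   the p-moment condition turns this into closeness of the Palm means, through
   the truncation y <= M + M^(1-r) y^r for y >= 0 (in place of Hoelder's
   inequality). The unit layers parallel to the boundary of W_n have volume
   O(n / n^(1/d)); their errors tend to zero, and are summable when phi decays
   exponentially. This gives (i).

   For (ii), the covariance is a diagonal term, to which (i) applies with xi^2
   for xi, plus the double integral of f(n^(-1/d) x) g(n^(-1/d) y) c_n(x, y), with
   c_n(x, y) = m_2(x, y; n) - m_1(x; n) m_1(y; n). Fast decay dominates c_n by an
   integrable function of y - x, so that only the pairs at bounded distance from
   each other and far from the boundary matter; for these, c_n is close to its
   stationary limit c(y - x). After the substitution z = y - x, continuity of
   translations in L^1 and dominated convergence identify the limit. *)

Require Import Defs.
From HB Require Import structures.
From mathcomp Require Import all_boot all_order all_algebra.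
From mathcomp Require Import all_classical all_reals all_analysis.
From mathcomp Require Import measurable_realfun.
From mathcomp Require Import ring lra zify.
Set SsrOldRewriteGoalsOrder.
Set Implicit Arguments.
Unset Strict Implicit.
Unset Printing Implicit Defensive.
Import Order.TTheory GRing.Theory Num.Theory.
Import numFieldNormedType.Exports.
Local Open Scope classical_set_scope.
Local Open Scope ring_scope.

(** * Lebesgue measure on R^d *)

(** The hypotheses on Palm kernels hold almost everywhere for factorial moment measures, while the
    limits involve the point 0 and the pairs (0, u), which are Lebesgue-null. Translation covariance
    bridges the gap: a bound valid almost everywhere holds at some point, or at almost all pairs,
    and is carried to the origin.

    Palm means of products of scores are extended reals. Real kernels are obtained through [fine];
    the decay of m_2 - m_1 m_1 makes it finite off a null set, and there both versions agree.

    The event {R > t} is replaced by the measurable event that the scores in the window and in the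
    whole space differ. Truncation at M then leaves an error 2 M phi + 2 C M^(1 - p/s), for powers s
    < p of the score. For a limit, M is chosen before the depth. For a rate, M grows polynomially
    with the depth, and exponential stabilization enters as decay of phi beyond every power. Since s
    = 2 is allowed when p > 2, one argument serves both for the means and for the diagonal of the
    covariance. *)

Lemma measurable_pushforwardP d1 d2 (X : measurableType d1) (Y : measurableType d2)
  (f : X -> Y) (B : set Y) : measurable_fun setT f -> measurable B -> measurable (f @^-1` B).
Proof. by move=> mf mB; rewrite -[X in measurable X]setTI; exact: mf. Qed.

Section tuple_integral.
Local Open Scope ereal_scope.
Context d (T : measurableType d) (R : realType).
Variable mu : {sigma_finite_measure set T -> \bar R}.

Lemma ge0_integral_tuple0 (F : 0.-tuple T -> \bar R) :
  measurable_fun setT F -> (forall t, 0 <= F t) ->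
  \int[tuple_measure mu 0]_t F t = F [tuple].
Proof.
by move=> mF F0; rewrite (@integral_dirac _ _ ([tuple] : 0.-tuple T) R setT measurableT F mF) diracT mul1e.
Qed.

Lemma measurable_tcons_l k (F : k.+1.-tuple T -> \bar R) (x : T) :
  measurable_fun setT F -> measurable_fun setT (fun t => F (tcons (x, t))).
Proof.
move=> mF; apply: measurableT_comp => //.
apply: (measurableT_comp (@measurable_tcons _ T k)).
exact: measurable_pair1.
Qed.

Lemma ge0_integral_tupleS k (F : k.+1.-tuple T -> \bar R) :
  measurable_fun setT F -> (forall t, 0 <= F t) ->
  \int[tuple_measure mu k.+1]_t F t =
  \int[mu]_x \int[tuple_measure mu k]_t F (tcons (x, t)).
Proof.
move=> mF F0.
transitivity (\int[pushforward (mu \x tuple_measure mu k) (@tcons d T k)]_t F t) => //.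
rewrite ge0_integral_pushforward ?preimage_setT//; last exact: measurable_tcons.
rewrite fubini_tonelli1//=.
exact: (measurableT_comp mF (@measurable_tcons _ T k)).
Qed.

Lemma measurable_integral_tuple k (F : k.+1.-tuple T -> \bar R) :
  measurable_fun setT F -> (forall t, 0 <= F t) ->
  measurable_fun setT (fun x => \int[tuple_measure mu k]_t F (tcons (x, t))).
Proof.
move=> mF F0.
apply: (@measurable_fun_fubini_tonelli_F _ _ _ _ _ (tuple_measure mu k) (F \o @tcons d T k)).
  exact: (measurableT_comp mF (@measurable_tcons _ T k)).
by move=> x; exact: F0.
Qed.

End tuple_integral.

Section affine1.
Context (R : realType).
Local Open Scope ereal_scope.
Notation leb := (@lebesgue_measure R).

(** By uniqueness of Lebesgue measure: [a] times its image under x -> a x + b gives every half-open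
    interval its length. *)
Lemma ge0_integral_affine (a b : R) (F : R -> \bar R) : (0 < a)%R ->
  measurable_fun setT F -> (forall x, 0 <= F x) ->
  a%:E * \int[leb]_x F (a * x + b)%R = \int[leb]_x F x.
Proof.
move=> a0 mF F0.
pose f (x : measurableTypeR R) : measurableTypeR R := (a * x + b)%R.
have mf : measurable_fun setT f by apply: measurable_funD => //; exact: measurable_funM.
have [nu nuE] : exists nu : {measure set (measurableTypeR R) -> \bar R},
    nu = mscale (NngNum (ltW a0)) (pushforward leb f) :> (set _ -> \bar R).
  by unshelve eexists (mscale (NngNum (ltW a0)) (pushforward leb f)).
have E A : measurable A -> leb A = nu A.
  apply: lebesgue_measure_unique => _ [[u v]] _ <-.
  rewrite nuE /mscale/= /pushforward.
  have -> : f @^-1` `]u, v] = `]((u - b) / a)%R, ((v - b) / a)%R]%classic.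
    apply/seteqP; split => x /=; rewrite !in_itv/= /f ltr_pdivrMr// ler_pdivlMr//; lra.
  rewrite !lebesgue_measure_itv/= !lte_fin ltr_pM2r ?invr_gt0// ltrBlDr subrK.
  case: ifPn => uv; last by rewrite mule0.
  rewrite -!EFinD -EFinM; congr (_%:E); field; exact/lt0r_neq0.
transitivity (\int[nu]_x F x); last first.
  by apply: eq_measure_integral => A mA _; exact/esym/E.
rewrite nuE ge0_integral_mscale//= ge0_integral_pushforward//.
Qed.

End affine1.

Section affine.
Context (R : realType).
Local Open Scope ereal_scope.
Notation leb := (@lebesgue_measure R).

Definition tuple_affine (a : R) k (b t : k.-tuple R) : k.-tuple R :=
  [tuple a * tnth t i + tnth b i | i < k]%R.

Lemma measurable_tuple_affine a k (b : k.-tuple R) :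
  measurable_fun setT (tuple_affine a b).
Proof.
apply/measurable_fun_tnthP => i.
rewrite (_ : _ \o _ = fun t => a * tnth t i + tnth b i)%R; last first.
  by apply/funext => t /=; rewrite tnth_mktuple.
apply: measurable_funD => //; apply: measurable_funM => //.
exact: measurable_tnth.
Qed.

Lemma tuple_affine_tcons a k (b : k.+1.-tuple R) (x : R) (t : k.-tuple R) :
  tuple_affine a b (tcons (x, t)) =
  tcons ((a * x + thead b)%R, tuple_affine a [tuple of behead b] t).
Proof.
apply: eq_from_tnth => i; rewrite tnth_mktuple.
case: (unliftP ord0 i) => [j|] ->.
  by rewrite !tnthS tnth_mktuple [in LHS](tuple_eta b) tnthS.
by rewrite /tcons !tnth0.
Qed.

(** Tonelli peels off one coordinate at a time, each contributing a factor [a]. *)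
Lemma ge0_integral_tuple_affine a k (b : k.-tuple R) (F : k.-tuple R -> \bar R) :
  (0 < a)%R -> measurable_fun setT F -> (forall x, 0 <= F x) ->
  (a ^+ k)%:E * \int[tuple_measure leb k]_t F (tuple_affine a b t) =
  \int[tuple_measure leb k]_t F t.
Proof.
move=> a0; elim: k b F => [|k IH] b F mF F0.
  rewrite expr0 mul1e.
  rewrite !ge0_integral_tuple0//; last first.
    by apply: (measurableT_comp mF); exact: measurable_tuple_affine.
  by congr F; rewrite tuple0; exact/esym/tuple0.
have mFa : measurable_fun setT (fun t => F (tuple_affine a b t)).
  by apply: (measurableT_comp mF); exact: measurable_tuple_affine.
rewrite [RHS]ge0_integral_tupleS// [in LHS]ge0_integral_tupleS//.
rewrite -[RHS](@ge0_integral_affine R a (thead b))//; last 2 first.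
- exact: (@measurable_integral_tuple _ _ _ leb k F).
- by move=> x; apply: integral_ge0.
rewrite exprS EFinM -muleA; congr (_ * _).
rewrite -ge0_integralZl//.
- apply: eq_integral => x _; rewrite -[RHS](IH [tuple of behead b] (fun t => F (tcons (_, t))))//.
  + by congr (_ * _); apply: eq_integral => t _; rewrite tuple_affine_tcons.
  + exact: measurable_tcons_l.
- exact: (@measurable_integral_tuple _ _ _ leb k (fun t => F (tuple_affine a b t))).
- by move=> x _; apply: integral_ge0.
- by rewrite lee_fin exprn_ge0// ltW.
Qed.

Lemma ge0_integral_row d (F : 'rV[R]_d -> \bar R) :
  measurable_fun setT F -> (forall x, 0 <= F x) ->
  \int[lebesgue_row R d]_x F x = \int[tuple_measure leb d]_t F (row_of_tuple t).
Proof.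
move=> mF F0.
transitivity (\int[pushforward (tuple_measure leb d) (@row_of_tuple R d)]_t F t) => //.
by rewrite ge0_integral_pushforward ?preimage_setT//; exact: measurable_row_of_tuple.
Qed.

End affine.

Section row_affine.
Context (R : realType) (d : nat).
Local Open Scope ereal_scope.
Notation E := 'rV[R]_d.
Notation lam := (lebesgue_row R d).

Lemma measurable_coord (i : 'I_d) : measurable_fun setT (fun x : E => x ord0 i).
Proof.
rewrite (_ : (fun x : E => _) = (fun t => tnth t i) \o @tuple_of_row R d); last first.
  by apply/funext => x /=; rewrite tnth_mktuple.
apply: measurableT_comp; first exact: measurable_tnth.
exact: measurable_tuple_of_row.
Qed.

Lemma measurable_rowP d1 (T : measurableType d1) (f : T -> E) :
  (forall i, measurable_fun setT (fun x => f x ord0 i)) -> measurable_fun setT f.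
Proof.
move=> mf; rewrite (_ : f = @row_of_tuple R d \o (fun x => tuple_of_row (f x))).
  apply: measurableT_comp; first exact: measurable_row_of_tuple.
  apply/measurable_fun_tnthP => i; rewrite (_ : _ \o _ = fun x => f x ord0 i)//.
  by apply/funext => x /=; rewrite tnth_mktuple.
by apply/funext => x /=; apply/rowP => i; rewrite mxE tnth_mktuple.
Qed.

Lemma measurable_rowD d1 (T : measurableType d1) (f g : T -> E) :
  measurable_fun setT f -> measurable_fun setT g ->
  measurable_fun setT (fun x => f x + g x)%R.
Proof.
move=> mf mg; apply: measurable_rowP => i.
rewrite (_ : (fun x => _) = fun x => (f x ord0 i + g x ord0 i)%R); last first.
  by apply/funext => x; rewrite mxE.
by apply: measurable_funD; exact: (measurableT_comp (measurable_coord i)).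
Qed.

Lemma measurable_rowZ d1 (T : measurableType d1) a (f : T -> E) :
  measurable_fun setT f -> measurable_fun setT (fun x => a *: f x)%R.
Proof.
move=> mf; apply: measurable_rowP => i.
rewrite (_ : (fun x => _) = fun x => (a * f x ord0 i)%R); last first.
  by apply/funext => x; rewrite mxE.
by apply: measurable_funM => //; exact: (measurableT_comp (measurable_coord i)).
Qed.

Lemma measurable_rowB d1 (T : measurableType d1) (f g : T -> E) :
  measurable_fun setT f -> measurable_fun setT g ->
  measurable_fun setT (fun x => f x - g x)%R.
Proof.
move=> mf mg; apply: measurable_rowD => //.
rewrite (_ : (fun x => _) = fun x => ((-1) *: g x)%R); first exact: measurable_rowZ.
by apply/funext => x; rewrite scaleN1r.
Qed.

Lemma ge0_integral_row_affine (a : R) (b : E) (F : E -> \bar R) : (0 < a)%R ->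
  measurable_fun setT F -> (forall x, 0 <= F x) ->
  (a ^+ d)%:E * \int[lam]_x F (a *: x + b)%R = \int[lam]_x F x.
Proof.
move=> a0 mF F0.
have mr := @measurable_row_of_tuple R d.
rewrite !ge0_integral_row//; last first.
  by apply: measurableT_comp => //; apply: measurable_rowD => //; exact: measurable_rowZ.
rewrite -[RHS](@ge0_integral_tuple_affine R a d (tuple_of_row b))//; last first.
  exact: (measurableT_comp mF mr).
congr (_ * _); apply: eq_integral => t _; congr F.
by apply/rowP => i; rewrite !mxE tnth_mktuple tnth_mktuple.
Qed.

Lemma ge0_integral_shift (b : E) (F : E -> \bar R) :
  measurable_fun setT F -> (forall x, 0 <= F x) ->
  \int[lam]_x F (x + b)%R = \int[lam]_x F x.
Proof.
move=> mF F0; rewrite -[RHS](@ge0_integral_row_affine 1 b F)// expr1n mul1e.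
by apply: eq_integral => x _; rewrite scale1r.
Qed.

Lemma ge0_integral_scale (a : R) (F : E -> \bar R) : (0 < a)%R ->
  measurable_fun setT F -> (forall x, 0 <= F x) ->
  (a ^+ d)%:E * \int[lam]_x F (a *: x)%R = \int[lam]_x F x.
Proof.
move=> a0 mF F0; rewrite -[RHS](@ge0_integral_row_affine a 0%R F)//.
by congr (_ * _); apply: eq_integral => x _; rewrite addr0.
Qed.

End row_affine.

Section box.
Context (R : realType).
Local Open Scope ereal_scope.
Notation leb := (@lebesgue_measure R).

Lemma tuple_measure_box k (B : 'I_k -> set R) : (forall i, measurable (B i)) ->
  tuple_measure leb k [set t | forall i, B i (tnth t i)] = \prod_(i < k) leb (B i).
Proof.
elim: k B => [|k IH] B mB.
  have -> : [set t : 0.-tuple R | forall i, B i (tnth t i)] = setT.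
    by apply/seteqP; split => // t _ [].
  by rewrite big_ord0 /= diracT.
have mBk l (C : 'I_l -> set R) : (forall i, measurable (C i)) ->
    measurable [set t : l.-tuple R | forall i, C i (tnth t i)].
  move=> mC; rewrite (_ : [set t : l.-tuple R | _] = \bigcap_(i in [set: 'I_l]) ((fun t => tnth t i) @^-1` C i)).
    apply: fin_bigcap_measurable => // i _; apply: measurable_pushforwardP => //.
    exact: measurable_tnth.
  by apply/seteqP; split => t /= h i; [move=> _|]; exact: h.
transitivity ((leb \x tuple_measure leb k)
  (B ord0 `*` [set t | forall i, B (lift ord0 i) (tnth t i)])).
  congr ((leb \x tuple_measure leb k) _).
  apply/seteqP; split => -[x t] /=.
    move=> h; split; first by have := h ord0; rewrite tnth0.
    by move=> i; have := h (lift ord0 i); rewrite tnthS.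
  move=> [h0 h] i; case: (unliftP ord0 i) => [j|] ->; first by rewrite tnthS.
  by rewrite tnth0.
rewrite big_ord_recl -(IH (fun i => B (lift ord0 i)))//.
apply: product_measure1E; first exact: mB.
exact: (mBk _ (fun i => B (lift ord0 i))  (fun i => mB (lift ord0 i))).
Qed.

Lemma measurable_box d (B : 'I_d -> set R) : (forall i, measurable (B i)) ->
  measurable [set x : 'rV[R]_d | forall i, B i (x ord0 i)].
Proof.
move=> mB; rewrite (_ : [set x : 'rV[R]_d | _] = \bigcap_(i in [set: 'I_d]) ((fun x : 'rV[R]_d => x ord0 i) @^-1` B i)).
  apply: fin_bigcap_measurable => // i _; apply: measurable_pushforwardP => //.
  exact: measurable_coord.
by apply/seteqP; split => t /= h i; [move=> _|]; exact: h.
Qed.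

Lemma lebesgue_row_box d (B : 'I_d -> set R) : (forall i, measurable (B i)) ->
  lebesgue_row R d [set x | forall i, B i (x ord0 i)] = \prod_(i < d) leb (B i).
Proof.
move=> mB; rewrite -tuple_measure_box//.
congr (tuple_measure leb d _).
by apply/seteqP; split => t /= h i; have := h i; rewrite mxE.
Qed.

End box.

(** * Windows and measurability of configuration functionals *)

Section finite_transition.
Local Open Scope ereal_scope.
Context d d' (Z : measurableType d) (Y : measurableType d') (R : realType).
Variable l : Z -> {measure set Y -> \bar R}.
Hypothesis ml : forall U, measurable U -> measurable_fun setT (l ^~ U).
Hypothesis l_fin : forall z, l z setT < +oo.

Let xsectionT z : xsection [set: Z * Y] z = setT.
Proof. by apply/seteqP; split => // y _; rewrite /xsection/= inE. Qed.

(** The measures [l z] are finite but not uniformly bounded in z, as for the number of points of a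
    configuration in a window. Dynkin's lemma on rectangles copes with this: finiteness of each
    single [l z] is what complements require. *)
Lemma measurable_transition_xsection D : measurable D ->
  measurable_fun setT (fun z => l z (xsection D z)).
Proof.
rewrite measurable_prod_measurableType.
apply: (dynkin_induction (P := fun D => measurable_fun setT (fun z => l z (xsection D z)))).
- by rewrite measurable_prod_measurableType.
- move=> _ _ [A1 mA1 [A2 mA2 <-]] [B1 mB1 [B2 mB2 <-]].
  exists (A1 `&` B1); first exact: measurableI.
  by exists (A2 `&` B2); [exact: measurableI|rewrite setXI].
- by under eq_fun do rewrite xsectionT; exact: ml.
- move=> _ [A mA [B mB <-]].
  rewrite (_ : (fun z => _) = fun z => (\1_A z)%:E * l z B); last first.
    apply/funext => z; rewrite indicE; have [zA|zA] := boolP (z \in A).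
      by rewrite in_xsectionX// mul1e.
    by rewrite notin_xsectionX// measure0 mul0e.
  apply: emeasurable_funM; last exact: ml.
  exact/measurable_EFinP.
- move=> S mS h.
  rewrite (_ : (fun z => _) = fun z => l z setT - l z (xsection S z)); last first.
    apply/funext => z; rewrite -setTD xsectionD xsectionT.
    rewrite measureD ?setTI//; try exact: measurable_xsection.
    by have := l_fin z.
  apply: emeasurable_funB => //; exact: ml.
- move=> F mF tF h.
  rewrite (_ : (fun z => _) = fun z => \sum_(k <oo) l z (xsection (F k) z)); last first.
    apply/funext => z; rewrite xsection_bigcup measure_semi_bigcup//.
    + by move=> n; exact: measurable_xsection.
    + exact: trivIset_xsection.
    + by apply: bigcup_measurable => n _; exact: measurable_xsection.
  by apply: ge0_emeasurable_sum.
Qed.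

Import HBNNSimple.

Lemma measurable_transition_integral (k : Z * Y -> \bar R) :
  (forall z, 0 <= k z) -> measurable_fun setT k ->
  measurable_fun setT (fun z => \int[l z]_y k (z, y)).
Proof.
move=> k0 mk.
pose k_ := nnsfun_approx measurableT mk.
apply: (@measurable_fun_xsection_integral _ _ _ _ _ k l k_).
- by move=> a b ab; exact/nd_nnsfun_approx.
- by move=> z; exact/cvg_nnsfun_approx.
- move=> n r; apply: measurable_transition_xsection.
  by apply: measurable_pushforwardP => //; exact: measurable_funP.
Qed.

End finite_transition.

Section finite_sums.
Local Open Scope ereal_scope.
Context d (T : measurableType d) (R : realType).

(** The counting measure of a finite set, written as a finite sum of Dirac masses so that its
    integrals are finite sums; [x0] is only the default value of [nth]. *)
Definition sum_dirac (x0 : T) (A : set T) : set T -> \bar R :=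
  msum (fun i => \d_(nth x0 (finmap.enum_fset (fset_set A)) i)) (size (finmap.enum_fset (fset_set A))).

HB.instance Definition _ (x0 : T) (A : set T) := Measure.on (sum_dirac x0 A).

Lemma ge0_integral_sum_dirac x0 A (F : T -> \bar R) : finite_set A ->
  measurable_fun setT F -> (forall x, 0 <= F x) ->
  \int[sum_dirac x0 A]_x F x = \sum_(x \in A) F x.
Proof.
move=> finA mF F0; rewrite /sum_dirac ge0_integral_measure_sum//=.
rewrite fsbig_finite//= (big_nth x0) big_mkord; apply: eq_bigr => i _.
by rewrite integral_dirac// diracT mul1e.
Qed.

Lemma counting_fsum (A : set T) : finite_set A ->
  counting A = \sum_(x \in A) (1%R : R)%:E.
Proof.
move=> finA; rewrite /counting asboolT// fsbig_finite//= sumEFin.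
by rewrite big_const_seq count_predT iter_addr addr0.
Qed.

Lemma sum_diracE x0 A B : finite_set A -> measurable B ->
  sum_dirac x0 A B = counting (A `&` B).
Proof.
move=> finA mB.
rewrite counting_fsum; last exact: finite_setIl.
rewrite fsbig_mkcondr -[in LHS](setIT B) -integral_indic// ge0_integral_sum_dirac//.
  by apply: eq_fsbigr => x _; rewrite indicE; case: ifP.
exact/measurable_EFinP.
Qed.

End finite_sums.

Section windows.
Context (R : realType) (d : nat).
Notation E := 'rV[R]_d.

Definition side (n : nat) : R := n%:R `^ d%:R^-1.

Lemma side_ge0 n : 0 <= side n. Proof. exact: powR_ge0. Qed.

Lemma side_gt0 n : (0 < n)%N -> 0 < side n.
Proof. by move=> n0; rewrite powR_gt0// ltr0n. Qed.

Lemma side_pow n : (0 < d)%N -> side n ^+ d = n%:R.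
Proof.
move=> d0; rewrite -powR_mulrn ?side_ge0// -powRrM mulVf ?pnatr_eq0 -?lt0n//.
by rewrite powRr1.
Qed.

Lemma le_side m n : (m <= n)%N -> side m <= side n.
Proof.
by move=> mn; apply: ge0_ler_powR; rewrite ?nnegrE ?invr_ge0// ler_nat.
Qed.

Lemma side_ge (M : R) : (0 < d)%N -> exists m, forall n, (m <= n)%N -> M <= side n.
Proof.
move=> d0; exists (Num.truncn (`|M| ^+ d)).+1 => n mn.
apply: (le_trans (ler_norm M)).
rewrite -[leLHS]powRr1//; have -> : 1 = d%:R * d%:R^-1 :> R by rewrite mulfV// pnatr_eq0 -lt0n.
rewrite powRrM; apply: ge0_ler_powR; rewrite ?nnegrE ?invr_ge0 ?powR_ge0//.
rewrite powR_mulrn//; apply: (le_trans (ltW (truncnS_gt _))).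
by rewrite ler_nat.
Qed.

Lemma windowE n : window (Some n) =
  [set x : E | forall i, `[- (2^-1 * side n), 2^-1 * side n]%classic (x ord0 i)].
Proof.
by apply/seteqP; split => x /= h i; have := h i; rewrite /= in_itv/= ler_norml.
Qed.

Lemma measurable_window n : measurable (window n : set E).
Proof.
case: n => [n|]; last exact: measurableT.
rewrite windowE; apply: (@measurable_box R d (fun=> `[- (2^-1 * side n), 2^-1 * side n]%classic)).
by move=> i; exact: measurable_itv.
Qed.

Lemma compact_window n : compact (window (Some n) : set E).
Proof.
rewrite windowE; apply: (@rV_compact R d (fun=> `[- (2^-1 * side n), 2^-1 * side n]%classic)).
by move=> i; exact: segment_compact.
Qed.

Lemma subset_window m n : (m <= n)%N -> (window (Some m) : set E) `<=` window (Some n).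
Proof.
move=> mn x /= h i; apply: (le_trans (h i)).
by rewrite ler_pM2l// le_side.
Qed.

Lemma window_cover (x : E) : exists m, forall n, (m <= n)%N -> window (Some n) x.
Proof.
have [d0|] := ltnP 0 d; last first.
  rewrite leqn0 => /eqP d0; exists 0%N => n _ i; exfalso.
  by have := ltn_ord i; rewrite {2}d0.
have [m h] := side_ge (2 * \sum_i `|x ord0 i|) d0.
exists m => n /h {}h i; have : `|x ord0 i| <= \sum_i `|x ord0 i|.
  by rewrite (bigD1 i)//= lerDl sumr_ge0.
rewrite -/(side n); lra.
Qed.

Lemma finite_window (X : config R d) n : finite_set (points X `&` window (Some n)).
Proof. by apply: points_lf; exact: compact_window. Qed.

Lemma measurable_row_set1 (x : E) : measurable [set x].
Proof.
rewrite (_ : [set x] = [set y : E | forall i, [set x ord0 i] (y ord0 i)]).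
  apply: (@measurable_box R d (fun i => [set x ord0 i])) => i.
  exact: measurable_set1.
apply/seteqP; split => [_ -> //|y /= h].
by apply/rowP => i; have := h i.
Qed.

End windows.

Section config_measurability.
Context (R : realType) (d : nat).
Notation E := 'rV[R]_d.
Notation cfg := (config R d).
Local Open Scope ereal_scope.

(** The generating events prescribe finite counts only; the value +oo is taken on the complement of
    their union. *)
Lemma measurable_counting (B : set E) : measurable B ->
  measurable_fun setT (fun X : cfg => counting (points X `&` B) : \bar R).
Proof.
move=> mB _ Y mY; rewrite setTI.
pose S n : set cfg := [set X | counting (points X `&` B) = n%:R%:E :> \bar R].
have mS n : measurable (S n) by apply: sub_sigma_algebra; exists B, n.
have mc (Q : Prop) : measurable [set X : cfg | Q].
  have [q|nq] := pselect Q.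
    by rewrite (_ : [set X | Q] = setT)//; apply/seteqP; split.
  by rewrite (_ : [set X | Q] = set0)//; apply/seteqP; split.
rewrite (_ : _ @^-1` Y = (\bigcup_n (S n `&` [set X | Y n%:R%:E])) `|`
    (~` (\bigcup_n S n) `&` [set X | Y +oo])).
  apply: measurableU.
    by apply: bigcupT_measurable => n; exact: measurableI.
  by apply: measurableI => //; apply: measurableC; exact: bigcupT_measurable.
apply/seteqP; split => X /=.
  rewrite /counting; case: ifPn => fX YX; [left|right].
    exists (size (finmap.enum_fset (fset_set (points X `&` B)))) => //; split => //.
    by rewrite /S/= /counting fX.
  split => //; case=> n _; rewrite /S/= /counting.
  by rewrite (negbTE fX).
case=> [[n _ []]|[]]; first by rewrite /S/= => ->.
rewrite /counting; case: ifPn => // fX []; exists (size (finmap.enum_fset (fset_set (points X `&` B)))) => //.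
by rewrite /S/= /counting fX.
Qed.

(** The sum is an integral against the counting measure of the finitely many points of [X z] in the
    window, and this measure depends measurably on z. *)
Lemma measurable_window_fsum dz (Z : measurableType dz) (X : Z -> cfg) n
    (F : Z * E -> \bar R) :
  measurable_fun setT X -> measurable_fun setT F -> (forall z, 0 <= F z) ->
  measurable_fun setT
    (fun z => \sum_(y \in points (X z) `&` window (Some n)) F (z, y)).
Proof.
move=> mX mF F0.
pose l z := sum_dirac R (0%R : E) (points (X z) `&` window (Some n)).
rewrite (_ : (fun z => _) = fun z => \int[l z]_y F (z, y)); last first.
  apply/funext => z; rewrite ge0_integral_sum_dirac//; first exact: finite_window.
  exact: measurableT_comp.
have lE z U : measurable U -> l z U = counting (points (X z) `&` (window (Some n) `&` U)).
  by move=> mU; rewrite setIA; apply: sum_diracE => //; exact: finite_window.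
apply: (@measurable_transition_integral _ _ _ _ _ l) => //.
- move=> U mU; rewrite (_ : (fun z => _) =
    (fun X => counting (points X `&` (window (Some n) `&` U))) \o X); last first.
    by apply/funext => z; exact: lE.
  apply: measurableT_comp => //; apply: measurable_counting.
  by apply: measurableI => //; exact: measurable_window.
- move=> z; suff : counting (points (X z) `&` (window (Some n) `&` setT)) < +oo :> \bar R by rewrite -lE.
  by rewrite setIT /counting asboolT ?ltry//; exact: finite_window.
Qed.

Lemma measurable_configP dz (Z : measurableType dz) (f : Z -> cfg) :
  (forall B, measurable B -> measurable_fun setT (fun z => counting (points (f z) `&` B) : \bar R)) ->
  measurable_fun setT f.
Proof.
move=> mf; apply: (@measurability _ _ _ _ _ _ (@count_events R d)) => //.
move=> _ [_ [B [n [mB ->]] <-]]; rewrite setTI.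
apply: (measurable_pushforwardP (B := [set n%:R%:E]) (mf B mB)).
exact: emeasurable_set1.
Qed.

Lemma measurable_restrict_window n : measurable_fun setT (fun X : cfg => Defs.restrict X (window n)).
Proof.
apply: measurable_configP => B mB.
rewrite (_ : (fun z => _) = fun X : cfg => counting (points X `&` (window n `&` B)) : \bar R).
  apply: measurable_counting; apply: measurableI => //; exact: measurable_window.
by apply/funext => X; rewrite setIA.
Qed.

(** Joint measurability in the vector and in the configuration: the number of shifted points in B is
    the increasing limit, over the windows, of sums of the indicator of B at x + y. *)
Lemma measurable_shift dz (Z : measurableType dz) (y : Z -> E) (X : Z -> cfg) :
  measurable_fun setT y -> measurable_fun setT X ->
  measurable_fun setT (fun z => Defs.shift (y z) (X z)).
Proof.
move=> my mX; apply: measurable_configP => B mB.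
pose F (p : Z * E) : \bar R := (\1_B (p.2 + y p.1)%R)%:E.
have mF : measurable_fun setT F.
  apply/measurable_EFinP; apply: measurableT_comp => //.
  by apply: measurable_rowD => //; exact: measurableT_comp.
pose s n z := \sum_(x \in points (X z) `&` window (Some n)) F (z, x).
apply: (@emeasurable_fun_cvg _ _ _ _ s).
  by move=> n; apply: measurable_window_fsum => // p; rewrite lee_fin.
move=> z _.
pose C n : set E := [set (x + y z)%R | x in points (X z) `&` window (Some n)] `&` B.
have finC n : finite_set (C n).
  by apply: finite_setIl; apply: finite_image; exact: finite_window.
have mC n : measurable (C n).
  have -> : C n = \bigcup_(x in C n) [set x].
    by apply/seteqP; split => [u Cu|u [_ Cu ->]//]; exists u.
  by apply: fin_bigcup_measurable => // x _; exact: measurable_row_set1.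
have -> : points (Defs.shift (y z) (X z)) `&` B = \bigcup_n C n.
  apply/seteqP; split => [_ [[x Xx <-] Bx]|x [n _ [[u [Xu _] <-] Bx]]].
    have [m hm] := window_cover x; exists m => //; split => //.
    by exists x => //; split => //; exact: hm.
  by split => //; exists u.
have -> : s ^~ z = counting \o C.
  apply/funext => n /=; rewrite counting_fsum// fsbig_mkcondr fsbig_image; last first.
    by move=> u v _ _ /addIr.
  by apply: eq_fsbigr => x _; rewrite /F indicE/=; case: ifP.
apply: nondecreasing_cvg_mu => //; first exact: bigcupT_measurable.
move=> m n mn; apply/subsetPset => x [[u [Xu Wu] <-] Bx]; split => //.
by exists u => //; split => //; exact: subset_window Wu.
Qed.

(** A score is assumed measurable in each argument separately. Translation covariance moves the
    point to the origin, and joint measurability follows from that of the shift. *)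
Lemma measurable_score dz (Z : measurableType dz) (xi : E -> cfg -> R) (x : Z -> E) (X : Z -> cfg) :
  score_function xi -> measurable_fun setT x -> measurable_fun setT X ->
  measurable_fun setT (fun z => xi (x z) (X z)).
Proof.
move=> hxi mx mX.
rewrite (_ : (fun z => _) = fun z => xi 0%R (Defs.shift (- x z)%R (X z))); last first.
  by apply/funext => z; rewrite -[LHS](score_shift hxi (- x z)) subrr.
apply: (measurableT_comp (score_measurable_config hxi 0%R)).
apply: measurable_shift => //.
rewrite (_ : (fun z => _) = fun z => ((-1) *: x z)%R); first exact: measurable_rowZ.
by apply/funext => z; rewrite scaleN1r.
Qed.

End config_measurability.

(** * Campbell formulas and Palm means *)

Section density.
Local Open Scope ereal_scope.
Context d (T : measurableType d) (R : realType).

Import HBNNSimple.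

(** [moment_measure] is a bare set function. Its integral is still a supremum over simple functions,
    so it can be exchanged for that of a genuine measure with the same values on measurable sets. *)
Lemma eq_setfun_integral (m1 m2 : set T -> \bar R) (f : T -> \bar R) :
  (forall A, measurable A -> m1 A = m2 A) -> \int[m1]_x f x = \int[m2]_x f x.
Proof.
move=> m12.
have E (g : T -> \bar R) :
  ereal_sup [set sintegral m1 h | h in [set h : {nnsfun T >-> R} | forall x, (h x)%:E <= g x]] =
  ereal_sup [set sintegral m2 h | h in [set h : {nnsfun T >-> R} | forall x, (h x)%:E <= g x]].
  congr ereal_sup; apply: eq_imagel => h _.
  rewrite /sintegral; apply: eq_fsbigr => r _; rewrite m12//.
by rewrite /integral; rewrite !E.
Qed.

Variables (mu : {measure set T -> \bar R}) (f : T -> R).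
Hypothesis mf : measurable_fun setT f.
Hypothesis f0 : forall x, (0 <= f x)%R.

Let mEf : measurable_fun setT (fun x => (f x)%:E).
Proof. exact/measurable_EFinP. Qed.

Let Ef0 x : 0 <= (f x)%:E.
Proof. by rewrite lee_fin. Qed.

Definition density_measure of measurable_fun setT f & (forall x, 0 <= f x)%R :
  set T -> \bar R := fun A => \int[mu]_(x in A) (f x)%:E.

Let nu := density_measure mf f0.

Let nu0 : nu set0 = 0.
Proof. by rewrite /nu /density_measure integral_set0. Qed.

Let nu_ge0 A : 0 <= nu A.
Proof. by apply: integral_ge0. Qed.

Let nu_sigma_additive : semi_sigma_additive nu.
Proof.
move=> F mF tF mUF; rewrite /nu /density_measure ge0_integral_bigcup//.
  by apply: is_cvg_ereal_nneg_natsum_cond => n _ _; exact: integral_ge0.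
exact: measurable_funTS.
Qed.

HB.instance Definition _ := isMeasure.Build _ _ _ (density_measure mf f0)
  nu0 nu_ge0 nu_sigma_additive.

Lemma ge0_integral_density (g : T -> \bar R) :
  measurable_fun setT g -> (forall x, 0 <= g x) ->
  \int[nu]_x g x = \int[mu]_x ((f x)%:E * g x).
Proof.
move=> mg g0.
pose g_ := nnsfun_approx measurableT mg.
have cvgg x : (g_ n x)%:E @[n --> \oo] --> g x.
  by apply: cvg_nnsfun_approx.
have ndg x m n : (m <= n)%N -> (g_ m x)%:E <= (g_ n x)%:E.
  by move=> mn; rewrite lee_fin; exact/lefP/nd_nnsfun_approx.
transitivity (limn (fun n => \int[nu]_x (g_ n x)%:E)).
  rewrite -monotone_convergence//.
  - by apply: eq_integral => x _; apply/esym/cvg_lim => //; exact: cvgg.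
  - by move=> n; exact/measurable_EFinP.
  - by move=> n x _; rewrite lee_fin.
  - by move=> x _ m n; exact: ndg.
transitivity (limn (fun n => \int[mu]_x ((f x)%:E * (g_ n x)%:E))); last first.
  rewrite -monotone_convergence//.
  - apply: eq_integral => x _; apply/cvg_lim => //.
    by apply: cvgeZl => //; exact: cvgg.
  - by move=> n; apply: emeasurable_funM => //; exact/measurable_EFinP.
  - by move=> n x _; rewrite mule_ge0// lee_fin.
  - by move=> x _ m n mn; apply: lee_wpmul2l => //; exact: ndg.
congr (limn _); apply/funext => n.
transitivity (\sum_(k \in range (g_ n)) k%:E * \int[mu]_(x in g_ n @^-1` [set k]) (f x)%:E).
  by rewrite integralT_nnsfun sintegralE.
transitivity (\sum_(k \in range (g_ n)) \int[mu]_x (k%:E * ((f x)%:E * (\1_(g_ n @^-1` [set k]) x)%:E))).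
  apply: eq_fsbigr => k; rewrite inE => -[z _ gz].
  rewrite ge0_integralZl//.
  - congr (_ * _); rewrite integral_mkcond; apply: eq_integral => x _.
    by rewrite patchE indicE; case: ifP => _; rewrite ?mule1 ?mule0.
  - apply: emeasurable_funM => //; apply/measurable_EFinP.
    exact/measurable_indicP.
  - by move=> x _; rewrite mule_ge0// lee_fin.
  - by rewrite -gz lee_fin.
rewrite -ge0_integral_fsum//; last first.
- move=> k x _; have [k0|k0] := leP 0%R k; first by rewrite !mule_ge0// lee_fin.
  by rewrite preimage_nnfun0// indic0 !mule0.
- move=> k; apply: emeasurable_funM => //; apply: emeasurable_funM => //; apply/measurable_EFinP.
  exact/measurable_indicP.
apply: eq_integral => x _; rewrite [in RHS]fimfunE -fsumEFin// ge0_mule_fsumr//; last first.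
  by move=> k; rewrite lee_fin; exact: nnfun_muleindic_ge0.
by apply: eq_fsbigr => k _; rewrite muleCA EFinM.
Qed.

(** This is how statements holding almost everywhere for a factorial moment measure reach Lebesgue
    measure. The set where the density vanishes escapes, but there the Palm terms have weight
    zero. *)
Lemma ae_density (Q : T -> Prop) : {ae nu, forall x, Q x} ->
  {ae mu, forall x, f x != 0%R -> Q x}.
Proof.
move=> [B [mB B0 QB]].
have /ae_eq_integral_abs : \int[mu]_(x in B) `|(f x)%:E| = 0.
  by rewrite -[RHS]B0; apply: eq_integral => x _; rewrite gee0_abs.
move=> /(_ mB (measurable_funTS mEf)); apply: filterS => x h fx0.
by apply: contrapT => Qx; have [] := h (QB _ Qx); exact/eqP.
Qed.

End density.

Section small_tuples.
Local Open Scope ereal_scope.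
Context d (T : measurableType d) (R : realType).
Variable mu : {sigma_finite_measure set T -> \bar R}.

Lemma measurable_tuple1 : measurable_fun setT (fun x : T => [tuple x]).
Proof. by apply/measurable_fun_tnthP => i; rewrite (ord1 i) (_ : _ \o _ = id)//. Qed.

Lemma measurable_tuple2 : measurable_fun setT (fun z : T * T => [tuple z.1; z.2]).
Proof.
apply/measurable_fun_tnthP => i; case: (unliftP ord0 i) => [j|] ->.
  by rewrite (ord1 j) (_ : _ \o _ = snd)//; apply/funext => -[].
by rewrite (_ : _ \o _ = fst)//; apply/funext => -[].
Qed.

Lemma ge0_integral_tuple1 (G : 1.-tuple T -> \bar R) :
  measurable_fun setT G -> (forall t, 0 <= G t) ->
  \int[tuple_measure mu 1]_t G t = \int[mu]_x G [tuple x].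
Proof.
move=> mG G0; rewrite ge0_integral_tupleS//; apply: eq_integral => x _.
by rewrite ge0_integral_tuple0//; last exact: measurable_tcons_l.
Qed.

Lemma ge0_integral_tuple2 (G : 2.-tuple T -> \bar R) :
  measurable_fun setT G -> (forall t, 0 <= G t) ->
  \int[tuple_measure mu 2]_t G t = \int[mu \x mu]_z G [tuple z.1; z.2].
Proof.
move=> mG G0; rewrite ge0_integral_tupleS// fubini_tonelli1//; last first.
  exact: (measurableT_comp mG measurable_tuple2).
apply: eq_integral => x _; by rewrite ge0_integral_tuple1//; last exact: measurable_tcons_l.
Qed.

Lemma ae_tuple1 (Q : 1.-tuple T -> Prop) :
  {ae tuple_measure mu 1, forall t, Q t} -> {ae mu, forall x, Q [tuple x]}.
Proof.
move=> [B [mB B0 QB]]; exists [set x | B [tuple x]]; split.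
- exact: (measurable_pushforwardP measurable_tuple1 mB).
- have : \int[tuple_measure mu 1]_t (\1_B t)%:E = 0 by rewrite integral_indic// setIT.
  rewrite ge0_integral_tuple1//; last exact/measurable_EFinP.
  move=> <-; rewrite -[in LHS](setIT [set x | _]) -integral_indic//.
  exact: (measurable_pushforwardP measurable_tuple1 mB).
- by move=> x Qx; exact: QB.
Qed.

Lemma ae_tuple2 (Q : 2.-tuple T -> Prop) :
  {ae tuple_measure mu 2, forall t, Q t} ->
  {ae mu \x mu, forall z, Q [tuple z.1; z.2]}.
Proof.
move=> [B [mB B0 QB]]; exists [set z | B [tuple z.1; z.2]]; split.
- exact: (measurable_pushforwardP measurable_tuple2 mB).
- have : \int[tuple_measure mu 2]_t (\1_B t)%:E = 0.
    by rewrite (integral_indic _ measurableT mB) setIT; exact: B0.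
  rewrite ge0_integral_tuple2//; last exact/measurable_EFinP.
  move=> <-; rewrite -[in LHS](setIT [set x | _]) -integral_indic//.
  exact: (measurable_pushforwardP measurable_tuple2 mB).
- by move=> x Qx; exact: QB.
Qed.

End small_tuples.

Section distinct_sums.
Context (R : realType) (d : nat).
Notation E := 'rV[R]_d.
Notation cfg := (config R d).
Local Open Scope ereal_scope.

Lemma esum_distinct1 (X : cfg) n (F : E -> \bar R) : (forall x, 0 <= F x) ->
  (forall x, ~ window (Some n) x -> F x = 0) ->
  \esum_(xs in distinct_tuples 1 X) F (thead xs) =
  \sum_(x \in points X `&` window (Some n)) F x.
Proof.
move=> F0 FW; rewrite (@reindex_esum _ _ _ (points X) _ (fun x => [tuple x])); last first.
  split.
  - by move=> x Xx; split => // i; rewrite (ord1 i).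
  - by move=> x y _ _ /(congr1 (fun t : 1.-tuple E => thead t)); rewrite !theadE.
  - move=> t [_ tX]; exists (thead t); first exact: tX.
    by apply: eq_from_tnth => i; rewrite (ord1 i).
rewrite -esum_fset//; last exact: finite_window.
rewrite esum_mkcondr; apply: eq_esum => x Xx.
by rewrite theadE; case: ifPn => // /negP; rewrite inE => /FW.
Qed.

Definition offdiag (F : E -> E -> \bar R) x y : \bar R := if x == y then 0 else F x y.

Lemma esum_distinct2 (X : cfg) n (F : E -> E -> \bar R) : (forall x y, 0 <= F x y) ->
  (forall x y, ~ (window (Some n) x /\ window (Some n) y) -> F x y = 0) ->
  \esum_(xs in distinct_tuples 2 X) F (tnth xs ord0) (tnth xs ord_max) =
  \sum_(x \in points X `&` window (Some n)) \sum_(y \in points X `&` window (Some n)) offdiag F x y.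
Proof.
move=> F0 FW.
have off0 x y : 0 <= offdiag F x y by rewrite /offdiag; case: ifP.
rewrite (@reindex_esum _ _ _ [set z : E * E | [/\ points X z.1, points X z.2 & z.1 != z.2]] _
  (fun z => [tuple z.1; z.2])); last first.
  split.
  - move=> [x y] [/= Xx Xy xy]; split; first by rewrite /= inE xy.
    by move=> i; case: (unliftP ord0 i) => [j|] -> //; rewrite (ord1 j).
  - move=> [x y] [x' y'] _ _ /(congr1 val)/= -[-> ->] //.
  - move=> t [ut tX]; exists (tnth t ord0, tnth t ord_max).
      split; [exact: tX|exact: tX|]; apply/eqP => /= h.
      by move/tuple_uniqP : ut => /(_ _ _ h)/(congr1 val).
    apply: eq_from_tnth => i; case: (unliftP ord0 i) => [j|] -> //.
    by rewrite (ord1 j) /=; congr (tnth t _); exact: val_inj.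
under [in RHS]eq_fsbigr => x _.
  rewrite -esum_fset//; last exact: finite_window.
  over.
rewrite -esum_fset//; [|exact: finite_window|by move=> x _; exact: esum_ge0].
rewrite esum_esum// [LHS]esum_mkcond [RHS]esum_mkcond; apply: eq_esum => -[x y] _ /=.
rewrite /offdiag; case: ifPn => [|].
  rewrite inE/= => -[Xx Xy xy]; rewrite (negbTE xy).
  case: ifPn => // /negP; rewrite inE/= => h; apply: FW => -[Wx Wy].
  by apply: h; split.
move=> /negP; rewrite inE/= => h; case: ifPn => // /[!inE]/= -[[Xx Wx] [Xy Wy]].
by case: ifPn => // xy; exfalso; apply: h; split.
Qed.

End distinct_sums.

Section signed_difference.
Local Open Scope ereal_scope.
Context d (T : measurableType d) (R : realType) (mu : {measure set T -> \bar R}).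

(** [S] is compared with p - m almost everywhere only, because it will be built from values of
    [fine], which are arbitrary on a null set. Both integrals being finite, they may be
    subtracted. *)
Lemma integrable_fine_difference (S : T -> R) (p m : T -> \bar R) :
  measurable_fun setT p -> measurable_fun setT m ->
  (forall x, 0 <= p x) -> (forall x, 0 <= m x) ->
  \int[mu]_x p x < +oo -> \int[mu]_x m x < +oo ->
  {ae mu, forall x, (S x)%:E = p x - m x} -> measurable_fun setT S ->
  mu.-integrable setT (EFin \o S) /\
  \int[mu]_x (S x)%:E = \int[mu]_x p x - \int[mu]_x m x.
Proof.
move=> mp mm p0 m0 ip im Sae mS.
have Ip : mu.-integrable setT p.
  by apply/integrableP; split => //; under eq_integral do rewrite gee0_abs//.
have Im : mu.-integrable setT m.
  by apply/integrableP; split => //; under eq_integral do rewrite gee0_abs//.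
have IS : mu.-integrable setT (EFin \o S).
  have mES : measurable_fun setT (EFin \o S) by exact/measurable_EFinP.
  apply/integrableP; split => //.
  apply: (@le_lt_trans _ _ (\int[mu]_x (p x + m x))); last by rewrite ge0_integralD// lte_add_pinfty.
  apply: ae_ge0_le_integral => //.
  - exact: measurableT_comp.
  - by move=> x _; rewrite adde_ge0.
  - exact: emeasurable_funD.
  apply: filterS Sae => x Sx _; have -> : (EFin \o S) x = p x - m x by [].
  by rewrite (le_trans (lee_abs_sub _ _))// !gee0_abs.
split => //; rewrite -integralB//; apply: ae_eq_integral => //.
- exact/measurable_EFinP.
- exact: emeasurable_funB.
- by apply: filterS Sae => x /= -> _.
Qed.

End signed_difference.

Section disintegration.
Local Open Scope ereal_scope.
Context dy (Y : measurableType dy) d (T : measurableType d) (R : realType).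
Variables (nu : {measure set Y -> \bar R}) (k : Y -> probability T R) (w : Y -> R).
Hypothesis mk : forall A, measurable A -> measurable_fun setT (fun y => k y A : \bar R).
Hypotheses (mw : measurable_fun setT w) (w0 : forall y, (0 <= w y)%R).

Lemma measurable_kint (F : Y * T -> \bar R) : measurable_fun setT F -> (forall p, 0 <= F p) ->
  measurable_fun setT (fun y => \int[k y]_x F (y, x)).
Proof.
move=> mF F0; apply: (@measurable_transition_integral _ _ _ _ _ (fun y => k y)) => // y.
by apply: le_lt_trans (probability_le1 (k y) measurableT) _; rewrite ltry.
Qed.

(* The mean of [F] for the measure [w y nu(dy) k y (dx)]. *)
Definition mixture (F : Y * T -> \bar R) : \bar R :=
  \int[nu]_y ((w y)%:E * \int[k y]_x F (y, x)).

Lemma measurable_wkint (F : Y * T -> \bar R) : measurable_fun setT F -> (forall p, 0 <= F p) ->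
  measurable_fun setT (fun y => (w y)%:E * \int[k y]_x F (y, x)).
Proof.
by move=> mF F0; apply: emeasurable_funM; [exact/measurable_EFinP|exact: measurable_kint].
Qed.

Lemma wkint_ge0 (F : Y * T -> \bar R) y : (forall p, 0 <= F p) ->
  0 <= (w y)%:E * \int[k y]_x F (y, x).
Proof. by move=> F0; rewrite mule_ge0 ?lee_fin//; exact: integral_ge0. Qed.

Lemma le_mixture (F G : Y * T -> \bar R) : measurable_fun setT F -> measurable_fun setT G ->
  (forall p, 0 <= F p) -> (forall p, F p <= G p) -> mixture F <= mixture G.
Proof.
move=> mF mG F0 FG; have G0 p : 0 <= G p by exact: le_trans (FG p).
apply: ge0_le_integral => //.
- by move=> y _; exact: wkint_ge0.
- exact: measurable_wkint.
- exact: measurable_wkint.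
move=> y _; apply: lee_wpmul2l; first by rewrite lee_fin.
apply: ge0_le_integral => //; exact: (measurableT_comp _ (measurable_pair1 y)).
Qed.

Variable F : Y * T -> R.
Hypothesis mF : measurable_fun setT F.
Hypothesis finF : mixture (fun p => `|F p|%:E) < +oo.

Let mEF : measurable_fun setT (EFin \o F). Proof. exact/measurable_EFinP. Qed.
Let mFn : measurable_fun setT (fun p => `|F p|%:E : \bar R).
Proof. by apply/measurable_EFinP; exact: measurableT_comp. Qed.
Let Fn0 p : 0 <= `|F p|%:E :> \bar R. Proof. by rewrite lee_fin. Qed.
Let mFp : measurable_fun setT (EFin \o F)^\+. Proof. exact: measurable_funepos. Qed.
Let mFm : measurable_fun setT (EFin \o F)^\-. Proof. exact: measurable_funeneg. Qed.
Let Fp0 p : 0 <= (EFin \o F)^\+ p. Proof. exact: funepos_ge0. Qed.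
Let Fm0 p : 0 <= (EFin \o F)^\- p. Proof. exact: funeneg_ge0. Qed.
Let mFy y : measurable_fun setT (fun x => F (y, x)).
Proof. exact: (measurableT_comp mF (measurable_pair1 y)). Qed.

(** Meaningful where [F (y, _)] is integrable; [fine] turns an infinite integral into 0. *)
Definition kmean y : R := fine (\int[k y]_x (F (y, x))%:E).

Lemma measurable_kint_signed : measurable_fun setT (fun y => \int[k y]_x (F (y, x))%:E).
Proof.
rewrite (_ : (fun y => _) = fun y => \int[k y]_x (EFin \o F)^\+ (y, x) - \int[k y]_x (EFin \o F)^\- (y, x)); last first.
  apply/funext => y; rewrite [LHS]integralE; congr (_ - _).
    by apply: eq_integral => x _; rewrite !funeposE.
  by apply: eq_integral => x _; rewrite !funenegE.
by apply: emeasurable_funB; exact: measurable_kint.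
Qed.

Lemma measurable_kmean : measurable_fun setT kmean.
Proof. exact: measurableT_comp measurable_kint_signed. Qed.

(** A positive weight times an infinite mean would be infinite, against the integrability of the
    weighted means. *)
Lemma ae_kint_fin : {ae nu, forall y, w y != 0%R -> \int[k y]_x `|F (y, x)|%:E < +oo}.
Proof.
have I : nu.-integrable setT (fun y => (w y)%:E * \int[k y]_x `|F (y, x)|%:E).
  apply/integrableP; split; first exact: (measurable_wkint mFn Fn0).
  rewrite (_ : \int[nu]_y _ = mixture (fun p => `|F p|%:E))//.
  by apply: eq_integral => y _; rewrite gee0_abs// (wkint_ge0 y Fn0).
have := integrable_ae measurableT I; apply: filterS => y /(_ Logic.I) fy wy.
have i0 : 0 <= \int[k y]_x `|F (y, x)|%:E by exact: integral_ge0.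
rewrite -ge0_fin_numE//; move: fy i0.
case: (\int[k y]_x _) => // fy _; exfalso; move: fy.
by rewrite gt0_muley// lte_fin lt_neqAle eq_sym wy w0.
Qed.

Lemma ae_kintegrable : {ae nu, forall y, w y != 0%R -> (k y).-integrable setT (fun x => (F (y, x))%:E)}.
Proof.
apply: filterS ae_kint_fin => y h /h fy; apply/integrableP; split => //.
exact/measurable_EFinP.
Qed.

Lemma kmeanE y : (k y).-integrable setT (fun x => (F (y, x))%:E) ->
  (kmean y)%:E = \int[k y]_x (F (y, x))%:E.
Proof. by move=> h; rewrite /kmean fineK//; exact: integrable_fin_num. Qed.

Lemma le_kmean y : (k y).-integrable setT (fun x => (F (y, x))%:E) ->
  `|kmean y|%:E <= \int[k y]_x `|F (y, x)|%:E.
Proof.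
by move=> h; rewrite -[leLHS]abse_EFin kmeanE//; apply: le_abse_integral => //; exact/measurable_EFinP.
Qed.

Lemma mixture_funepos_lty : mixture (EFin \o F)^\+ < +oo.
Proof.
apply: le_lt_trans finF; apply: le_mixture => // p.
by rewrite funeposE/= -EFin_max lee_fin ge_max ler_norm normr_ge0.
Qed.

Lemma mixture_funeneg_lty : mixture (EFin \o F)^\- < +oo.
Proof.
apply: le_lt_trans finF; apply: le_mixture => // p.
by rewrite funenegE/= -EFin_max lee_fin ge_max normr_ge0 andbT -normrN ler_norm.
Qed.

Lemma mixture_signed : nu.-integrable setT (fun y => (w y * kmean y)%:E) /\
  \int[nu]_y (w y * kmean y)%:E = mixture (EFin \o F)^\+ - mixture (EFin \o F)^\-.
Proof.
apply: (integrable_fine_difference (S := fun y => (w y * kmean y)%R)).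
- exact: measurable_wkint.
- exact: measurable_wkint.
- by move=> y; exact: wkint_ge0.
- by move=> y; exact: wkint_ge0.
- exact: mixture_funepos_lty.
- exact: mixture_funeneg_lty.
- apply: filterS ae_kintegrable => y h.
  have [->|wy] := eqVneq (w y) 0%R; first by rewrite mul0r !mul0e sube0.
  have {h}I := h wy.
  have -> : \int[k y]_x (EFin \o F)^\+ (y, x) = \int[k y]_x (fun x => (F (y, x))%:E)^\+ x.
    by apply: eq_integral => x _; rewrite !funeposE.
  have -> : \int[k y]_x (EFin \o F)^\- (y, x) = \int[k y]_x (fun x => (F (y, x))%:E)^\- x.
    by apply: eq_integral => x _; rewrite !funenegE.
  rewrite EFinM kmeanE// [in LHS]integralE muleBr//.
  by apply: fin_num_adde_defl; rewrite fin_numN; exact: integrable_neg_fin_num.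
- by apply: measurable_funM => //; exact: measurable_kmean.
Qed.

End disintegration.

Section real_fsum.
Context (R : realType) (I : choiceType) (A : set I).
Hypothesis finA : finite_set A.

Lemma fsum_posneg (f : I -> R) :
  (\sum_(i \in A) f i)%:E =
  (\sum_(i \in A) (EFin \o f)^\+ i - \sum_(i \in A) (EFin \o f)^\- i)%E.
Proof.
under [X in (X - _)%E]eq_fsbigr do rewrite funeposE /= -EFin_max.
under [X in (_ - X)%E]eq_fsbigr do rewrite funenegE /= -EFin_max.
rewrite !fsumEFin// -EFinB; congr (_%:E).
rewrite !fsbig_finite// -sumrB; apply: eq_bigr => i _.
by have [h|h] := leP (f i) 0; have [h'|h'] := leP (- f i) 0; lra.
Qed.

Lemma fsumrB (f g : I -> R) :
  \sum_(i \in A) (f i - g i) = \sum_(i \in A) f i - \sum_(i \in A) g i.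
Proof. by rewrite !fsbig_finite// -sumrB. Qed.

End real_fsum.

Section campbell.
Context (R : realType) (d : nat) (disp : measure_display) (Omega : measurableType disp).
Context (Pr : probability Omega R) (P : {RV Pr >-> config R d}).
Context (rho : forall k, k.-tuple 'rV[R]_d -> R).
Context (palm : forall k, k.-tuple 'rV[R]_d -> probability (config R d) R).
Hypothesis hP : admissible Pr P rho.
Hypothesis hpalm : palm_probabilities Pr P palm.
Notation E := 'rV[R]_d.
Notation cfg := (config R d).
Notation lam := (lebesgue_row R d).
Local Open Scope ereal_scope.

Definition intensity : R := @rho 1%N [tuple 0%R].
Definition rho2 (z : E * E) : R := @rho 2%N [tuple z.1; z.2].
Definition palm1 (x : E) : probability cfg R := @palm 1%N [tuple x].
Definition palm2 (z : E * E) : probability cfg R := @palm 2%N [tuple z.1; z.2].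

Let mP : measurable_fun setT (P : Omega -> cfg).
Proof. exact: measurable_funP. Qed.

Lemma shift_tuple1 (x y : E) : shift_tuple y [tuple x] = [tuple (x + y)%R].
Proof. exact: val_inj. Qed.

Lemma shift_tuple2 (x1 x2 y : E) :
  shift_tuple y [tuple x1; x2] = [tuple (x1 + y)%R; (x2 + y)%R].
Proof. exact: val_inj. Qed.

Lemma rho1E (x : E) : @rho 1%N [tuple x] = intensity.
Proof.
have := correlation_shift (admissible_correlation hP (ltn0Sn 0)) x [tuple 0%R].
by rewrite shift_tuple1 add0r.
Qed.

Lemma rho2_shift (x y : E) : rho2 (x, y) = rho2 (0, y - x)%R.
Proof.
have := correlation_shift (admissible_correlation hP (ltn0Sn 1)) x [tuple 0%R; (y - x)%R].
by rewrite shift_tuple2 add0r subrK.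
Qed.

Lemma intensity_gt0 : (0 < intensity)%R.
Proof. exact: admissible_intensity hP. Qed.

Lemma rho2_ge0 z : (0 <= rho2 z)%R.
Proof. exact: (correlation_ge0 (admissible_correlation hP (ltn0Sn 1))). Qed.

Lemma measurable_rho2 : measurable_fun setT rho2.
Proof.
exact: (measurableT_comp (correlation_measurable (admissible_correlation hP (ltn0Sn 1)))
  (@measurable_tuple2 _ E)).
Qed.

Lemma measurable_palm1 A : measurable A -> measurable_fun setT (fun x => palm1 x A : \bar R).
Proof.
move=> mA; exact: (measurableT_comp (palm_measurable hpalm (ltn0Sn 0) mA)
  (@measurable_tuple1 _ E)).
Qed.

Lemma measurable_palm2 A : measurable A -> measurable_fun setT (fun x => palm2 x A : \bar R).
Proof.
move=> mA; exact: (measurableT_comp (palm_measurable hpalm (ltn0Sn 1) mA)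
  (@measurable_tuple2 _ E)).
Qed.

Lemma ge0_integral_moment k (g : k.-tuple E -> \bar R) : (0 < k)%N ->
  measurable_fun setT g -> (forall x, 0 <= g x) ->
  \int[moment_measure Pr P (k := k)]_xs g xs =
  \int[tuple_measure lam k]_xs ((@rho k xs)%:E * g xs).
Proof.
move=> k0 mg g0; have hr := admissible_correlation hP k0.
rewrite -(ge0_integral_density (tuple_measure lam k) (correlation_measurable hr) (correlation_ge0 hr))//.
by apply: eq_setfun_integral => A mA; rewrite (correlation_density hr).
Qed.

Lemma ae_moment k (Q : k.-tuple E -> Prop) : (0 < k)%N ->
  {ae moment_measure Pr P (k := k), forall xs, Q xs} ->
  {ae tuple_measure lam k, forall xs, @rho k xs != 0%R -> Q xs}.
Proof.
move=> k0 [B [mB B0 QB]]; have hr := admissible_correlation hP k0.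
apply: (ae_density (mf := correlation_measurable hr) (f0 := correlation_ge0 hr)).
by exists B; split => //; rewrite -[RHS]B0 (correlation_density hr).
Qed.

Lemma campbell_tuple k (f : k.-tuple E * cfg -> \bar R) : (0 < k)%N ->
  measurable_fun setT f -> (forall z, 0 <= f z) ->
  \int[Pr]_w (\esum_(xs in distinct_tuples k (P w)) f (xs, P w)) =
  \int[tuple_measure lam k]_xs ((@rho k xs)%:E * \int[@palm k xs]_X f (xs, X)).
Proof.
move=> k0 mf f0; rewrite (palm_campbell hpalm)// ge0_integral_moment//.
- by apply: (measurable_kint _ mf f0) => A mA; exact: (palm_measurable hpalm).
- by move=> x; exact: integral_ge0.
Qed.

Definition mix1 := mixture lam palm1 (fun=> intensity).
Definition mix2 := mixture (lam \x lam) palm2 rho2.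

(** Vanishing outside a bounded window turns the sum over all points into a finite one, which later
    allows signed summands. *)
Lemma campbell1 n (F : E * cfg -> \bar R) :
  measurable_fun setT F -> (forall z, 0 <= F z) ->
  (forall x X, ~ window (Some n) x -> F (x, X) = 0) ->
  \int[Pr]_w (\sum_(x \in points (P w) `&` window (Some n)) F (x, P w)) = mix1 F.
Proof.
move=> mF F0 FW; rewrite /mix1 /mixture.
pose f (p : 1.-tuple E * cfg) := F (thead p.1, p.2).
have f0 p : 0 <= f p by exact: F0.
have mf : measurable_fun setT f.
  apply: (measurableT_comp mF); apply/measurable_fun_pairP; split; last exact: measurable_snd.
  exact: (measurableT_comp (@measurable_tnth _ E 1 ord0) measurable_fst).
transitivity (\int[Pr]_w (\esum_(xs in distinct_tuples 1 (P w)) f (xs, P w))).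
  by apply: eq_integral => w _; rewrite -(@esum_distinct1 R d (P w) n (fun x => F (x, P w)))// => x; exact: FW.
rewrite campbell_tuple//.
rewrite (@ge0_integral_tuple1 _ _ _ lam (fun xs => (@rho 1%N xs)%:E * \int[@palm 1%N xs]_X f (xs, X)))//.
- by apply: eq_integral => x _; rewrite rho1E.
- apply: emeasurable_funM.
    apply/measurable_EFinP; exact: (correlation_measurable (admissible_correlation hP (ltn0Sn 0))).
  by apply: (measurable_kint _ mf f0) => A mA; exact: (palm_measurable hpalm).
- move=> t; rewrite mule_ge0//; last exact: integral_ge0.
  by rewrite lee_fin; exact: (correlation_ge0 (admissible_correlation hP (ltn0Sn 0))).
Qed.

Lemma campbell2 n (F : (E * E) * cfg -> \bar R) :
  measurable_fun setT F -> (forall z, 0 <= F z) ->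
  (forall x y X, ~ (window (Some n) x /\ window (Some n) y) -> F ((x, y), X) = 0) ->
  \int[Pr]_w (\sum_(x \in points (P w) `&` window (Some n))
    \sum_(y \in points (P w) `&` window (Some n)) offdiag (fun x y => F ((x, y), P w)) x y) = mix2 F.
Proof.
move=> mF F0 FW; rewrite /mix2 /mixture.
pose f (p : 2.-tuple E * cfg) := F ((tnth p.1 ord0, tnth p.1 ord_max), p.2).
have f0 p : 0 <= f p by exact: F0.
have mf : measurable_fun setT f.
  apply: (measurableT_comp mF); apply/measurable_fun_pairP; split; last exact: measurable_snd.
  apply/measurable_fun_pairP; split.
    exact: (measurableT_comp (@measurable_tnth _ E 2 ord0) measurable_fst).
  exact: (measurableT_comp (@measurable_tnth _ E 2 ord_max) measurable_fst).
transitivity (\int[Pr]_w (\esum_(xs in distinct_tuples 2 (P w)) f (xs, P w))).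
  by apply: eq_integral => w _; rewrite -(@esum_distinct2 R d (P w) n (fun x y => F ((x, y), P w)))// => x y; exact: FW.
rewrite campbell_tuple//.
rewrite (@ge0_integral_tuple2 _ _ _ lam (fun xs => (@rho 2%N xs)%:E * \int[@palm 2%N xs]_X f (xs, X)))//.
- by apply: eq_integral => -[x y] _.
- apply: emeasurable_funM.
    apply/measurable_EFinP; exact: (correlation_measurable (admissible_correlation hP (ltn0Sn 1))).
  by apply: (measurable_kint _ mf f0) => A mA; exact: (palm_measurable hpalm).
- move=> t; rewrite mule_ge0//; last exact: integral_ge0.
  by rewrite lee_fin; exact: (correlation_ge0 (admissible_correlation hP (ltn0Sn 1))).
Qed.

(** The pair (x, y) and its exchange cannot be compared inside [palm2] or [rho2], which are versions
    without prescribed symmetry. The symmetry is read on the process side of Campbell's formula,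
    where the sum runs over all ordered pairs. *)
Lemma mix2_swap n (F : (E * E) * cfg -> \bar R) :
  measurable_fun setT F -> (forall z, 0 <= F z) ->
  (forall x y X, ~ (window (Some n) x /\ window (Some n) y) -> F ((x, y), X) = 0) ->
  mix2 (fun p => F ((p.1.2, p.1.1), p.2)) = mix2 F.
Proof.
move=> mF F0 FW.
rewrite -(@campbell2 n F)// -(@campbell2 n (fun p => F ((p.1.2, p.1.1), p.2)))//=; last 2 first.
- apply: (measurableT_comp mF); apply/measurable_fun_pairP; split; last exact: measurable_snd.
  apply/measurable_fun_pairP; split.
    exact: (measurableT_comp measurable_snd measurable_fst).
  exact: (measurableT_comp measurable_fst measurable_fst).
- by move=> x y X h; apply: FW => -[? ?]; apply: h.
apply: eq_integral => w _; rewrite exchange_fsbig//; try exact: finite_window.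
apply: eq_fsbigr => x _; apply: eq_fsbigr => y _.
by rewrite /offdiag eq_sym.
Qed.

Lemma measurable_offdiag_fsum n (F : (E * E) * cfg -> \bar R) :
  measurable_fun setT F -> (forall z, 0 <= F z) ->
  measurable_fun setT (fun w => \sum_(x \in points (P w) `&` window (Some n))
    \sum_(y \in points (P w) `&` window (Some n)) offdiag (fun x y => F ((x, y), P w)) x y).
Proof.
move=> mF F0.
apply: (@measurable_window_fsum _ _ _ _ _ n (fun p => \sum_(y \in points (P p.1) `&` window (Some n))
   offdiag (fun x y => F ((x, y), P p.1)) p.2 y)) => //; last first.
  by move=> z; apply: fsume_ge0 => y _; rewrite /offdiag; case: ifP.
apply: (@measurable_window_fsum _ _ _ _ (fun p => P p.1) n (fun p : (Omega * E) * E =>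
   offdiag (fun x y => F ((x, y), P p.1.1)) p.1.2 p.2)) => //; last first.
- by move=> z; rewrite /offdiag; case: ifP.
- apply: measurable_fun_ifT => //.
  (* The diagonal is the preimage of the origin under the difference map, hence measurable. *)
  + rewrite (_ : (fun t => _) = (fun t => (t.1.2 - t.2)%R \in [set (0%R : E)])); last first.
      by apply/funext => t; rewrite -subr_eq0; apply/eqP/idP => [->|]; rewrite inE.
    apply: (measurable_fun_bool true) => /=.
    rewrite setTI (_ : _ @^-1` _ = (fun t : (Omega * E) * E => (t.1.2 - t.2)%R) @^-1` [set 0%R]); last first.
      by apply/seteqP; split => t /= h; [exact: set_mem h|exact: mem_set].
    apply: measurable_pushforwardP; last exact: measurable_row_set1.
    apply: measurable_rowB => //.
    exact: (measurableT_comp measurable_snd measurable_fst).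
  + apply: (measurableT_comp mF); apply/measurable_fun_pairP; split.
      apply/measurable_fun_pairP; split; last exact: measurable_snd.
      exact: (measurableT_comp measurable_snd measurable_fst).
    exact: (measurableT_comp mP (measurableT_comp measurable_fst measurable_fst)).
- exact: (measurableT_comp mP measurable_fst).
Qed.

Definition point_sum n (F : E * cfg -> R) (w : Omega) : R :=
  (\sum_(x \in points (P w) `&` window (Some n)) F (x, P w))%R.

Definition pair_sum n (F : (E * E) * cfg -> R) (w : Omega) : R :=
  (\sum_(x \in points (P w) `&` window (Some n))
   \sum_(y \in points (P w) `&` window (Some n)) if x == y then 0 else F ((x, y), P w))%R.

(** Campbell's formula is applied to the positive and the negative part; the finite mean of |F|
    makes both sides subtractable. *)
Lemma signed_campbell1 n (F : E * cfg -> R) :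
  measurable_fun setT F ->
  (forall x X, ~ window (Some n) x -> F (x, X) = 0%R) ->
  mix1 (fun p => `|F p|%:E) < +oo ->
  [/\ measurable_fun setT (point_sum n F),
    Pr.-integrable setT (EFin \o point_sum n F) &
    \int[Pr]_w (point_sum n F w)%:E = \int[lam]_x (intensity * kmean palm1 F x)%:E].
Proof.
move=> mF FW fin.
have mEF : measurable_fun setT (EFin \o F) by exact/measurable_EFinP.
have mFp : measurable_fun setT (EFin \o F)^\+ by exact: measurable_funepos.
have mFm : measurable_fun setT (EFin \o F)^\- by exact: measurable_funeneg.
have FpW x X : ~ window (Some n) x -> (EFin \o F)^\+ (x, X) = 0.
  by move=> /FW h; rewrite funeposE /= h maxxx.
have FmW x X : ~ window (Some n) x -> (EFin \o F)^\- (x, X) = 0.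
  by move=> /FW h; rewrite funenegE /= h oppr0 maxxx.
have mr : measurable_fun setT (fun _ : E => intensity) by exact: measurable_cst.
have r0 (x : E) : (0 <= intensity)%R by rewrite ltW// intensity_gt0.
have [_ ->] := mixture_signed measurable_palm1 mr r0 mF fin.
have ip := mixture_funepos_lty measurable_palm1 mr r0 mF fin.
have im := mixture_funeneg_lty measurable_palm1 mr r0 mF fin.
have Fp0 p : 0 <= (EFin \o F)^\+ p by exact: funepos_ge0.
have Fm0 p : 0 <= (EFin \o F)^\- p by exact: funeneg_ge0.
have Cp := campbell1 mFp Fp0 FpW; have Cm := campbell1 mFm Fm0 FmW.
pose G (e : E * cfg -> \bar R) w := \sum_(x \in points (P w) `&` window (Some n)) e (x, P w).
have mG e : measurable_fun setT e -> (forall p, 0 <= e p) -> measurable_fun setT (G e).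
  move=> me e0; apply: (@measurable_window_fsum _ _ _ _ _ n (fun p => e (p.2, P p.1))) => //.
  apply: (measurableT_comp me); apply/measurable_fun_pairP; split; first exact: measurable_snd.
  exact: (measurableT_comp mP measurable_fst).
have SE w : (point_sum n F w)%:E = G (EFin \o F)^\+ w - G (EFin \o F)^\- w.
  rewrite /point_sum fsum_posneg//; last exact: finite_window.
  congr (_ - _); apply: eq_fsbigr => x _; first by rewrite !funeposE.
  by rewrite !funenegE.
have mS : measurable_fun setT (point_sum n F).
  apply/measurable_EFinP; rewrite (_ : _ \o _ = fun w => G (EFin \o F)^\+ w - G (EFin \o F)^\- w).
    by apply: emeasurable_funB; exact: mG.
  by apply/funext => w; exact: SE.
have [] // := @integrable_fine_difference _ _ R Pr (point_sum n F) (G (EFin \o F)^\+) (G (EFin \o F)^\-).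
- exact: mG.
- exact: mG.
- by move=> w; apply: fsume_ge0 => x _.
- by move=> w; apply: fsume_ge0 => x _.
- by rewrite Cp.
- by rewrite Cm.
- by apply: aeW => w; exact: SE.
- by move=> I ->; split => //; rewrite Cp Cm.
Qed.

Lemma signed_campbell2 n (F : (E * E) * cfg -> R) :
  measurable_fun setT F ->
  (forall x y X, ~ (window (Some n) x /\ window (Some n) y) -> F ((x, y), X) = 0%R) ->
  mix2 (fun p => `|F p|%:E) < +oo ->
  Pr.-integrable setT (EFin \o pair_sum n F) /\
  \int[Pr]_w (pair_sum n F w)%:E = \int[lam \x lam]_z (rho2 z * kmean palm2 F z)%:E.
Proof.
move=> mF FW fin.
have mEF : measurable_fun setT (EFin \o F) by exact/measurable_EFinP.
have mFp : measurable_fun setT (EFin \o F)^\+ by exact: measurable_funepos.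
have mFm : measurable_fun setT (EFin \o F)^\- by exact: measurable_funeneg.
have FpW x y X : ~ (window (Some n) x /\ window (Some n) y) -> (EFin \o F)^\+ ((x, y), X) = 0.
  by move=> /FW h; rewrite funeposE /= h maxxx.
have FmW x y X : ~ (window (Some n) x /\ window (Some n) y) -> (EFin \o F)^\- ((x, y), X) = 0.
  by move=> /FW h; rewrite funenegE /= h oppr0 maxxx.
have [_ ->] := mixture_signed measurable_palm2 measurable_rho2 rho2_ge0 mF fin.
have ip := mixture_funepos_lty measurable_palm2 measurable_rho2 rho2_ge0 mF fin.
have im := mixture_funeneg_lty measurable_palm2 measurable_rho2 rho2_ge0 mF fin.
have Fp0 p : 0 <= (EFin \o F)^\+ p by exact: funepos_ge0.
have Fm0 p : 0 <= (EFin \o F)^\- p by exact: funeneg_ge0.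
have Cp := campbell2 mFp Fp0 FpW; have Cm := campbell2 mFm Fm0 FmW.
pose G (e : (E * E) * cfg -> \bar R) w := \sum_(x \in points (P w) `&` window (Some n))
    \sum_(y \in points (P w) `&` window (Some n)) offdiag (fun x y => e ((x, y), P w)) x y.
have mG e : measurable_fun setT e -> (forall p, 0 <= e p) -> measurable_fun setT (G e).
  by move=> me e0; exact: measurable_offdiag_fsum.
have SE w : (pair_sum n F w)%:E = G (EFin \o F)^\+ w - G (EFin \o F)^\- w.
  have finw := @finite_window R d (P w) n.
  pose g (h : R -> R) x y := if x == y then 0%R else h (F ((x, y), P w)).
  have GE (e : (E * E) * cfg -> \bar R) (h : R -> R) : (forall p, e p = (h (F p))%:E) ->
      G e w = (\sum_(x \in points (P w) `&` window (Some n))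
        \sum_(y \in points (P w) `&` window (Some n)) g h x y)%R%:E.
    move=> eh; rewrite /G -fsumEFin//; apply: eq_fsbigr => x _; rewrite -fsumEFin//.
    by apply: eq_fsbigr => y _; rewrite /offdiag /g; case: ifP.
  rewrite (GE _ (fun r => Num.max r 0%R)); last by move=> p; rewrite funeposE /= EFin_max.
  rewrite (GE _ (fun r => Num.max (- r)%R 0%R)); last by move=> p; rewrite funenegE /= EFin_max.
  rewrite -EFinB -fsumrB//; congr (_%:E); apply: eq_fsbigr => x _; rewrite -fsumrB//.
  apply: eq_fsbigr => y _; rewrite /g; case: ifP => _; first by rewrite subrr.
  by have [h|h] := leP (F ((x, y), P w)) 0%R; have [h'|h'] := leP (- F ((x, y), P w))%R 0%R; lra.
have mS : measurable_fun setT (pair_sum n F).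
  apply/measurable_EFinP; rewrite (_ : _ \o _ = fun w => G (EFin \o F)^\+ w - G (EFin \o F)^\- w).
    by apply: emeasurable_funB; exact: mG.
  by apply/funext => w; exact: SE.
have off0 (e : (E * E) * cfg -> \bar R) w : (forall p, 0 <= e p) -> 0 <= G e w.
  by move=> e0; apply: fsume_ge0 => x _; apply: fsume_ge0 => y _; rewrite /offdiag; case: ifP.
have [] // := @integrable_fine_difference _ _ R Pr (pair_sum n F) (G (EFin \o F)^\+) (G (EFin \o F)^\-).
- exact: mG.
- exact: mG.
- by move=> w; exact: off0.
- by move=> w; exact: off0.
- by rewrite Cp.
- by rewrite Cm.
- by apply: aeW => w; exact: SE.
- by move=> I ->; split => //; rewrite Cp Cm.
Qed.

End campbell.

(** * Volumes of boundary layers *)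

Lemma cvge0 (R : realType) (u : nat -> \bar R) : (forall n, 0 <= u n)%E ->
  (forall e : R, 0 < e -> \forall n \near \oo, (u n <= e%:E)%E) -> u @ \oo --> 0%E.
Proof.
move=> u0 h; apply/fine_cvgP; split.
  apply: filterS (h 1 ltr01) => n un.
  by rewrite ge0_fin_numE// (le_lt_trans un)// ltry.
apply/cvgrPdist_le => e e0; apply: filterS (h e e0) => n un.
rewrite sub0r normrN ger0_norm ?fine_ge0//= -lee_fin fineK//.
by rewrite ge0_fin_numE// (le_lt_trans un)// ltry.
Qed.

Lemma cvge0_le (R : realType) (u : nat -> \bar R) (e : R) : u @ \oo --> 0%E -> 0 < e ->
  \forall n \near \oo, (u n <= e%:E)%E.
Proof.
move=> /fine_cvgP[fu /cvgrPdist_le/(_ e)] h e0.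
near=> n.
have un : u n \is a fin_num by near: n.
rewrite -(fineK un) lee_fin (le_trans (ler_norm _))//.
have : `|0 - (fine \o u) n| <= e by near: n; exact: h.
by rewrite sub0r normrN.
Unshelve. all: by end_near. Qed.

Section volumes.
Context (R : realType) (d : nat).
Hypothesis d_gt0 : (0 < d)%N.
Notation E := 'rV[R]_d.
Notation lam := (lebesgue_row R d).
Notation leb := (@lebesgue_measure R).
Notation L := (side R d).

(* The points of the n-th window at sup-distance at least [a] from its boundary. *)
Definition inner n (a : R) : set E := [set x | forall i, `|x ord0 i| + a <= 2^-1 * L n].

Definition cube (a : R) : set E := [set x | forall i, `|x ord0 i| < a].

Lemma inner0 n : inner n 0 = window (Some n).
Proof. by apply/seteqP; split => x /= h i; have := h i; rewrite addr0. Qed.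

Lemma subset_inner n a b : a <= b -> inner n b `<=` inner n a.
Proof. by move=> ab x h i; have := h i; lra. Qed.

Lemma inner_window n a : 0 <= a -> inner n a `<=` window (Some n).
Proof. by move=> a0; rewrite -inner0; exact: subset_inner. Qed.

Let measurable_normle (a : R) : measurable [set s : R | `|s| <= a].
Proof.
rewrite (_ : [set s | _] = `[- a, a]%classic); first exact: measurable_itv.
by apply/seteqP; split => s /=; rewrite in_itv/= ler_norml.
Qed.

Let measurable_normlt (a : R) : measurable [set s : R | `|s| < a].
Proof.
rewrite (_ : [set s | _] = `]- a, a[%classic); first exact: measurable_itv.
by apply/seteqP; split => s /=; rewrite in_itv/= ltr_norml.
Qed.

Lemma measurable_inner n a : measurable (inner n a).
Proof.
rewrite (_ : inner n a = [set x | forall i : 'I_d, [set s : R | `|s| <= 2^-1 * L n - a] (x ord0 i)]).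
  by apply: (@measurable_box R d (fun=> [set s : R | `|s| <= 2^-1 * L n - a])).
by apply/seteqP; split => x /= h i; have := h i; lra.
Qed.

Lemma measurable_cube a : measurable (cube a).
Proof. by apply: (@measurable_box R d (fun=> [set s : R | `|s| < a])). Qed.

Lemma lebesgue_normle (a : R) : 0 <= a -> leb [set s : R | `|s| <= a] = (2 * a)%:E.
Proof.
move=> a0; rewrite (_ : [set s | _] = `[- a, a]%classic); last first.
  by apply/seteqP; split => s /=; rewrite in_itv/= ler_norml.
rewrite lebesgue_measure_itv/= lte_fin; case: ifPn => [_|].
  by rewrite -EFinD; congr (_%:E); lra.
by rewrite -leNgt => h; congr (_%:E); lra.
Qed.

Lemma lebesgue_window n : lam (window (Some n)) = n%:R%:E.
Proof.
rewrite (_ : window _ = [set x : E | forall i, [set s : R | `|s| <= 2^-1 * L n] (x ord0 i)])//.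
rewrite (@lebesgue_row_box R d (fun=> [set s : R | `|s| <= 2^-1 * L n]))//.
rewrite lebesgue_normle ?mulr_ge0 ?side_ge0// mulrA mulfV// mul1r.
by rewrite big_const_ord iter_mule mule1 -EFin_expe side_pow.
Qed.

Lemma lebesgue_cube (a : R) : 0 <= a -> (lam (cube a) <= ((2 * a) ^+ d)%:E)%E.
Proof.
move=> a0; apply: (@le_trans _ _ (lam [set x : E | forall i, [set s : R | `|s| <= a] (x ord0 i)])).
  apply: le_measure; rewrite ?inE.
  - exact: measurable_cube.
  - exact: (@measurable_box R d (fun=> [set s : R | `|s| <= a])).
  - by move=> x /= h i; exact: ltW.
rewrite (@lebesgue_row_box R d (fun=> [set s : R | `|s| <= a]))//.
by rewrite lebesgue_normle// big_const_ord iter_mule mule1 -EFin_expe.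
Qed.

(** The lower end [a] may be negative, in which case the two intervals for the i-th coordinate
    overlap. This keeps the bound valid for depths exceeding half the side of the window. *)
Lemma lebesgue_slab n (i : 'I_d) (a b : R) : a <= b ->
  (lam [set x | window (Some n) x /\ (a < `|x ord0 i| <= b)%R] <= (2 * (b - a) * L n ^+ d.-1)%:E)%E.
Proof.
move=> ab.
pose I : set R := [set s : R | `|s| <= 2^-1 * L n].
pose J : set R := `[- b, - a] `|` `[a, b].
pose B j := if j == i then J else I.
have mB j : measurable (B j).
  by rewrite /B; case: ifP => _; [apply: measurableU; exact: measurable_itv|exact: measurable_normle].
apply: (@le_trans _ _ (lam [set x : E | forall j, B j (x ord0 j)])).
  apply: le_measure; rewrite ?inE.
  - rewrite (_ : [set x | _] = window (Some n) `&` [set x : E | forall j : 'I_d, (if j == i then [set s | a < `|s| <= b] else setT) (x ord0 j)]).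
      apply: measurableI; first exact: measurable_window.
      apply: (@measurable_box R d (fun j => if j == i then [set s | a < `|s| <= b] else setT)) => j.
      case: ifP => // _.
      rewrite (_ : [set s | _] = [set s : R | `|s| <= b] `\` [set s : R | `|s| <= a]); first exact: measurableD.
      apply/seteqP; split => s /= => [/andP[h1 h2]|[h1 h2]]; first by split => //; lra.
      by rewrite h1 andbT ltNge; exact/negP.
    apply/seteqP; split => x /= [h1 h2]; split => //.
      by move=> j; case: ifP => // /eqP ->.
    by have := h2 i; rewrite eqxx.
  - exact: (@measurable_box R d B).
  - move=> x /= [h1 h2] j; rewrite /B; case: ifP => [/eqP ->|_]; last exact: h1.
    rewrite /J /=; rewrite !in_itv/=.
    have [h|h] := leP 0 (x ord0 i).
      by right; move: h2; rewrite ger0_norm//; lra.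
    by left; move: h2; rewrite ltr0_norm//; lra.
rewrite lebesgue_row_box// (bigD1 i)//= /B eqxx.
have -> : (\prod_(j < d | j != i) leb (if j == i then J else I) = (L n ^+ d.-1)%:E)%E.
  rewrite (eq_bigr (fun=> (L n)%:E)); last first.
    move=> j /negbTE ->; rewrite lebesgue_normle ?mulr_ge0 ?side_ge0//.
    by rewrite mulrA mulfV// mul1r.
  by rewrite big_const iter_mule mule1 cardC1 card_ord -EFin_expe.
rewrite EFinM; apply: lee_wpmul2r; first by rewrite lee_fin exprn_ge0// side_ge0.
apply: (@le_trans _ _ (leb `[(- b)%R, (- a)%R]%classic + leb `[a, b]%classic)%E).
  by apply: measureU2; exact: measurable_itv.
rewrite !lebesgue_measure_itv/= !lte_fin.
by case: ifPn => h1; case: ifPn => h2; rewrite -?EFinD -?EFinN ?lee_fin; lra.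
Qed.

(** A point of the layer has some coordinate at distance less than [b] from the boundary, so that d
    slabs cover the layer, one for each coordinate. *)
Lemma lebesgue_layer n (a b : R) : 0 <= a -> a <= b ->
  (lam (inner n a `\` inner n b) <= (d%:R * (2 * (b - a) * L n ^+ d.-1))%:E)%E.
Proof.
move=> a0 ab.
pose S i := [set x : E | window (Some n) x /\ (2^-1 * L n - b < `|x ord0 i| <= 2^-1 * L n - a)%R].
have mS i : measurable (S i).
  rewrite (_ : S i = window (Some n) `&` ((fun x : E => x ord0 i) @^-1`
      ([set s : R | `|s| <= 2^-1 * L n - a] `\` [set s : R | `|s| <= 2^-1 * L n - b]))).
    apply: measurableI; first exact: measurable_window.
    by apply: measurable_pushforwardP; [exact: measurable_coord|exact: measurableD].
  apply/seteqP; split => x /= [h1]; first by move=> /andP[h2 h3]; split => //; split => //; lra.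
  by move=> [h2 h3]; split => //; rewrite h2 andbT ltNge; exact/negP.
apply: (@le_trans _ _ (lam (\big[setU/set0]_(i < d) S i))).
  apply: le_measure; rewrite ?inE.
  - by apply: measurableD; exact: measurable_inner.
  - by apply: bigsetU_measurable.
  - move=> x [ha hb]; rewrite -bigcup_seq.
    have [i hi] : exists i, ~ (`|x ord0 i| + b <= 2^-1 * L n) by apply/existsNP.
    exists i; first by rewrite /= mem_index_enum.
    split; first exact: inner_window ha.
    by have := ha i; move/negP: hi; rewrite -ltNge => *; apply/andP; split; lra.
apply: (@le_trans _ _ (\sum_(i < d) lam (S i))%E).
  suff [] : measurable (\big[setU/set0]_(i < d) S i) /\
    (lam (\big[setU/set0]_(i < d) S i) <= \sum_(i < d) lam (S i))%E by [].
  elim/big_ind2 : _ => [|A r B s [mA Ar] [mB Bs]|i _]; first by rewrite measure0.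
    by split; [exact: measurableU|rewrite (le_trans (measureU2 _ mA mB))// leeD].
  by split => //; exact: mS.
apply: (@le_trans _ _ (\sum_(i < d) (2 * (b - a) * L n ^+ d.-1)%:E)%E).
  apply: lee_sum => i _.
  have := @lebesgue_slab n i (2^-1 * L n - b) (2^-1 * L n - a).
  have -> : 2^-1 * L n - a - (2^-1 * L n - b) = b - a by lra.
  by apply; lra.
by rewrite sumEFin lee_fin sumr_const card_ord -[leLHS]mulr_natl.
Qed.

Lemma side_pow_pred n : (0 < n)%N -> L n ^+ d.-1 = n%:R / L n.
Proof.
move=> n0; have <- : L n ^+ d.-1 * L n = n%:R by rewrite -exprSr prednK// side_pow.
by rewrite mulfK// lt0r_neq0// side_gt0.
Qed.

End volumes.

(** * Integrable majorants constant on cubical shells *)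

Section summable_bound.
Context (R : realType).

(* Summability with an explicit majorant, whose partial sums telescope. *)
Definition telescoping_bound (u : nat -> R) :=
  exists C : R, forall k, u k <= C / (k.+1%:R * k.+2%:R).

Lemma sum_telescoping n : \sum_(k < n) (k.+1%:R * k.+2%:R)^-1 = 1 - n.+1%:R^-1 :> R.
Proof.
elim: n => [|n IH]; first by rewrite big_ord0 invr1 subrr.
rewrite big_ord_recr /= IH.
have a0 : 0 <= n%:R :> R by [].
rewrite -!natr1; set a := n%:R in a0 *.
have h1 : a + 1 != 0 by apply: lt0r_neq0; lra.
have h2 : a + 1 + 1 != 0 by apply: lt0r_neq0; lra.
by field; rewrite h1 h2.
Qed.

Lemma telescoping_nneseries (u : nat -> R) : (forall k, 0 <= u k) ->
  telescoping_bound u -> (\sum_(k <oo) (u k)%:E < +oo)%E.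
Proof.
move=> u0 [C uC].
have C0 : 0 <= C.
  have := le_trans (u0 0%N) (uC 0%N).
  by rewrite pmulr_lge0// invr_gt0 mulr_gt0.
apply: (@le_lt_trans _ _ C%:E); last by rewrite ltry.
apply: lime_le; first by apply: is_cvg_nneseries => n _ _; rewrite lee_fin.
apply: nearW => n; rewrite big_mkord sumEFin lee_fin.
apply: (@le_trans _ _ (\sum_(k < n) C / (k.+1%:R * k.+2%:R))); first exact: ler_sum.
by rewrite -mulr_sumr sum_telescoping -[leRHS]mulr1 ler_wpM2l// gerBl.
Qed.

Lemma nneseries_ge_term (u : nat -> \bar R) k : (forall n, 0 <= u n)%E ->
  (u k <= \sum_(n <oo) u n)%E.
Proof.
move=> u0; apply: (@le_trans _ _ (\sum_(0 <= n < k.+1) u n)%E).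
  by rewrite big_nat_recr//= leeDr// sume_ge0.
exact: nneseries_lim_ge.
Qed.

End summable_bound.

Section shells.
Context (R : realType) (d : nat).
Hypothesis d_gt0 : (0 < d)%N.
Notation E := 'rV[R]_d.
Notation lam := (lebesgue_row R d).

Definition shell (k : nat) : set E := cube k.+1%:R `\` cube k%:R.

Lemma measurable_shell k : measurable (shell k).
Proof. by apply: measurableD; exact: measurable_cube. Qed.

Lemma coord_le_enorm (z : E) i : `|z ord0 i| <= enorm z.
Proof.
rewrite -sqrtr_sqr; apply: ler_wsqrtr.
by rewrite (bigD1 i)//= lerDl sumr_ge0// => j _; exact: sqr_ge0.
Qed.

Lemma shell_cover (z : E) : exists k, shell k z /\ k%:R <= enorm z.
Proof.
have ex : exists m, `[< cube m%:R z >].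
  exists (Num.truncn (enorm z)).+1; apply/asboolP => i.
  exact: (le_lt_trans (coord_le_enorm z i) (truncnS_gt _)).
case: (ex_minnP ex) => -[|k] /asboolP kz kmin.
  by have := kz (Ordinal d_gt0); rewrite ltNge normr_ge0.
have nk : ~ cube k%:R z by move=> /asboolP/kmin; rewrite ltnn.
exists k; split; first by split.
have [i hi] : exists i, ~ (`|z ord0 i| < k%:R) by apply/existsNP.
by apply: le_trans (coord_le_enorm z i); rewrite leNgt; exact/negP.
Qed.

(** A step function above z -> phi (c |z|): a point of the k-th shell has norm at least k and phi is
    non-increasing. Its integral is a series whose k-th volume is at most (2 (k + 1))^d. *)
Definition shell_majorant (phi : R -> R) (c : R) (z : E) : \bar R :=
  (\sum_(k <oo) (phi (c * k%:R))%:E * (\1_(shell k) z)%:E)%E.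

Context (phi : R -> R) (c : R).
Hypotheses (c0 : 0 < c) (phi_fast : fast_decreasing phi).

Let phi0 (k : nat) : 0 <= phi (c * k%:R).
Proof. by have [h _ _] := phi_fast; have /andP[] := h (c * k%:R) (mulr_ge0 (ltW c0) (ler0n _ _)). Qed.

Let term0 z k : (0 <= (phi (c * k%:R))%:E * (\1_(shell k) z)%:E :> \bar R)%E.
Proof. by rewrite mule_ge0 ?lee_fin. Qed.

Lemma shell_majorant_ge0 z : (0 <= shell_majorant phi c z)%E.
Proof. by apply: nneseries_ge0 => n _ _; exact: term0. Qed.

Lemma shell_majorant_ge z : ((phi (c * enorm z))%:E <= shell_majorant phi c z)%E.
Proof.
have [k [zk kz]] := shell_cover z.
apply: le_trans (nneseries_ge_term k (term0 z)).
rewrite indicE mem_set// mule1 lee_fin.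
have [_ h _] := phi_fast; apply: h; first by rewrite mulr_ge0// ltW.
by rewrite ler_wpM2l// ltW.
Qed.

Lemma measurable_shell_majorant : measurable_fun setT (shell_majorant phi c).
Proof.
apply: ge0_emeasurable_sum => // k _; apply: emeasurable_funM => //.
apply/measurable_EFinP; apply/measurable_indicP; exact: measurable_shell.
Qed.

(** The decay of t^(d + 2) phi(t) pays for the volume of the k-th cube and for the factor (k + 1)(k
    + 2). Here d is only an exponent; another one is substituted when summing over boundary
    layers. *)
Lemma telescoping_fast : telescoping_bound (fun k => phi (c * k%:R) * (2 * k.+1%:R) ^+ d).
Proof.
have [h01 _ /(_ d.+2 (ltn0Sn _)) lim] := phi_fast.
have [T [Treal hT]] : \forall t \near +oo, t ^+ d.+2 * phi t <= 1.
  have /cvgrPdist_le/(_ 1 ltr01) := lim; apply: filterS => t.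
  by rewrite sub0r normrN; apply: le_trans; exact: ler_norm.
pose K := (Num.truncn (`|T| / c)).+2.
(* For k >= 1, (2 (k + 1))^d <= (4 k)^d and (k + 1)(k + 2) <= 6 k^2, while (c k)^(d + 2) phi(c k) <=
   1 from the index [K] on. [B] absorbs the smaller indices. *)
pose A := 6 * 4 ^+ d / c ^+ d.+2.
pose B := \sum_(k < K) phi (c * k%:R) * (2 * k.+1%:R) ^+ d * (k.+1%:R * k.+2%:R).
have c2 : 0 < c ^+ d.+2 by exact: exprn_gt0.
have A0 : 0 <= A by apply: divr_ge0; [apply: mulr_ge0 => //; exact: exprn_ge0|exact: ltW].
have t0 (k : nat) : 0 <= phi (c * k%:R) * (2 * k.+1%:R) ^+ d * (k.+1%:R * k.+2%:R).
  by rewrite !mulr_ge0// exprn_ge0// mulr_ge0.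
have B0 : 0 <= B by apply: sumr_ge0 => k _; exact: t0.
exists (A + B) => k; rewrite ler_pdivlMr ?mulr_gt0//.
have [kK|Kk] := ltnP k K.
  apply: (@le_trans _ _ B); last by rewrite lerDr.
  by rewrite /B (bigD1 (Ordinal kK))//= lerDl sumr_ge0// => i _; exact: t0.
apply: (@le_trans _ _ A); last by rewrite lerDl.
have k1 : (1 <= k)%N by apply: leq_trans Kk.
have k1R : 1 <= k%:R :> R by rewrite ler1n.
have Tk : T < c * k%:R.
  rewrite mulrC -ltr_pdivrMr//; apply: le_lt_trans (ler_wpM2r _ (ler_norm T)) _; first by rewrite invr_ge0 ltW.
  by apply: lt_le_trans (truncnS_gt _) _; rewrite ler_nat (leq_trans _ Kk).
have := hT _ Tk; rewrite exprMn => hk.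
have e1 : (2 * k.+1%:R) ^+ d <= (4 * k%:R) ^+ d :> R.
  by apply: lerXn2r; rewrite ?nnegrE ?mulr_ge0//; rewrite -natr1; lra.
have e2 : k.+1%:R * k.+2%:R <= 6 * k%:R ^+ 2 :> R.
  have -> : k.+2%:R = k%:R + 2 :> R by rewrite -natr1 -natr1; lra.
  by rewrite -natr1 expr2; nra.
have p0 := phi0 k.
apply: (@le_trans _ _ (phi (c * k%:R) * (4 * k%:R) ^+ d * (6 * k%:R ^+ 2))).
  apply: ler_pM => //; first by rewrite mulr_ge0// exprn_ge0// mulr_ge0.
  by rewrite ler_wpM2l.
rewrite /A ler_pdivlMr//.
rewrite (_ : _ * c ^+ d.+2 = (6 * 4 ^+ d) * (c ^+ d.+2 * k%:R ^+ d.+2 * phi (c * k%:R))); last first.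
  by rewrite exprMn (exprS c d.+1) (exprS c d) (exprS k%:R d.+1) (exprS k%:R d); ring.
by rewrite -[leRHS]mulr1 ler_wpM2l// mulr_ge0// exprn_ge0.
Qed.

Lemma integral_shell_majorant : (\int[lam]_z shell_majorant phi c z < +oo)%E.
Proof.
have mI k : measurable_fun setT (fun z : E => (\1_(shell k) z)%:E : \bar R).
  by apply/measurable_EFinP/measurable_indicP; exact: measurable_shell.
rewrite integral_nneseries//; last by move=> k; exact: emeasurable_funM.
apply: le_lt_trans (telescoping_nneseries _ telescoping_fast); last first.
  by move=> k; rewrite mulr_ge0// exprn_ge0// mulr_ge0.
apply: lee_nneseries => [k _ _|k _]; first by apply: integral_ge0 => z _; exact: term0.
rewrite ge0_integralZl ?lee_fin//.
rewrite EFinM; apply: lee_wpmul2l; first by rewrite lee_fin.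
rewrite integral_indic//; last exact: measurable_shell.
apply: le_trans (lebesgue_cube d (ler0n R k.+1)).
rewrite setIT; apply: le_measure; rewrite ?inE; [exact: measurable_shell|exact: measurable_cube|].
by move=> z [].
Qed.

Lemma shell_majorant_tail :
  (\int[lam]_z (shell_majorant phi c z * (\1_(~` cube k%:R) z)%:E))%E @[k --> \oo] --> 0%E.
Proof.
have mI k : measurable_fun setT (fun z : E => (\1_(~` cube k%:R) z)%:E : \bar R).
  by apply/measurable_EFinP; apply/measurable_indicP; apply: measurableC; exact: measurable_cube.
have mH := measurable_shell_majorant.
have [] // := @dominated_convergence _ _ R lam setT measurableT
  (fun k z => shell_majorant phi c z * (\1_(~` cube k%:R) z)%:E)%E (cst 0%E) (shell_majorant phi c).
- by move=> k; exact: emeasurable_funM.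
- apply: aeW => z _; have [k [[zk _] _]] := shell_cover z.
  apply: cvg_near_cst; exists k.+1 => // n /= kn.
  rewrite indicE memNset ?mule0//; apply; move=> i; apply: lt_le_trans (zk i) _.
  by rewrite ler_nat.
- apply/integrableP; split => //; under eq_integral do rewrite gee0_abs ?shell_majorant_ge0//.
  exact: integral_shell_majorant.
- apply: aeW => z n _; rewrite gee0_abs ?mule_ge0 ?shell_majorant_ge0 ?lee_fin//.
  rewrite -[leRHS]mule1; apply: lee_wpmul2l; first exact: shell_majorant_ge0.
  by rewrite lee_fin indicE lern1 leq_b1.
by move=> _ _; rewrite integral0.
Qed.

End shells.

(** * Null sets of points, of pairs and of differences *)

Section ae_products.
Context (R : realType) (d : nat).
Hypothesis d_gt0 : (0 < d)%N.
Notation E := 'rV[R]_d.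
Notation lam := (lebesgue_row R d).

Lemma measurable_diff : measurable_fun setT (fun p : E * E => p.2 - p.1).
Proof. exact: measurable_rowB. Qed.

Let prod_indic (D : set (E * E)) : measurable D ->
  ((lam \x lam) D = \int[lam]_x \int[lam]_y (\1_D (x, y))%:E)%E.
Proof.
move=> mD; rewrite -[in LHS](setIT D) -integral_indic// fubini_tonelli1//.
exact/measurable_EFinP/measurable_indicP.
Qed.

(** Null sets cannot contain the unit window. The point obtained serves as a base point from which
    translation covariance carries a bound elsewhere. *)
Lemma ae_exists (Q : E -> Prop) : {ae lam, forall x, Q x} -> exists x, Q x.
Proof.
move=> [B [mB B0 QB]]; apply: contrapT => /forallNP nQ.
have : (lam (window (Some 1%N)) <= lam B)%E.
  apply: le_measure; rewrite ?inE//; first exact: measurable_window.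
  by move=> x _; apply: QB; exact: nQ.
by rewrite lebesgue_window// [leRHS](_ : _ = 0%E)// lee_fin ler10.
Qed.

Lemma ae_prod_fst (Q : E -> Prop) : {ae lam, forall x, Q x} -> {ae (lam \x lam)%E, forall p, Q p.1}.
Proof.
move=> [B [mB B0 QB]]; have mD : measurable ((fst : E * E -> E) @^-1` B).
  by apply: measurable_pushforwardP => //; exact: measurable_fst.
exists (fst @^-1` B); split => //; last by move=> p; exact: QB.
rewrite prod_indic// (fubini_tonelli (fun p => (\1_(fst @^-1` B) p)%:E))//; last by apply/measurable_EFinP/measurable_indicP.
rewrite integral0_eq// => y _; rewrite -[RHS]B0 -[in RHS](setIT B) -integral_indic//.
Qed.

Lemma ae_prod_snd (Q : E -> Prop) : {ae lam, forall x, Q x} -> {ae (lam \x lam)%E, forall p, Q p.2}.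
Proof.
move=> [B [mB B0 QB]]; have mD : measurable ((snd : E * E -> E) @^-1` B).
  by apply: measurable_pushforwardP => //; exact: measurable_snd.
exists (snd @^-1` B); split => //; last by move=> p; exact: QB.
rewrite prod_indic//.
rewrite integral0_eq// => y _; rewrite -[RHS]B0 -[in RHS](setIT B) -integral_indic//.
Qed.

Lemma ae_prod_diff (Q : E -> Prop) :
  {ae lam, forall z, Q z} -> {ae (lam \x lam)%E, forall p, Q (p.2 - p.1)}.
Proof.
move=> [B [mB B0 QB]]; have mD : measurable ((fun p : E * E => p.2 - p.1) @^-1` B).
  by apply: measurable_pushforwardP => //; exact: measurable_diff.
exists ((fun p : E * E => p.2 - p.1) @^-1` B); split => //; last by move=> p; exact: QB.
rewrite prod_indic// integral0_eq// => x _.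
rewrite -[RHS]B0 -[in RHS](setIT B) -integral_indic//.
rewrite -[RHS](ge0_integral_shift (- x))//.
exact/measurable_EFinP/measurable_indicP.
Qed.

(** By Tonelli almost every section of the exceptional set is null; one such section, translated by
    its base point, is an exceptional set for the differences. The pairs (0, z), themselves a null
    set of pairs, are reached in this way. *)
Lemma ae_diff_prod (Q : E -> Prop) :
  {ae (lam \x lam)%E, forall p, Q (p.2 - p.1)} -> {ae lam, forall z, Q z}.
Proof.
move=> [B [mB]]; rewrite prod_indic// => B0 QB.
have mI : measurable_fun setT (fun p => (\1_B p)%:E : \bar R).
  exact/measurable_EFinP/measurable_indicP.
have : {ae lam, forall x, (\int[lam]_y (\1_B (x, y))%:E = 0)%E}.
  have I0 (p : E * E) : (0 <= (\1_B p)%:E :> \bar R)%E by rewrite lee_fin.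
  have mF := measurable_fun_fubini_tonelli_F (m2 := lam) _ mI I0.
  have [+ _] := ae_eq_integral_abs lam measurableT mF.
  rewrite (_ : (\int[lam]_x _)%E = 0%E).
    by move=> /(_ erefl); apply: filterS => x; apply.
  rewrite -[RHS]B0; apply: eq_integral => x _; rewrite gee0_abs//.
  by apply: integral_ge0 => y _; exact: I0.
move=> /ae_exists[x x0].
have mIx : measurable_fun setT (fun y => (\1_B (x, y))%:E : \bar R).
  exact: (measurableT_comp mI (measurable_pair1 x)).
have mS : measurable [set z | B (x, z + x)].
  have mf : measurable_fun setT (fun z : E => (x, z + x)).
    by apply/measurable_fun_pairP; split; [exact: measurable_cst|exact: measurable_rowD].
  exact: (measurable_pushforwardP mf mB).
exists [set z | B (x, z + x)]; split => //.
  rewrite -[in LHS](setIT [set z | _]) -integral_indic//.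
  by rewrite -[RHS]x0 -[RHS](ge0_integral_shift x).
by move=> z Qz; apply: QB => /=; rewrite addrK.
Qed.

End ae_products.

(** * Continuity of translations in L^1 *)

Section orthants.
Context (R : realType) (d : nat).
Notation E := 'rV[R]_d.

Definition ray (B : set R) := B = setT \/ exists a, B = `]a, +oo[%classic.

(** A generating system stable under intersection. Leaving some coordinates free brings in the
    half-spaces, and intersecting with the unit window gives products of intervals, for which
    translations can be handled by hand. *)
Definition orthant : set_system E :=
  [set A | exists B : 'I_d -> set R, (forall i, ray (B i)) /\
    A = [set x : E | forall i, B i (x ord0 i)]].

Lemma measurable_ray B : ray B -> measurable B.
Proof. by move=> [->|[a ->]]; [exact: measurableT|exact: measurable_itv]. Qed.

Lemma rayI B C : ray B -> ray C -> ray (B `&` C).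
Proof.
move=> [->|[a ->]] [->|[b ->]]; rewrite ?setTI ?setIT.
- by left.
- by right; exists b.
- by right; exists a.
right; exists (Num.max a b); apply/seteqP; split => x /=; rewrite !in_itv/= !andbT gt_max.
  by move=> [-> ->].
by move/andP.
Qed.

Lemma orthant_setI_closed : setI_closed orthant.
Proof.
move=> _ _ [B [rB ->]] [C [rC ->]]; exists (fun i => B i `&` C i); split.
  by move=> i; exact: rayI.
by apply/seteqP; split => x /= => [[h1 h2] i|h]; [split|split => i; have [] := h i].
Qed.

Lemma measurable_orthantE : @measurable _ E = <<s orthant >>.
Proof.
apply/seteqP; split.
  have sub i (C : set R) : measurable C -> <<s orthant >> ((fun x : E => x ord0 i) @^-1` C).
    have mcoord : measurable_fun [set: g_sigma_algebraType orthant] (fun x : E => x ord0 i : R).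
      apply: (@measurability _ _ (g_sigma_algebraType orthant) _ setT (fun x : E => x ord0 i : R) (@RGenOInfty.G R) (RGenOInfty.measurableE R)).
      move=> _ [_ [a ->] <-]; apply: sub_sigma_algebra.
      exists (fun j => if j == i then `]a, +oo[%classic else setT); split.
        by move=> j; case: ifP => _; [right; exists a|left].
      rewrite setTI; apply/seteqP; split => x /= h.
        by move=> j; case: ifP => // /eqP ->.
      by have := h i; rewrite eqxx.
    by move=> mC; have := mcoord measurableT C mC; rewrite setTI.
  apply: smallest_sub; first exact: smallest_sigma_algebra.
  move=> A; rewrite -bigcup_seq => -[i _ [C mC <-]].
  by rewrite setTI; exact: sub.
apply: smallest_sub; first exact: sigma_algebra_measurable.
move=> _ [B [rB ->]]; apply: measurable_box => i; exact: measurable_ray.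
Qed.

End orthants.

Section translation.
Context (R : realType) (d : nat).
Hypothesis d_gt0 : (0 < d)%N.
Notation E := 'rV[R]_d.
Notation lam := (lebesgue_row R d).
Notation W := (window (Some 1%N) : set E).
Variables (a : nat -> R) (z : E).
Hypotheses (a01 : forall n, 0 <= a n <= 1) (a_cvg : a @ \oo --> 0).
Local Open Scope ereal_scope.

Definition translation_error (f : E -> R) n := \int[lam]_u `|f (u + a n *: z)%R - f u|%:E.

Definition translation_continuous (f : E -> R) :=
  measurable_fun setT f /\ translation_error f @ \oo --> 0.

Let measurable_shift_by (f : E -> R) n : measurable_fun setT f ->
  measurable_fun setT (fun u : E => f (u + a n *: z)%R).
Proof.
by move=> mf; apply: measurableT_comp => //; exact: measurable_rowD.
Qed.

Let measurable_translation_error (f : E -> R) n : measurable_fun setT f ->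
  measurable_fun setT (fun u : E => `|f (u + a n *: z)%R - f u|%:E).
Proof.
move=> mf; apply/measurable_EFinP; apply: measurableT_comp => //.
by apply: measurable_funB => //; exact: measurable_shift_by.
Qed.

Lemma translation_error_ge0 f n : 0 <= translation_error f n.
Proof. by apply: integral_ge0 => u _; rewrite lee_fin. Qed.

Lemma translation_error_le2 f n : measurable_fun setT f ->
  translation_error f n <= 2%:E * \int[lam]_u `|f u|%:E.
Proof.
move=> mf.
have mfn : measurable_fun setT (fun u : E => `|f u|%:E : \bar R).
  by apply/measurable_EFinP; exact: measurableT_comp.
have mfs : measurable_fun setT (fun u : E => `|f (u + a n *: z)%R|%:E : \bar R).
  by apply/measurable_EFinP; apply: measurableT_comp => //; exact: measurable_shift_by.
apply: (@le_trans _ _ (\int[lam]_u (`|f (u + a n *: z)%R|%:E + `|f u|%:E))).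
  apply: ge0_le_integral => //.
  - exact: measurable_translation_error.
  - exact: emeasurable_funD.
  - by move=> u _; rewrite -EFinD lee_fin ler_normB.
rewrite ge0_integralD// (ge0_integral_shift _ (F := fun u => `|f u|%:E))//.
by rewrite mule_natl mule2n.
Qed.

Lemma translation_error_lin f g (r s : R) n : measurable_fun setT f -> measurable_fun setT g ->
  translation_error (fun u : E => r * f u + s * g u)%R n <= `|r|%:E * translation_error f n + `|s|%:E * translation_error g n.
Proof.
move=> mf mg; rewrite /translation_error -!ge0_integralZl//; try exact: measurable_translation_error.
rewrite -ge0_integralD//; try by move=> u _; rewrite -EFinM lee_fin mulr_ge0.
- apply: ge0_le_integral => //.
  + apply: measurable_translation_error; apply: measurable_funD; exact: measurable_funM.
  + by apply: emeasurable_funD; apply: measurable_funeM; exact: measurable_translation_error.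
  + move=> u _; rewrite -!EFinM -EFinD lee_fin -!normrM.
    apply: le_trans (ler_normD _ _); rewrite le_eqVlt; apply/orP; left; apply/eqP.
    by congr (`|_|%R); ring.
- by apply: measurable_funeM; exact: measurable_translation_error.
- by apply: measurable_funeM; exact: measurable_translation_error.
Qed.

Lemma translation_continuous_lin f g (r s : R) :
  translation_continuous f -> translation_continuous g ->
  translation_continuous (fun u : E => r * f u + s * g u)%R.
Proof.
move=> [mf cf] [mg cg]; split; first by apply: measurable_funD; exact: measurable_funM.
apply: (@squeeze_cvge _ _ _ _ (fun=> 0) _ (fun n => `|r|%:E * translation_error f n + `|s|%:E * translation_error g n)).
- by apply: nearW => n; rewrite translation_error_ge0 translation_error_lin.
- exact: cvg_cst.
rewrite [X in _ --> X](_ : 0 = `|r|%:E * 0 + `|s|%:E * 0); last by rewrite !mule0 adde0.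
by apply: cvgeD; [rewrite !mule0|exact: cvgeZl|exact: cvgeZl].
Qed.

(** Stability under L^1 limits: the error of f is at most the error of g plus twice the L^1 distance
    from f to g. *)
Lemma translation_continuous_approx (f : E -> R) : measurable_fun setT f ->
  (forall e : R, (0 < e)%R -> exists g, translation_continuous g /\
    \int[lam]_u `|f u - g u|%:E <= e%:E) ->
  translation_continuous f.
Proof.
move=> mf h; split => //; apply: cvge0 => [n|e e0]; first exact: translation_error_ge0.
have e40 : (0 < e / 4)%R by lra.
have [g [[mg cg] fg]] := h _ e40.
have e20 : (0 < e / 2)%R by lra.
apply: filterS (cvge0_le cg e20) => n gn.
have -> : f = (fun u : E => 1 * (f u - g u) + 1 * g u)%R by apply/funext => u; ring.
have mfg : measurable_fun setT (fun u : E => f u - g u)%R by exact: measurable_funB.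
apply: (le_trans (translation_error_lin _ _ _ mfg mg)).
rewrite normr1 !mul1e.
have -> : e = (2 * (e / 4) + e / 2)%R by lra.
rewrite EFinD EFinM; apply: leeD => //.
by apply: (le_trans (translation_error_le2 _ mfg)); rewrite lee_pmul2l.
Qed.

Let cvg_at (i : 'I_d) : (fun n => a n * z ord0 i)%R @ \oo --> (0 : R)%R.
Proof. by rewrite -[X in _ --> X](mul0r (z ord0 i)); apply: cvgMl. Qed.

Lemma lebesgue_hyperplane (i : 'I_d) (s : R) : lam [set x : E | x ord0 i = s] = 0.
Proof.
pose B j : set R := if j == i then [set s] else setT.
have -> : [set x : E | x ord0 i = s] = [set x : E | forall j, B j (x ord0 j)].
  apply/seteqP; split => x /=; last by move=> /(_ i); rewrite /B eqxx.
  by move=> xs j; rewrite /B; case: ifP => // /eqP ->.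
rewrite lebesgue_row_box; last by move=> j; rewrite /B; case: ifP.
by rewrite (bigD1 i)//= {1}/B eqxx lebesgue_measure_set1 mul0e.
Qed.

(** [D i] collects the endpoints of the i-th interval. Off the null union of the corresponding
    hyperplanes, a small shift does not change membership in the box, and dominated convergence
    applies. *)
Lemma translation_continuous_box (J : 'I_d -> set R) (D : 'I_d -> set R) :
  (forall i, measurable (J i)) -> (forall i, finite_set (D i)) ->
  (forall i x, J i x -> (`|x| <= 2^-1)%R) ->
  (forall i x, ~ D i x -> forall t : nat -> R, t @ \oo --> (0 : R)%R ->
     \forall n \near \oo, J i (x + t n)%R <-> J i x) ->
  translation_continuous (\1_[set u : E | forall i, J i (u ord0 i)]).
Proof.
move=> mJ fD J2 JD.
set A := [set u : E | _].
have mA : measurable A by exact: measurable_box.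
have mI : measurable_fun setT (\1_A : E -> R) by exact/measurable_indicP.
split => //.
(* The box lies in the cube of half-side 1/2 and a shift moves the i-th coordinate by at most |z_i|,
   so both indicators vanish outside [cube M]. *)
pose M := (1 + \sum_i `|z ord0 i|)%R.
have M0 : (0 <= M)%R by rewrite addr_ge0// sumr_ge0.
have Mi i : (2^-1 + `|z ord0 i| < M)%R.
  rewrite /M (bigD1 i)//=; have : (0 <= \sum_(j < d | j != i) `|z ord0 j|)%R by rewrite sumr_ge0.
  lra.
have [] // := @dominated_convergence _ _ R lam setT measurableT
  (fun n u => `|\1_A (u + a n *: z)%R - \1_A u|%:E) (cst 0) (fun u => (\1_(@cube R d M) u)%:E).
- by move=> n; exact: measurable_translation_error.
- have neg i : lam.-negligible [set u : E | D i (u ord0 i)].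
    apply: (negligibleS (A := \bigcup_k [set u : E | u ord0 i = nth 0%R (finmap.enum_fset (fset_set (D i))) k])).
      move=> u /= Du; have us : u ord0 i \in finmap.enum_fset (fset_set (D i)).
        by have := in_fset_set (fD i) (u ord0 i); rewrite mem_set//.
      by exists (index (u ord0 i) (finmap.enum_fset (fset_set (D i)))) => //=; rewrite nth_index.
    apply: negligible_bigcup => k; apply/negligibleP; last exact: lebesgue_hyperplane.
    exact: (measurable_pushforwardP (@measurable_coord R d i) (measurable_set1 _)).
  have aeD : {ae lam, forall u : E, forall i, ~ D i (u ord0 i)}.
    apply: (negligibleS (A := \big[setU/set0]_(i < d) [set u : E | D i (u ord0 i)])).
      by move=> u /= /existsNP[i /contrapT Du]; rewrite -bigcup_seq; exists i; rewrite //= mem_index_enum.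
    elim/big_ind : _ => [|B C nB nC|i _]; [exact: negligible_set0|exact: negligibleU|exact: neg].
  apply: filterS aeD => u Du _.
  apply: cvg_near_cst.
  have ev : \forall n \near \oo, forall i, J i (u ord0 i + a n * z ord0 i)%R <-> J i (u ord0 i).
    by apply: filter_forall => i; apply: JD => //; exact: cvg_at.
  apply: filterS ev => n h.
  have -> : \1_A (u + a n *: z)%R = \1_A u :> R.
    rewrite !indicE; congr ((_ : bool)%:R); apply/idP/idP; rewrite !inE => Au i.
      by apply/h; have := Au i; rewrite !mxE.
    by rewrite !mxE; apply/h; exact: Au.
  by rewrite subrr normr0.
- apply/integrableP; split; first by apply/measurable_EFinP/measurable_indicP; exact: measurable_cube.
  under eq_integral do rewrite gee0_abs ?lee_fin//.
  rewrite integral_indic//; last exact: measurable_cube.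
  by rewrite setIT (le_lt_trans (lebesgue_cube d M0))// ltry.
- apply: aeW => u n _; rewrite gee0_abs ?lee_fin//.
  have [uM|] := boolP (u \in cube M).
    by rewrite !indicE uM; case: (_ \in A); case: (_ \in A); rewrite /= ?subrr ?subr0 ?sub0r ?normrN ?normr1 ?normr0.
  move=> uM.
  have nA : ~ A u.
    move=> Au; move/negP: uM; apply; rewrite inE => i; apply: le_lt_trans (J2 _ _ (Au i)) _.
    by apply: le_lt_trans (Mi i); rewrite lerDl.
  have nA' : ~ A (u + a n *: z)%R.
    move=> Au; move/negP: uM; apply; rewrite inE => i; apply: le_lt_trans (Mi i).
    have := J2 _ _ (Au i); rewrite !mxE => h.
    have h2 : (`|a n * z ord0 i| <= `|z ord0 i|)%R.
      by rewrite normrM ger0_norm ?ler_piMl//; have /andP[] := a01 n.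
    have : (`|u ord0 i| <= `|u ord0 i + a n * z ord0 i| + `|a n * z ord0 i|)%R.
      by rewrite -{1}(addrK (a n * z ord0 i)%R (u ord0 i)) ler_normB.
    lra.
  by rewrite !indicE (memNset nA) (memNset nA')/= subr0 normr0.
by move=> _ _; rewrite integral0.
Qed.

Let near_cmp (s b : R) (t : nat -> R) : s != b -> t @ \oo --> (0 : R)%R ->
  \forall n \near \oo, [/\ (s + t n <= b)%R = (s <= b)%R, (b < s + t n)%R = (b < s)%R &
    (b <= s + t n)%R = (b <= s)%R].
Proof.
move=> sb /cvgrPdist_lt/(_ `|s - b|%R); rewrite normr_gt0 subr_eq0 => /(_ sb).
apply: filterS => n; rewrite sub0r normrN => tn.
move: sb; rewrite neq_lt => /orP[h|h]; move: tn; rewrite ltr_norml.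
  rewrite ltr0_norm ?subr_lt0// => /andP[_ h2].
  have h3 : (s + t n < b)%R by lra.
  by rewrite (ltW h) (ltW h3) !ltNge (ltW h) (ltW h3) !leNgt h h3.
rewrite gtr0_norm ?subr_gt0// => /andP[h1 _].
have h3 : (b < s + t n)%R by lra.
by rewrite h h3 (ltW h) (ltW h3) !leNgt h h3.
Qed.

Lemma windowE1 : W = [set u : E | forall i, (`|u ord0 i| <= 2^-1)%R].
Proof. by rewrite /window powR1 mulr1. Qed.

Lemma translation_continuous_orthant A : orthant A -> translation_continuous (\1_(A `&` W)).
Proof.
move=> [B [rB ->]].
(* A free coordinate receives the dummy endpoint 0, which merely adds a null hyperplane to the
   exceptional set. *)
have /choice[b Bb] : forall i, exists c : R, B i = setT \/ B i = `]c, +oo[%classic.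
  by move=> i; have [->|[c ->]] := rB i; [exists 0%R; left|exists c; right].
pose J i : set R := B i `&` [set s | (`|s| <= 2^-1)%R].
have -> : [set x : E | forall i, B i (x ord0 i)] `&` W = [set x : E | forall i, J i (x ord0 i)].
  rewrite windowE1; apply/seteqP; split => x /= => [[h1 h2] i|h]; first by split; [exact: h1|exact: h2].
  by split => i; have [] := h i.
apply: (@translation_continuous_box J (fun i => [set 2^-1%R; (- 2^-1)%R; b i])).
- move=> i; apply: measurableI; first exact: measurable_ray.
  rewrite (_ : [set s | _] = `[(- 2^-1)%R, 2^-1%R]%classic); first exact: measurable_itv.
  by apply/seteqP; split => s /=; rewrite in_itv/= ler_norml.
- by move=> i; rewrite !finite_setU; do ![split]; apply: finite_set1.
- by move=> i x [].
move=> i x Dx t t0.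
have x1 : x != 2^-1%R by apply/eqP => h; apply: Dx; left; left.
have x2 : x != (- 2^-1)%R by apply/eqP => h; apply: Dx; left; right.
have x3 : x != b i by apply/eqP => h; apply: Dx; right.
have e1 := near_cmp x1 t0; have e2 := near_cmp x2 t0; have e3 := near_cmp x3 t0.
near=> n.
have [l1 _ _] : [/\ (x + t n <= 2^-1)%R = (x <= 2^-1)%R, (2^-1 < x + t n)%R = (2^-1 < x)%R &
  (2^-1 <= x + t n)%R = (2^-1 <= x)%R] by near: n.
have [_ _ l2] : [/\ (x + t n <= - 2^-1)%R = (x <= - 2^-1)%R, (- 2^-1 < x + t n)%R = (- 2^-1 < x)%R &
  (- 2^-1 <= x + t n)%R = (- 2^-1 <= x)%R] by near: n.
have [_ l3 _] : [/\ (x + t n <= b i)%R = (x <= b i)%R, (b i < x + t n)%R = (b i < x)%R &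
  (b i <= x + t n)%R = (b i <= x)%R] by near: n.
have BE : B i (x + t n)%R <-> B i x.
  by case: (Bb i) => ->//=; rewrite !in_itv/= !andbT l3.
by rewrite /J; split => -[/BE h1 h2]; split => //; move: h2; rewrite /= !ler_norml l1 l2.
Unshelve. all: by end_near. Qed.


(** Dynkin's lemma from the orthants. Complements are differences with the indicator of the window;
    countable disjoint unions are L^1 limits of finite ones because the window has finite volume. *)
Lemma translation_continuous_indic A : measurable A ->
  translation_continuous (\1_(A `&` W)).
Proof.
have mW : measurable W by exact: measurable_window.
have sub1 (f g : E -> R) : translation_continuous f -> translation_continuous g ->
    translation_continuous (fun u : E => f u - g u)%R.
  move=> cf cg; rewrite (_ : (fun u : E => _) = (fun u : E => 1 * f u + (-1) * g u)%R).
    exact: translation_continuous_lin.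
  by apply/funext => u; ring.
have tcT : translation_continuous (\1_([set: E] `&` W)).
  apply: translation_continuous_orthant; exists (fun=> setT); split; first by move=> i; left.
  by apply/seteqP; split.
rewrite measurable_orthantE.
apply: (dynkin_induction (P := fun A => translation_continuous (\1_(A `&` W)))) => //.
- exact: measurable_orthantE.
- exact: orthant_setI_closed.
- by move=> B; exact: translation_continuous_orthant.
- move=> B mB cB; rewrite (_ : \1_(~` B `&` W) = (fun u : E => \1_([set: E] `&` W) u - \1_(B `&` W) u)%R).
    exact: sub1.
  apply/funext => u; rewrite !indicE !in_setI in_setC in_setT /=.
  by case: (u \in B); case: (u \in W); rewrite /= ?subrr ?subr0.
move=> F mF tF cF.
pose B n := \bigcup_(i < n) F i.
have mB n : measurable (B n) by apply: bigcup_measurable => i _.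
have mU : measurable (\bigcup_k F k) by exact: bigcupT_measurable.
have cB n : translation_continuous (\1_(B n `&` W)).
  elim: n => [|n IH].
    rewrite (_ : \1_(B 0%N `&` W) = (fun u : E => \1_([set: E] `&` W) u - \1_([set: E] `&` W) u)%R); first exact: sub1.
    by apply/funext => u; rewrite subrr /B bigcup_mkord big_ord0 set0I indic0.
  rewrite (_ : \1_(B n.+1 `&` W) = (fun u : E => 1 * \1_(B n `&` W) u + 1 * \1_(F n `&` W) u)%R).
    exact: translation_continuous_lin.
  have dj : B n `&` F n = set0.
    rewrite -subset0 => u [[i /= iln Fi] Fn].
    have := tF i n Logic.I Logic.I; move=> /(_ (ex_intro _ u (conj Fi Fn))) ein.
    by move: iln; rewrite ein ltnn.
  apply/funext => u; rewrite !mul1r /B bigcup_mkord big_ord_recr -bigcup_mkord -/(B n) !indicE.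
  rewrite !in_setI in_setU; case: (boolP (u \in W)); rewrite ?andbF ?andbT ?addr0// => _.
  have : u \notin B n `&` F n by rewrite dj in_set0.
  by rewrite in_setI; case: (u \in B n); case: (u \in F n); rewrite /= ?addr0 ?add0r.
have lamW : lam W < +oo by rewrite lebesgue_window// ltry.
apply: translation_continuous_approx; first by apply/measurable_indicP; exact: measurableI.
move=> e e0.
pose D n := ((\bigcup_k F k) `\` B n) `&` W.
have mD n : measurable (D n) by apply: measurableI => //; exact: measurableD.
have D0 : \bigcap_n D n = set0.
  rewrite -subset0 => u Du; have [[[k _ Fk] _] _] := Du 0%N Logic.I.
  by have [[_ nB] _] := Du k.+1 Logic.I; apply: nB; exists k => /=.
have : lam \o D @ \oo --> lam (\bigcap_n D n).
  apply: nonincreasing_cvg_mu => //.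
  - apply: le_lt_trans lamW; apply: le_measure; rewrite ?inE//.
    by move=> u [].
  - exact: bigcapT_measurable.
  - move=> m n mn; apply/subsetPset => u [[U nB] Wu]; split => //; split => // -[i /= im Fi].
    by apply: nB; exists i => //=; exact: leq_trans im mn.
rewrite D0 measure0 => /cvge0_le/(_ e0)[n _ /(_ _ (leqnn _)) hn].
exists (\1_(B n `&` W)); split => //.
apply: le_trans hn; have -> : (lam \o D) n = \int[lam]_u (\1_(D n) u)%:E.
  by rewrite integral_indic// setIT.
rewrite le_eqVlt; apply/orP; left; apply/eqP; apply: eq_integral => u _; congr (_%:E).
rewrite !indicE /D setDE !in_setI in_setC; case: (u \in W); rewrite ?andbF ?andbT ?subrr ?normr0//.
have : u \in B n -> u \in \bigcup_k F k.
  by rewrite !inE => -[i _ Fi]; exists i.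
case: (u \in B n); case: (u \in \bigcup_k F k) => //=; rewrite ?subrr ?subr0 ?normr0 ?normr1//.
by move=> /(_ isT).
Qed.

Lemma translation_continuous_sum (I : Type) (s : seq I) (r : I -> R) (A : I -> set E) :
  (forall i, measurable (A i)) ->
  translation_continuous (fun u : E => \sum_(i <- s) r i * \1_(A i `&` W) u)%R.
Proof.
move=> mA; elim: s => [|i s IH].
  rewrite (_ : (fun u : E => _) = (fun u : E => 0 * \1_(set0 `&` W) u + 0 * \1_(set0 `&` W) u)%R).
    by apply: translation_continuous_lin; exact: translation_continuous_indic.
  by apply/funext => u; rewrite big_nil !mul0r addr0.
rewrite (_ : (fun u : E => _) = (fun u : E => r i * \1_(A i `&` W) u +
    1 * \sum_(i <- s) r i * \1_(A i `&` W) u)%R).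
  by apply: translation_continuous_lin => //; exact: translation_continuous_indic.
by apply/funext => u; rewrite big_cons mul1r.
Qed.

Import HBSimple.

(** Simple functions approximate g in L^1 of the window; multiplied by the indicator of the window,
    they are combinations of the indicators already treated. *)
Lemma translation_continuous_bounded (g : E -> R) (K : R) : measurable_fun setT g ->
  (forall u, (`|g u| <= K)%R) -> (forall u, ~ W u -> g u = 0%R) ->
  translation_continuous g.
Proof.
move=> mg gK gW.
have mW : measurable W by exact: measurable_window.
have K0 : (0 <= K)%R by apply: le_trans (gK 0%R).
have Ig : lam.-integrable W (EFin \o g).
  apply/integrableP; split; first by apply/measurable_EFinP; exact: measurable_funTS.
  apply: (@le_lt_trans _ _ (\int[lam]_(u in W) K%:E)).
    apply: ge0_le_integral => //.
    - by apply/measurable_EFinP; apply: measurable_funTS; exact: measurableT_comp.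
    - by move=> u _; rewrite lee_fin.
  rewrite integral_cst// [X in K%:E * X](_ : _ = 1%:E); last exact: lebesgue_window.
  by rewrite mule1 ltry.
have [g_ [Ig_ _ cg]] := approximation_sfun_integrable mW Ig.
apply: translation_continuous_approx => // e e0.
have [n _ /(_ _ (leqnn _)) hn] := cvge0_le cg e0.
pose h := (fun u : E => g_ n u * \1_W u)%R.
exists h; split.
  rewrite (_ : h = fun u : E => \sum_(r <- finmap.enum_fset (fset_set (range (g_ n))))
      r * \1_((g_ n @^-1` [set r]) `&` W) u)%R.
    by apply: translation_continuous_sum => r; exact: measurable_funPTI.
  apply/funext => u; rewrite /h fimfunE fsbig_finite//= mulr_suml.
  by apply: eq_bigr => r _; rewrite -mulrA indicI.
apply: le_trans hn.
rewrite [leRHS]integral_mkcond; apply: ge0_le_integral => //.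
- apply/measurable_EFinP; apply: measurableT_comp => //; apply: measurable_funB => //.
  by apply: measurable_funM => //; exact/measurable_indicP.
- apply/(measurable_restrictT _ mW); apply: measurableT_comp => //.
  by apply: emeasurable_funB => //; apply/measurable_EFinP; exact: measurable_funTS.
- move=> u _; rewrite patchE /h indicE; case: ifPn => uW; first by rewrite mulr1.
  by rewrite mulr0 subr0 gW ?normr0//; move: uW; rewrite notin_setE.
Qed.

End translation.

(** * Stabilization and moments under Palm probabilities *)

Lemma config_ext (R : realType) (d : nat) (X Y : config R d) : points X = points Y -> X = Y.
Proof.
by case: X => X lX; case: Y => Y lY /= XY; move: lX; rewrite XY => lX; congr Config; exact: Prop_irrelevance.
Qed.

Section truncation.
Context (R : realType).

(** Beyond M one writes y = y^(1 - r) y^r, with y^(1 - r) decreasing in y. *)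
Lemma truncation_bound (M r y : R) : 0 < M -> 1 < r -> 0 <= y ->
  y <= M + M `^ (1 - r) * y `^ r.
Proof.
move=> M0 r1 y0; have [yM|My] := leP y M.
  by rewrite (le_trans yM)// lerDl mulr_ge0// powR_ge0.
have y1 : 0 < y by exact: lt_trans My.
apply: (@le_trans _ _ (M `^ (1 - r) * y `^ r)); last by rewrite lerDr ltW.
apply: (@le_trans _ _ (y `^ (1 - r) * y `^ r)).
  by rewrite -powRD ?subrK ?powRr1 ?(ltW y1)//; rewrite (gt_eqF y1) implybT.
rewrite ler_wpM2r ?powR_ge0//.
have -> : 1 - r = - (r - 1) by ring.
rewrite !powRN lef_pV2 ?posrE ?powR_gt0//.
by apply: ge0_ler_powR; rewrite ?nnegrE ?subr_ge0 ?ltW.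
Qed.

Lemma truncation_pow (M p y : R) (s : nat) : 0 < M -> (0 < s)%N -> s%:R < p -> 1 <= y ->
  y ^+ s <= M + M `^ (1 - p / s%:R) * y `^ p.
Proof.
move=> M0 s0 sp y1; have y0 : 0 <= y by exact: le_trans y1.
have s0R : 0 < s%:R :> R by rewrite ltr0n.
have -> : y `^ p = (y ^+ s) `^ (p / s%:R).
  by rewrite -powR_mulrn// -powRrM mulrC divfK// gt_eqF.
by apply: truncation_bound; rewrite ?exprn_ge0// ltr_pdivlMr// mul1r.
Qed.

End truncation.

Section stabilization.
Context (R : realType) (d : nat).
Notation E := 'rV[R]_d.
Notation cfg := (config R d).
Variable xi : E -> cfg -> R.
Hypothesis hxi : score_function xi.

Definition score_in (n : option nat) (x : E) (X : cfg) : R := xi x (Defs.restrict X (window n)).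

Lemma restrictT (X : cfg) : Defs.restrict X setT = X.
Proof. by apply: config_ext => /=; rewrite setIT. Qed.

Lemma score_inT x X : score_in None x X = xi x X.
Proof. by rewrite /score_in /= restrictT. Qed.

Lemma measurable_score_in dz (Z : measurableType dz) n (x : Z -> E) (X : Z -> cfg) :
  measurable_fun setT x -> measurable_fun setT X ->
  measurable_fun setT (fun z => score_in n (x z) (X z)).
Proof.
move=> mx mX; apply: (measurable_score hxi mx).
exact: (measurableT_comp (measurable_restrict_window n) mX).
Qed.

(** The admissible radii are integers: if none were at most t, all would be at least floor(t) + 1,
    and so would their infimum. *)
Lemma radius_attained x X (t : R) : (Defs.radius xi x X <= t%:E)%E ->
  exists r, [/\ (0 < r)%N, r%:R <= t & stabilizes_at xi x X r].
Proof.
move=> rt; apply: contrapT => /forallNP h.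
have : ((Num.truncn t).+1%:R%:E <= Defs.radius xi x X)%E.
  apply: le_ereal_inf_tmp => _ [r [r0 sr] <-].
  rewrite lee_fin ler_nat ltnNge; apply/negP => rT; apply: (h r); split => //.
  by rewrite -(prednK r0) -truncn_gt_nat prednK.
move=> /le_trans /(_ rt); rewrite lee_fin leNgt => /negP; apply.
exact: truncnS_gt.
Qed.

Lemma eball_window m (t : R) r (x : E) : r%:R <= t -> inner m t x ->
  eball x r%:R `<=` window (Some m).
Proof.
move=> rt xt y /= yx i.
have e1 : `|y ord0 i - x ord0 i| <= t.
  by apply: le_trans rt; apply: le_trans yx; have := coord_le_enorm (y - x) i; rewrite !mxE.
have e2 := ler_normD (y ord0 i - x ord0 i) (x ord0 i); rewrite subrK in e2.
have e3 : `|x ord0 i| + t <= 2^-1 * side R d m := xt i.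
by rewrite -/(side R d m); lra.
Qed.

(** A ball of radius at most t around x stays in the window, so X and its restriction to the window
    agree in it. Stabilization is used with two exteriors, X itself and X restricted to the
    window. *)
Lemma stabilized m (t : R) (x : E) X : inner m t x ->
  (Defs.radius xi x (Defs.restrict X (window None)) <= t%:E)%E ->
  score_in (Some m) x X = score_in None x X.
Proof.
move=> xt /radius_attained[r [r0 rt st]].
have BW := eball_window rt xt.
rewrite score_inT; move: st; rewrite /= restrictT => st.
have -> : xi x X = xi x (Defs.restrict X (eball x r%:R)).
  rewrite (st X); congr (xi x _); apply: config_ext => /=.
  by rewrite -setIUr setUv setIT.
rewrite /score_in (st (Defs.restrict X (window (Some m)))); congr (xi x _); apply: config_ext => /=.
apply/seteqP; split => y /=.
  move=> [Xy Wy]; have [By|By] := pselect (eball x r%:R y); [left|right] => //.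
by move=> [[Xy By]|[[Xy Wy] _]]; split => //; exact: BW.
Qed.

(** A measurable event that takes the place of the event of a large radius. *)
Definition neq_event m (x : E) : set cfg := [set X | score_in (Some m) x X != score_in None x X].

Lemma neq_event_radius m (t : R) (x : E) X : inner m t x -> neq_event m x X ->
  (t%:E < Defs.radius xi x (Defs.restrict X (window None)))%E.
Proof.
move=> xt; rewrite /neq_event/= => /eqP h; rewrite ltNge; apply/negP => rt.
by apply: h; exact: stabilized rt.
Qed.

Lemma measurable_neq m :
  measurable_fun setT (fun p : E * cfg => score_in (Some m) p.1 p.2 != score_in None p.1 p.2).
Proof.
have mm n : measurable_fun setT (fun p : E * cfg => score_in n p.1 p.2) by exact: measurable_score_in.
by apply: measurable_neg; apply: measurable_fun_eqr.
Qed.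

Definition score_max n (p : E * cfg) : R := Num.max `|score_in n p.1 p.2| 1.

Lemma score_max_ge1 n p : 1 <= score_max n p. Proof. by rewrite /score_max le_max lexx orbT. Qed.

Lemma score_max_ge n p : `|score_in n p.1 p.2| <= score_max n p. Proof. by rewrite /score_max le_max lexx. Qed.

Lemma measurable_score_max n : measurable_fun setT (score_max n).
Proof.
apply: measurable_maxr => //; apply: measurableT_comp => //.
exact: measurable_score_in.
Qed.

(* Dominates the effect of the window on powers of order at most [s < p] of the
   score: split according to whether the power exceeds [M]. *)
Definition trunc_majorant (p M : R) (s m : nat) (z : E * cfg) : R :=
  2 * M * (score_in (Some m) z.1 z.2 != score_in None z.1 z.2)%:R +
  M `^ (1 - p / s%:R) * (score_max (Some m) z `^ p + score_max None z `^ p).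

Lemma measurable_trunc_majorant p M s m : measurable_fun setT (trunc_majorant p M s m).
Proof.
have mp n : measurable_fun setT (fun z => score_max n z `^ p).
  by apply: (measurableT_comp (measurable_powR p)); exact: measurable_score_max.
apply: measurable_funD.
  apply: measurable_funM => //.
  rewrite (_ : (fun z => _) = fun z : E * cfg => if score_in (Some m) z.1 z.2 != score_in None z.1 z.2 then 1 else 0 : R).
    by apply: measurable_fun_ifT => //; exact: measurable_neq.
  by apply/funext => z; case: (_ != _).
by apply: measurable_funM => //; exact: measurable_funD.
Qed.

Lemma trunc_majorant_ge0 p M s m z : 0 < M -> 0 <= trunc_majorant p M s m z.
Proof.
move=> M0; rewrite /trunc_majorant addr_ge0// !mulr_ge0 ?addr_ge0 ?powR_ge0//; exact: ltW.
Qed.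

(** The function [q] will be the identity with s = 1 or the square with s = 2. The factor 2 M in the
    majorant pays for truncating both scores. *)
Lemma score_diff_le (q : R -> R) p M s m z : 0 < M -> (0 < s)%N -> s%:R < p ->
  (forall y, `|q y| <= Num.max `|y| 1 ^+ s) ->
  `|q (score_in (Some m) z.1 z.2) - q (score_in None z.1 z.2)| <= trunc_majorant p M s m z.
Proof.
move=> M0 s0 sp qs; have [e|ne] := eqVneq (score_in (Some m) z.1 z.2) (score_in None z.1 z.2).
  by rewrite e subrr normr0 trunc_majorant_ge0.
apply: (le_trans (ler_normB _ _)); rewrite /trunc_majorant ne mulr1.
have h1 := truncation_pow M0 s0 sp (score_max_ge1 (Some m) z).
have h2 := truncation_pow M0 s0 sp (score_max_ge1 None z).
have h3 := qs (score_in (Some m) z.1 z.2); have h4 := qs (score_in None z.1 z.2).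
rewrite -/(score_max _ z) in h3; rewrite -/(score_max _ z) in h4.
lra.
Qed.

(** Each product is at most half the sum of two squares, so four squares are truncated and cost 2 M
    in all. A single disagreement, at x or at y, already provides 2 M on the right. *)
Lemma score_pair_diff_le p M m (x y : E) X : 0 < M -> 2 < p ->
  `|score_in (Some m) x X * score_in (Some m) y X - score_in None x X * score_in None y X| <=
  trunc_majorant p M 2 m (x, X) + trunc_majorant p M 2 m (y, X).
Proof.
move=> M0 p2.
have H0 z : 0 <= trunc_majorant p M 2 m z by exact: trunc_majorant_ge0.
have [e|ne] := boolP ((score_in (Some m) x X == score_in None x X) && (score_in (Some m) y X == score_in None y X)).
  by move/andP: e => [/eqP -> /eqP ->]; rewrite subrr normr0 addr_ge0.
have prod n : `|score_in n x X * score_in n y X| <= 2^-1 * (score_max n (x, X) ^+ 2 + score_max n (y, X) ^+ 2).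
  rewrite normrM; have := score_max_ge n (x, X); have := score_max_ge n (y, X) => /= h1 h2.
  have h3 : `|score_in n x X| ^+ 2 <= score_max n (x, X) ^+ 2 by apply: lerXn2r; rewrite ?nnegrE// (le_trans _ h2).
  have h4 : `|score_in n y X| ^+ 2 <= score_max n (y, X) ^+ 2 by apply: lerXn2r; rewrite ?nnegrE// (le_trans _ h1).
  have := sqr_ge0 (`|score_in n x X| - `|score_in n y X|); rewrite sqrrB; lra.
apply: (le_trans (ler_normB _ _)).
have h1 := prod (Some m); have h2 := prod None.
have t n w := truncation_pow M0 (ltn0Sn 1) p2 (score_max_ge1 n w).
have := t (Some m) (x, X); have := t None (x, X); have := t (Some m) (y, X); have := t None (y, X).
rewrite /trunc_majorant /=.
have P0 n w : 0 <= M `^ (1 - p / 2%:R) * score_max n w `^ p by rewrite mulr_ge0// powR_ge0.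
have := P0 (Some m) (x, X); have := P0 None (x, X); have := P0 (Some m) (y, X); have := P0 None (y, X).
move: ne; rewrite negb_and.
by case: (score_in (Some m) x X == _); case: (score_in (Some m) y X == _) => //= _; rewrite ?mulr1 ?mulr0 ?mulrDr; lra.
Qed.

End stabilization.

(** * Stabilization, moments and translations for Palm kernels *)

Section palm_bounds.
Context (R : realType) (d : nat) (disp : measure_display) (Omega : measurableType disp).
Hypothesis d_gt0 : (0 < d)%N.
Context (Pr : probability Omega R) (P : {RV Pr >-> config R d}).
Context (rho : forall k, k.-tuple 'rV[R]_d -> R).
Context (palm : forall k, k.-tuple 'rV[R]_d -> probability (config R d) R).
Context (xi : 'rV[R]_d -> config R d -> R).
Hypothesis hP : admissible Pr P rho.
Hypothesis hpalm : palm_probabilities Pr P palm.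
Hypothesis hxi : score_function xi.
Notation E := 'rV[R]_d.
Notation cfg := (config R d).
Notation lam := (lebesgue_row R d).
Notation alpha k := (@moment_measure _ _ _ _ Pr P k).
Notation score_in := (score_in xi).
Notation score_max := (score_max xi).
Notation trunc_majorant := (trunc_majorant xi).
Notation palm1 := (palm1 palm).
Notation palm2 := (palm2 palm).
Local Open Scope ereal_scope.

Lemma measurable_neq_event m x : measurable (neq_event xi m x).
Proof.
have mb : measurable_fun setT (fun X => score_in (Some m) x X != score_in None x X).
  exact: (measurableT_comp (measurable_neq hxi m) (measurable_pair1 x)).
by rewrite -[X in measurable X]setTI; apply: (mb measurableT [set true]).
Qed.

(** The radius is taken in the whole process, so one exceptional set serves for all windows m. The
    disagreement event is measurable and contained in the event of a large radius, whose outer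
    measure is controlled. *)
Lemma ae_palm_neq (a : nat -> R) (phi : R -> R) l (t : R) :
  stabilizing_with Pr P palm xi a phi -> (0 < t)%R ->
  {ae alpha l.+1, forall xs, forall m, inner m t (thead xs) ->
    (palm xs (neq_event xi m (thead xs)) <= (phi (a l.+1 * t)%R)%:E)%E}.
Proof.
move=> [_ _ _ _ st] t0; have := st l None t isT t0.
move=> [B [mB B0 QB]]; exists B; split => // xs /= nQ; apply: QB => /= h; apply: nQ => m xt.
apply: le_trans (h (fun i => Logic.I)).
rewrite -measurable_mu_extE; last exact: measurable_neq_event.
by apply: le_mu_ext => X; exact: neq_event_radius.
Qed.

Definition moment_bound (p C : R) := forall (k : nat) (n : option nat),
  (k.+1 <= Num.truncn p)%N -> valid_index n ->
  {ae alpha k.+1, forall xs, (forall i, window n (tnth xs i)) ->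
    \int[palm xs]_X (score_max n (thead xs, X) `^ p)%R%:E <= C%:E}.

Lemma moment_boundP p : moment_condition Pr P palm xi p -> exists C, moment_bound p C.
Proof.
by move=> [C hC]; exists C => k n kp nv; have := hC k n kp nv; rewrite unlock.
Qed.

Variables (p C : R).
Hypothesis hC : moment_bound p C.

Lemma ae_moment_bound k n : (k.+1 <= Num.truncn p)%N -> valid_index n ->
  {ae tuple_measure lam k.+1, forall xs, @rho _ xs != 0%R ->
    (forall i, window n (tnth xs i)) ->
    \int[palm xs]_X (score_max n (thead xs, X) `^ p)%R%:E <= C%:E}.
Proof. by move=> kp nv; apply: (ae_moment hP (ltn0Sn k)); exact: hC. Qed.

Let mscore_maxp n (x : E) : measurable_fun setT (fun X : cfg => (score_max n (x, X) `^ p)%R%:E : \bar R).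
Proof.
apply/measurable_EFinP; apply: (measurableT_comp (measurable_powR p)).
exact: (measurableT_comp (measurable_score_max hxi n) (measurable_pair1 x)).
Qed.

(** Stabilization bounds the probability of disagreement; the two constants [C] come from the moment
    condition in the window and in the whole space. *)
Lemma ae_trunc_majorant (a : nat -> R) (phi : R -> R) l m (t M : R) (s : nat) :
  stabilizing_with Pr P palm xi a phi -> (0 < t)%R -> (0 < M)%R -> (0 < m)%N ->
  (l.+1 <= Num.truncn p)%N ->
  {ae tuple_measure lam l.+1, forall xs, @rho _ xs != 0%R ->
    (forall i, window (Some m) (tnth xs i)) -> inner m t (thead xs) ->
    \int[palm xs]_X (trunc_majorant p M s m (thead xs, X))%:E <=
      (2 * M * phi (a l.+1 * t) + M `^ (1 - p / s%:R) * (C + C))%R%:E}.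
Proof.
move=> st t0 M0 m0 lp.
have h1 := ae_moment hP (ltn0Sn l) (ae_palm_neq l st t0).
have h2 : valid_index (Some m) by [].
have {}h2 := ae_moment_bound lp h2.
have h3 : valid_index None by [].
have {}h3 := ae_moment_bound lp h3.
apply: filterS3 h1 h2 h3 => xs h1 h2 h3 r0 xsW xt.
have {h1} := h1 r0 m xt; have {h2} := h2 r0 xsW; have {h3} := h3 r0 (fun=> Logic.I).
set x := thead xs in xt * => h3 h2 h1.
have mA := measurable_neq_event m x.
have mI : measurable_fun setT (fun X => (\1_(neq_event xi m x) X)%:E : \bar R).
  exact/measurable_EFinP/measurable_indicP.
have HE X : (trunc_majorant p M s m (x, X))%:E = (2 * M)%R%:E * (\1_(neq_event xi m x) X)%:E +
    (M `^ (1 - p / s%:R))%R%:E * ((score_max (Some m) (x, X) `^ p)%R%:E + (score_max None (x, X) `^ p)%R%:E).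
  rewrite /trunc_majorant EFinD !EFinM EFinD; congr (_ * ((_ : bool)%:R)%:E + _).
  by apply/idP/idP; rewrite ?inE.
under eq_integral do rewrite HE.
rewrite ge0_integralD//; last 4 first.
- by move=> X _; rewrite -EFinM lee_fin !mulr_ge0// ltW.
- exact: measurable_funeM.
- by move=> X _; rewrite -EFinD -EFinM lee_fin mulr_ge0// ?addr_ge0 ?powR_ge0.
- by apply: measurable_funeM; exact: emeasurable_funD.
rewrite ge0_integralZl//; last by rewrite lee_fin mulr_ge0// ltW.
rewrite ge0_integralZl//; last 3 first.
- exact: emeasurable_funD.
- by move=> X _; rewrite -EFinD lee_fin addr_ge0// powR_ge0.
- by rewrite lee_fin powR_ge0.
rewrite ge0_integralD//; try by move=> X _; rewrite lee_fin powR_ge0.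
rewrite integral_indic// setIT EFinD !EFinM; apply: leeD.
  by rewrite lee_pmul2l// lte_fin mulr_gt0.
apply: lee_wpmul2l; first by rewrite lee_fin powR_ge0.
by rewrite EFinD; apply: leeD; [exact: h2|exact: h3].
Qed.

Lemma ae_trunc_majorant1 (a : nat -> R) (phi : R -> R) m (t M : R) (s : nat) :
  stabilizing_with Pr P palm xi a phi -> (0 < t)%R -> (0 < M)%R -> (0 < m)%N ->
  (1 <= Num.truncn p)%N ->
  {ae lam, forall x, inner m t x ->
    \int[palm1 x]_X (trunc_majorant p M s m (x, X))%:E <=
      (2 * M * phi (a 1%N * t) + M `^ (1 - p / s%:R) * (C + C))%R%:E}.
Proof.
move=> st t0 M0 m0 lp; have /ae_tuple1 := @ae_trunc_majorant a phi 0 m t M s st t0 M0 m0 lp.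
apply: filterS => x h xt; apply: h => //.
- by rewrite (rho1E hP) lt0r_neq0// (intensity_gt0 hP).
- by move=> i; rewrite (ord1 i); exact: (inner_window (ltW t0) xt).
Qed.

Lemma ae_trunc_majorant2 (a : nat -> R) (phi : R -> R) m (t M : R) (s : nat) :
  stabilizing_with Pr P palm xi a phi -> (0 < t)%R -> (0 < M)%R -> (0 < m)%N ->
  (2 <= Num.truncn p)%N ->
  {ae lam \x lam, forall z, rho2 rho z != 0%R -> inner m t z.1 -> window (Some m) z.2 ->
    \int[palm2 z]_X (trunc_majorant p M s m (z.1, X))%:E <=
      (2 * M * phi (a 2%N * t) + M `^ (1 - p / s%:R) * (C + C))%R%:E}.
Proof.
move=> st t0 M0 m0 lp; have /ae_tuple2 := @ae_trunc_majorant a phi 1 m t M s st t0 M0 m0 lp.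
apply: filterS => -[x y] h r0 /= xt yW; apply: h => //.
move=> i; case: (unliftP ord0 i) => [j|] ->; first by rewrite (ord1 j).
exact: (inner_window (ltW t0) xt).
Qed.

Lemma ae_moment1_bound n : (1 <= Num.truncn p)%N -> valid_index n ->
  {ae lam, forall x, window n x -> \int[palm1 x]_X (score_max n (x, X) `^ p)%R%:E <= C%:E}.
Proof.
move=> lp nv; have /ae_tuple1 := ae_moment_bound lp nv.
apply: filterS => x h xt; apply: h => //.
- by rewrite (rho1E hP) lt0r_neq0// (intensity_gt0 hP).
- by move=> i; rewrite (ord1 i).
Qed.

Lemma ae_moment2_bound n : (2 <= Num.truncn p)%N -> valid_index n ->
  {ae lam \x lam, forall z, rho2 rho z != 0%R -> window n z.1 -> window n z.2 ->
    \int[palm2 z]_X (score_max n (z.1, X) `^ p)%R%:E <= C%:E}.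
Proof.
move=> lp nv; have /ae_tuple2 := ae_moment_bound lp nv.
apply: filterS => -[x y] h r0 /= xt yW; apply: h => //.
by move=> i; case: (unliftP ord0 i) => [j|] -> //; rewrite (ord1 j).
Qed.

(** The kernel at x is the image of the kernel at 0 under the shift by x. The positive and negative
    parts have equal integrals separately, so integrability of g is not at stake. *)
Lemma integral_palm1_shift (x : E) (g : cfg -> \bar R) : measurable_fun setT g ->
  \int[palm1 x]_X g X = \int[palm1 0%R]_X g (Defs.shift x X).
Proof.
move=> mg.
have ms : measurable_fun setT (fun X : cfg => Defs.shift x X) by exact: measurable_shift.
have ge (h : cfg -> \bar R) : measurable_fun setT h -> (forall X, 0 <= h X) ->
    \int[palm1 x]_X h X = \int[palm1 0%R]_X h (Defs.shift x X).
  move=> mh h0.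
  transitivity (\int[pushforward (palm1 0%R) (fun X : cfg => Defs.shift x X)]_X h X).
    apply: eq_setfun_integral => A mA.
    have := palm_shift hpalm x [tuple 0%R] (ltn0Sn 0) mA.
    by rewrite shift_tuple1 add0r.
  by rewrite ge0_integral_pushforward ?preimage_setT.
rewrite integralE [RHS]integralE; congr (_ - _).
  rewrite ge//; last exact: measurable_funepos.
  by apply: eq_integral => X _; rewrite !funeposE.
rewrite ge//; last exact: measurable_funeneg.
by apply: eq_integral => X _; rewrite !funenegE.
Qed.

Lemma integral_palm2_shift (x y : E) (g : cfg -> \bar R) : measurable_fun setT g ->
  \int[palm2 (x, y)]_X g X = \int[palm2 (0, y - x)%R]_X g (Defs.shift x X).
Proof.
move=> mg.
have ms : measurable_fun setT (fun X : cfg => Defs.shift x X) by exact: measurable_shift.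
have ge (h : cfg -> \bar R) : measurable_fun setT h -> (forall X, 0 <= h X) ->
    \int[palm2 (x, y)]_X h X = \int[palm2 (0, y - x)%R]_X h (Defs.shift x X).
  move=> mh h0.
  transitivity (\int[pushforward (palm2 (0, y - x)%R) (fun X : cfg => Defs.shift x X)]_X h X).
    apply: eq_setfun_integral => A mA.
    have := palm_shift hpalm x [tuple 0%R; (y - x)%R] (ltn0Sn 1) mA.
    by rewrite shift_tuple2 add0r subrK.
  by rewrite ge0_integral_pushforward ?preimage_setT.
rewrite integralE [RHS]integralE; congr (_ - _).
  rewrite ge//; last exact: measurable_funepos.
  by apply: eq_integral => X _; rewrite !funeposE.
rewrite ge//; last exact: measurable_funeneg.
by apply: eq_integral => X _; rewrite !funenegE.
Qed.

Lemma score_inT_shift (y x : E) X : score_in None (x + y)%R (Defs.shift y X) = score_in None x X.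
Proof. by rewrite !score_inT (score_shift hxi). Qed.

End palm_bounds.

(** * Expectation asymptotics *)

Section layers.
Context (R : realType) (d : nat).
Hypothesis d_gt0 : (0 < d)%N.
Notation E := 'rV[R]_d.
Notation lam := (lebesgue_row R d).
Notation L := (side R d).
Local Open Scope ereal_scope.

Lemma integral_indic_window n :
  \int[lam]_x (\1_(window (Some n)) x)%:E = n%:R%:E.
Proof.
rewrite integral_indic//; last exact: measurable_window.
by rewrite setIT; exact: lebesgue_window.
Qed.

(** Unit layers are peeled off one by one: the k-th one has volume at most 2 d n / L and carries the
    bound [e k] of its outer face. The number [K] of layers is free: bounded for a limit, beyond the
    half-side for a rate, when the last term disappears. *)
Lemma layer_bound n (D : E -> \bar R) (e : nat -> R) K : (0 < n)%N ->
  measurable_fun setT D -> (forall x, 0 <= D x) -> (forall k, (0 <= e k)%R) ->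
  (forall k, {ae lam, forall x, inner n k%:R x -> D x <= (e k)%:E}) ->
  \int[lam]_x (D x * (\1_(window (Some n)) x)%:E) <=
  (\sum_(k < K) e k * (d%:R * (2 * (n%:R / L n))))%R%:E + (e K)%:E * lam (inner n K%:R).
Proof.
move=> n0 mD D0 e0 De.
have mI k : measurable_fun setT (fun x : E => (\1_(inner n k) x)%:E : \bar R).
  by apply/measurable_EFinP/measurable_indicP; exact: measurable_inner.
pose I k := \int[lam]_x (D x * (\1_(inner n k%:R) x)%:E).
have bound k (A : set E) : measurable A -> A `<=` inner n k%:R ->
    \int[lam]_x (D x * (\1_A x)%:E) <= (e k)%:E * lam A.
  move=> mA Ak.
  have mIA : measurable_fun setT (fun x : E => (\1_A x)%:E : \bar R).
    exact/measurable_EFinP/measurable_indicP.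
  apply: (@le_trans _ _ (\int[lam]_x ((e k)%:E * (\1_A x)%:E))).
    apply: ae_ge0_le_integral => //.
    - by move=> x _; rewrite mule_ge0// lee_fin.
    - exact: emeasurable_funM.
    - by move=> x _; rewrite mule_ge0// lee_fin.
    - exact: measurable_funeM.
    apply: filterS (De k) => x h _; rewrite indicE; have [xA|xA] := boolP (x \in A).
      by rewrite !mule1; apply/h/Ak; rewrite -inE.
    by rewrite !mule0.
  by rewrite ge0_integralZl ?lee_fin// integral_indic// setIT.
have step k : I k <= (e k * (d%:R * (2 * (n%:R / L n))))%R%:E + I k.+1.
  pose A := inner n k%:R `\` inner n k.+1%:R : set E.
  have mA : measurable A by apply: measurableD; exact: measurable_inner.
  have mIA : measurable_fun setT (fun x : E => (\1_A x)%:E : \bar R).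
    exact/measurable_EFinP/measurable_indicP.
  have sub : inner n k.+1%:R `<=` (inner n k%:R : set E).
    by apply: subset_inner; rewrite ler_nat.
  have -> : I k = \int[lam]_x (D x * (\1_A x)%:E) + I k.+1.
    rewrite /I -ge0_integralD//; last 4 first.
    - by move=> x _; rewrite mule_ge0// lee_fin.
    - exact: emeasurable_funM.
    - by move=> x _; rewrite mule_ge0// lee_fin.
    - exact: emeasurable_funM.
    apply: eq_integral => x _; rewrite -ge0_muleDr ?lee_fin// -EFinD; congr (_ * _%:E).
    rewrite !indicE /A setDE in_setI in_setC.
    have : x \in inner n k.+1%:R -> x \in inner n k%:R by rewrite !inE; exact: sub.
    by case: (x \in inner n k%:R); case: (x \in inner n k.+1%:R) => //= h; rewrite ?addr0 ?add0r//; have := h isT.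
  apply: leeD => //; apply: (@le_trans _ _ ((e k)%:E * lam A)); first by apply: bound => // x [].
  rewrite EFinM; apply: lee_wpmul2l; first by rewrite lee_fin.
  have kk : (k%:R <= k.+1%:R :> R)%R by rewrite ler_nat.
  apply: (le_trans (lebesgue_layer d n (ler0n R k) kk)).
  have e1 : (k.+1%:R - k%:R = 1 :> R)%R by rewrite mulrS; ring.
  by rewrite lee_fin e1 mulr1 side_pow_pred.
have -> : \int[lam]_x (D x * (\1_(window (Some n)) x)%:E) = I 0%N by rewrite /I inner0.
apply: (@le_trans _ _ ((\sum_(k < K) e k * (d%:R * (2 * (n%:R / L n))))%R%:E + I K)); last first.
  by apply: leeD => //; apply: bound => //; exact: measurable_inner.
elim: K => [|K IH]; first by rewrite big_ord0 add0e.
by rewrite big_ord_recr EFinD -addeA (le_trans IH)//; apply: leeD.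
Qed.

Lemma ge0_integral_unscale n (h : E -> \bar R) : (0 < n)%N ->
  measurable_fun setT h -> (forall x, 0 <= h x) ->
  \int[lam]_x h ((L n)^-1 *: x)%R = n%:R%:E * \int[lam]_x h x.
Proof.
move=> n0; have L0 : (0 < (L n)^-1)%R by rewrite invr_gt0 side_gt0.
move=> mh h0; rewrite -[in RHS](ge0_integral_scale L0)// muleA -EFinM.
by rewrite exprVn side_pow// mulfV ?mul1e// pnatr_eq0 -lt0n.
Qed.

End layers.

Section mean_value.
Context (R : realType) (d : nat) (disp : measure_display) (Omega : measurableType disp).
Hypothesis d_gt0 : (0 < d)%N.
Context (Pr : probability Omega R) (P : {RV Pr >-> config R d}).
Context (rho : forall k, k.-tuple 'rV[R]_d -> R).
Context (palm : forall k, k.-tuple 'rV[R]_d -> probability (config R d) R).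
Context (xi : 'rV[R]_d -> config R d -> R).
Hypothesis hP : admissible Pr P rho.
Hypothesis hpalm : palm_probabilities Pr P palm.
Hypothesis hxi : score_function xi.
Notation E := 'rV[R]_d.
Notation cfg := (config R d).
Notation lam := (lebesgue_row R d).
Notation L := (side R d).
Notation score_in := (score_in xi).
Notation score_max := (score_max xi).
Notation trunc_majorant := (trunc_majorant xi).
Notation palm1 := (palm1 palm).
Notation r1 := (intensity rho).
Local Open Scope ereal_scope.

Lemma window_scale n (x : E) : (0 < n)%N ->
  window (Some 1%N) ((L n)^-1 *: x)%R -> window (Some n) x.
Proof.
move=> n0 h i; have := h i; rewrite mxE powR1 mulr1 normrM ger0_norm ?invr_ge0 ?side_ge0//.
by rewrite -/(L n) ler_pdivrMl ?side_gt0// mulrC.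
Qed.

Lemma window_scaleV n (x : E) : (0 < n)%N ->
  window (Some n) x -> window (Some 1%N) ((L n)^-1 *: x)%R.
Proof.
move=> n0 h i; have := h i; rewrite mxE powR1 mulr1 normrM ger0_norm ?invr_ge0 ?side_ge0//.
by rewrite -/(L n) ler_pdivrMl ?side_gt0// mulrC.
Qed.

Variables (p C : R).
Hypothesis hC : moment_bound P palm xi p C.
Variables (q : R -> R) (s : nat).
Hypotheses (mq : measurable_fun setT q) (s_gt0 : (0 < s)%N) (sp : (s%:R < p)%R)
  (p1 : (1 <= Num.truncn p)%N).
Hypothesis qs : forall y, (`|q y| <= Num.max `|y| 1 ^+ s)%R.

(** With [q] the identity this governs the mean, with [q] the square the diagonal term of the
    covariance. *)
Definition fscore n (z : E * cfg) : R := q (score_in n z.1 z.2).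

Lemma measurable_fscore n : measurable_fun setT (fscore n).
Proof. by apply: (measurableT_comp mq); exact: measurable_score_in. Qed.

Let mfscore n (x : E) : measurable_fun setT (fun X => fscore n (x, X)).
Proof. exact: (measurableT_comp (measurable_fscore n) (measurable_pair1 x)). Qed.

Lemma fscore_le n z : (`|fscore n z| <= score_max n z `^ p)%R.
Proof.
apply: (le_trans (qs _)); rewrite -/(score_max n z) -powR_mulrn; last first.
  by rewrite (le_trans _ (score_max_ge1 xi n z)).
by apply: ler_powR; [exact: score_max_ge1|exact: ltW].
Qed.

Let mscore_max n (x : E) : measurable_fun setT (fun X : cfg => (score_max n (x, X) `^ p)%R%:E : \bar R).
Proof.
apply/measurable_EFinP; apply: (measurableT_comp (measurable_powR p)).
exact: (measurableT_comp (measurable_score_max hxi n) (measurable_pair1 x)).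
Qed.

Lemma integral_fscore_le n x : \int[palm1 x]_X (score_max n (x, X) `^ p)%R%:E <= C%:E ->
  \int[palm1 x]_X `|fscore n (x, X)|%:E <= C%:E.
Proof.
apply: le_trans; apply: ge0_le_integral => //.
- by apply/measurable_EFinP; exact: measurableT_comp.
- by move=> X _; rewrite lee_fin; exact: fscore_le.
Qed.

Lemma ae_integral_fscore n : valid_index n ->
  {ae lam, forall x, window n x -> \int[palm1 x]_X `|fscore n (x, X)|%:E <= C%:E}.
Proof.
move=> nv; apply: filterS (ae_moment1_bound hP hC p1 nv) => x h /h.
exact: integral_fscore_le.
Qed.

(** The moment bound holds at some point, and translation covariance of the whole-space score
    carries it to every point, the origin included. *)
Lemma fscoreT_integrable x : (palm1 x).-integrable setT (fun X => (fscore None (x, X))%:E).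
Proof.
have [y /(_ Logic.I) hy] := ae_exists d_gt0 (ae_integral_fscore (isT : valid_index None)).
apply/integrableP; split; first exact/measurable_EFinP.
apply: le_lt_trans (ltry C); apply: le_trans hy.
have mabs u : measurable_fun setT (fun X => `|fscore None (u, X)|%:E : \bar R).
  by apply/measurable_EFinP; exact: measurableT_comp.
have E u : \int[palm1 u]_X `|fscore None (u, X)|%:E = \int[palm1 0%R]_X `|fscore None (0%R, X)|%:E.
  rewrite (integral_palm1_shift hpalm u (mabs u)); apply: eq_integral => X _.
  by have := score_inT_shift hxi u 0%R X; rewrite add0r /fscore /= => ->.
by under eq_integral do rewrite abse_EFin; rewrite (E x) (E y).
Qed.

Definition qmean : R := kmean palm1 (fscore None) 0%R.

Lemma kmean_fscoreT x : kmean palm1 (fscore None) x = qmean.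
Proof.
rewrite /qmean /kmean; congr fine.
rewrite (integral_palm1_shift hpalm); last exact/measurable_EFinP.
apply: eq_integral => X _; rewrite /fscore /=; congr (q _)%:E.
by have := score_inT_shift hxi x 0%R X; rewrite add0r.
Qed.

Definition palm_diff n x := \int[palm1 x]_X `|fscore (Some n) (x, X) - fscore None (x, X)|%:E.

Definition boundary_error n := \int[lam]_x (palm_diff n x * (\1_(window (Some n)) x)%:E).

Let mdiff n : measurable_fun setT (fun z => `|fscore (Some n) z - fscore None z|%:E : \bar R).
Proof.
apply/measurable_EFinP; apply: measurableT_comp => //.
by apply: measurable_funB; exact: measurable_fscore.
Qed.

Lemma measurable_palm_diff n : measurable_fun setT (palm_diff n).
Proof.
by apply: (measurable_kint (measurable_palm1 hpalm) (mdiff n)) => z; rewrite lee_fin.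
Qed.

Lemma palm_diff_ge0 n x : 0 <= palm_diff n x.
Proof. by apply: integral_ge0 => X _; rewrite lee_fin. Qed.

Variables (g : E -> R) (K : R).
Hypotheses (mg : measurable_fun setT g) (gK : forall u, (`|g u| <= K)%R)
  (gW : forall u, ~ window (Some 1%N) u -> g u = 0%R).

Let K0 : (0 <= K)%R. Proof. exact: le_trans (gK 0%R). Qed.

Definition gscale n (x : E) : R := g ((L n)^-1 *: x)%R.

Lemma measurable_gscale n : measurable_fun setT (gscale n).
Proof. by apply: (measurableT_comp mg); exact: measurable_rowZ. Qed.

Lemma gscale_out n x : (0 < n)%N -> ~ window (Some n) x -> gscale n x = 0%R.
Proof. by move=> n0 nx; apply: gW => /(window_scale n0). Qed.

Lemma integrable_bounded_window : lam.-integrable setT (EFin \o g).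
Proof.
apply/integrableP; split; first exact/measurable_EFinP.
apply: (@le_lt_trans _ _ (\int[lam]_x (K%:E * (\1_(window (Some 1%N)) x)%:E))).
  have mI : measurable_fun setT (fun x : E => (\1_(window (Some 1%N)) x)%:E : \bar R).
    by apply/measurable_EFinP/measurable_indicP; exact: measurable_window.
  apply: ge0_le_integral => //.
  - by apply/measurable_EFinP; exact: measurableT_comp.
  - exact: measurable_funeM.
  move=> x _; rewrite indicE; case: (boolP (x \in _)) => xW.
    by rewrite mule1 lee_fin.
  by rewrite mule0 /= gW ?normr0//; move: xW; rewrite notin_setE.
rewrite ge0_integralZl ?lee_fin//; last first.
  by apply/measurable_EFinP/measurable_indicP; exact: measurable_window.
by rewrite integral_indic_window// -EFinM ltry.
Qed.

Lemma integrable_gscale n : (0 < n)%N -> lam.-integrable setT (fun x => (gscale n x)%:E).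
Proof.
move=> n0; apply/integrableP; split; first by apply/measurable_EFinP; exact: measurable_gscale.
have mh : measurable_fun setT (fun x => `|g x|%:E : \bar R).
  by apply/measurable_EFinP; exact: measurableT_comp.
have h0 x : 0 <= `|g x|%:E :> \bar R by rewrite lee_fin.
have := ge0_integral_unscale d_gt0 n0 mh h0; under eq_integral do rewrite -abse_EFin.
move=> ->; have /integrableP[_] := integrable_bounded_window.
under eq_integral do rewrite /= ; move=> gfin.
by rewrite lte_mul_pinfty// ge0_fin_numE//; exact: integral_ge0.
Qed.

Lemma integral_gscale n : (0 < n)%N ->
  \int[lam]_x (gscale n x)%:E = n%:R%:E * \int[lam]_x (g x)%:E.
Proof.
move=> n0.
have ge := ge0_integral_unscale d_gt0 n0.
have mEg : measurable_fun setT (EFin \o g) by exact/measurable_EFinP.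
have Ig := integrable_bounded_window.
rewrite integralE [in RHS]integralE muleBr//; last first.
  by apply: fin_num_adde_defl; rewrite fin_numN; exact: integrable_neg_fin_num.
rewrite -!ge//; [|exact: measurable_funeneg|exact: measurable_funepos].
congr (_ - _); apply: eq_integral => x _; first by rewrite !funeposE.
by rewrite !funenegE.
Qed.

Definition wscore n (z : E * cfg) : R := (gscale n z.1 * fscore (Some n) z)%R.

Lemma measurable_wscore n : measurable_fun setT (wscore n).
Proof.
apply: measurable_funM; last exact: measurable_fscore.
exact: (measurableT_comp (measurable_gscale n) measurable_fst).
Qed.

Lemma mix1_wscore n : (0 < n)%N -> mix1 rho palm (fun z => `|wscore n z|%:E) < +oo.
Proof.
move=> n0; rewrite /mix1 /mixture.
have r10 := intensity_gt0 hP.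
have mI : measurable_fun setT (fun x : E => (\1_(window (Some n)) x)%:E : \bar R).
  by apply/measurable_EFinP/measurable_indicP; exact: measurable_window.
have mabs : measurable_fun setT (fun z => `|wscore n z|%:E : \bar R).
  by apply/measurable_EFinP; apply: measurableT_comp => //; exact: measurable_wscore.
have C0 : (0 <= C)%R.
  have [y /(_ Logic.I) hy] := ae_exists d_gt0 (ae_integral_fscore (isT : valid_index None)).
  by rewrite -lee_fin; apply: le_trans hy; apply: integral_ge0 => X _; rewrite lee_fin.
apply: (@le_lt_trans _ _ (\int[lam]_x ((r1 * (K * C))%R%:E * (\1_(window (Some n)) x)%:E))).
  apply: ae_ge0_le_integral => //.
  - by move=> x _; rewrite mule_ge0 ?lee_fin ?(ltW r10)//; apply: integral_ge0 => X _; rewrite lee_fin.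
  - apply: (measurable_wkint (measurable_palm1 hpalm) (@measurable_cst _ _ E R setT r1) mabs) => z.
    by rewrite lee_fin.
  - by move=> x _; rewrite -EFinM lee_fin !mulr_ge0// ltW.
  - exact: measurable_funeM.
  have nv : valid_index (Some n) by [].
  apply: filterS (ae_integral_fscore nv) => x h _.
  rewrite EFinM -muleA; apply: lee_wpmul2l; first by rewrite lee_fin ltW.
  rewrite indicE; case: (boolP (x \in _)) => xW.
    rewrite mule1; apply: (@le_trans _ _ (\int[palm1 x]_X (K%:E * `|fscore (Some n) (x, X)|%:E))).
      apply: ge0_le_integral => //.
      - exact: (measurableT_comp mabs (measurable_pair1 x)).
      - by apply: measurable_funeM; apply/measurable_EFinP; exact: measurableT_comp.
      - by move=> X _; rewrite -EFinM lee_fin /wscore normrM ler_wpM2r// gK.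
    rewrite ge0_integralZl ?lee_fin//; last by apply/measurable_EFinP; exact: measurableT_comp.
    by rewrite EFinM; apply: lee_wpmul2l; [rewrite lee_fin|apply: h; rewrite -inE].
  rewrite mule0; under eq_integral => X _.
    rewrite /wscore /= gscale_out//; last by move: xW; rewrite notin_setE.
    rewrite mul0r normr0; over.
  by rewrite integral0.
rewrite ge0_integralZl ?lee_fin// ?mulr_ge0 ?(ltW r10)//.
by rewrite integral_indic_window// -EFinM ltry.
Qed.

(** Campbell's formula and a change of scale present both quantities as integrals over the same
    window; their integrands differ by at most the Palm mean of the effect of the window, times the
    bounds on the intensity and on g. *)
Lemma mean_compare n : (0 < n)%N ->
  [/\ measurable_fun setT (point_sum P n (wscore n)),
    Pr.-integrable setT (EFin \o point_sum P n (wscore n)) &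
    `|\int[Pr]_w (point_sum P n (wscore n) w)%:E - (r1 * qmean * n%:R)%R%:E * \int[lam]_x (g x)%:E|
      <= (r1 * K)%R%:E * boundary_error n].
Proof.
move=> n0.
have r10 := intensity_gt0 hP.
have wscore_out x X : ~ window (Some n) x -> wscore n (x, X) = 0%R.
  by move=> nx; rewrite /wscore /= gscale_out// mul0r.
have [mS IS ->] := signed_campbell1 hP hpalm (measurable_wscore n) wscore_out (mix1_wscore n0).
split => //.
have [Ik _] := mixture_signed (measurable_palm1 hpalm) (@measurable_cst _ _ E R setT r1)
  (fun=> ltW r10) (measurable_wscore n) (mix1_wscore n0).
have Ig := integrable_gscale n0.
have Igs : lam.-integrable setT (fun x => (r1 * qmean * gscale n x)%R%:E).
  by under eq_fun do rewrite EFinM; exact: integrableZl.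
have -> : (r1 * qmean * n%:R)%R%:E * \int[lam]_x (g x)%:E = \int[lam]_x (r1 * qmean * gscale n x)%R%:E.
  under [RHS]eq_integral do rewrite EFinM.
  by rewrite integralZl// integral_gscale// muleA -EFinM.
have mI : measurable_fun setT (fun x : E => (\1_(window (Some n)) x)%:E : \bar R).
  by apply/measurable_EFinP/measurable_indicP; exact: measurable_window.
have mk : measurable_fun setT (fun x => (r1 * kmean palm1 (wscore n) x)%:E - (r1 * qmean * gscale n x)%:E).
  by apply: emeasurable_funB; exact: measurable_int (Ik) || exact: measurable_int (Igs).
have mDW : measurable_fun setT (fun x => palm_diff n x * (\1_(window (Some n)) x)%:E).
  by apply: emeasurable_funM => //; exact: measurable_palm_diff.
have DW0 x : 0 <= palm_diff n x * (\1_(window (Some n)) x)%:E.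
  by rewrite mule_ge0 ?palm_diff_ge0// lee_fin.
rewrite -integralB_EFin//.
apply: (le_trans (le_abse_integral _ _ _)) => //.
rewrite -ge0_integralZl//; last by rewrite lee_fin mulr_ge0// ltW.
have nv : valid_index (Some n) by [].
apply: ae_ge0_le_integral => //.
- exact: measurableT_comp.
- by move=> x _; rewrite mule_ge0// lee_fin mulr_ge0// ltW.
- exact: measurable_funeM.
apply: filterS (ae_integral_fscore nv) => x h _.
rewrite -EFinB abse_EFin; have [xW|xW] := boolP (x \in (window (Some n) : set E)); last first.
  rewrite gscale_out// ?mulr0; last by move: xW; rewrite notin_setE.
  rewrite /kmean; under eq_integral => X _.
    rewrite wscore_out; last by move: xW; rewrite notin_setE.
    over.
  rewrite integral0 /= mulr0 subrr normr0.
  by rewrite mule_ge0// lee_fin mulr_ge0// ltW.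
rewrite indicE xW mule1.
have Iq : (palm1 x).-integrable setT (fun X => (fscore (Some n) (x, X))%:E).
  apply/integrableP; split; first exact/measurable_EFinP.
  by apply: le_lt_trans (ltry C); apply: h; rewrite -inE.
have -> : kmean palm1 (wscore n) x = (gscale n x * kmean palm1 (fscore (Some n)) x)%R.
  rewrite /kmean; under eq_integral do rewrite /wscore /= EFinM.
  by rewrite integralZl// fineM//; exact: integrable_fin_num.
have IT := fscoreT_integrable x.
have hd : `|kmean palm1 (fscore (Some n)) x - qmean|%:E <= palm_diff n x.
  rewrite -(kmean_fscoreT x) -abse_EFin EFinB !kmeanE// -integralB_EFin//.
  apply: (le_trans (le_abse_integral _ _ _)) => //.
  by apply: emeasurable_funB; apply/measurable_EFinP.
apply: (@le_trans _ _ ((r1 * K)%R%:E * `|kmean palm1 (fscore (Some n)) x - qmean|%:E)); last first.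
  by apply: lee_wpmul2l => //; rewrite lee_fin mulr_ge0// ltW.
rewrite -EFinM lee_fin.
have -> : (r1 * (gscale n x * kmean palm1 (fscore (Some n)) x) - r1 * qmean * gscale n x =
  r1 * gscale n x * (kmean palm1 (fscore (Some n)) x - qmean))%R by ring.
rewrite !normrM (gtr0_norm r10) ler_wpM2r// ler_wpM2l ?(ltW r10)//.
exact: gK.
Qed.

End mean_value.

(** * Exponential decay beats every power *)

Section exponential_decay.
Context (R : realType).

(** From exp(y) >= (y / N)^N at y = b t^c, with N so large that c N >= m + 1; the constant is (N /
    b)^N. *)
Lemma exp_power_decay (b c : R) (m : nat) : 0 < b -> 0 < c ->
  exists A : R, 0 <= A /\ forall t, 1 <= t -> t ^+ m * expR (- (b * t `^ c)) <= A / t.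
Proof.
move=> b0 c0.
pose N := (Num.truncn (m.+1%:R / c)).+1.
have N0 : 0 < N%:R :> R by rewrite ltr0n.
have cN : m.+1%:R <= c * N%:R.
  by rewrite mulrC -ler_pdivrMr// ltW// truncnS_gt.
exists ((N%:R / b) ^+ N); split; first by rewrite exprn_ge0// divr_ge0// ltW.
move=> t t1; have t0 : 0 < t by exact: lt_le_trans t1.
pose y := b * t `^ c.
have y0 : 0 < y by rewrite mulr_gt0// powR_gt0.
have ey : (y / N%:R) ^+ N <= expR y.
  have -> : expR y = expR (y / N%:R) ^+ N by rewrite -expRM_natl mulrC divfK// gt_eqF.
  apply: lerXn2r; rewrite ?nnegrE ?expR_ge0//; first by rewrite divr_ge0// ltW.
  by apply: le_trans (expR_ge1Dx _); rewrite lerDr.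
have yN0 : 0 < (y / N%:R) ^+ N by rewrite exprn_gt0// divr_gt0.
rewrite expRN ler_pdivlMr//.
apply: (@le_trans _ _ (t ^+ m * ((y / N%:R) ^+ N)^-1 * t)).
  by rewrite ler_wpM2r ?(ltW t0)// ler_wpM2l ?exprn_ge0 ?(ltW t0)// lef_pV2 ?posrE ?expR_gt0.
have -> : t ^+ m * ((y / N%:R) ^+ N)^-1 * t = t ^+ m.+1 / ((t `^ c) ^+ N) * (N%:R / b) ^+ N.
  rewrite exprS /y !exprMn !exprVn !invfM !invrK; ring.
rewrite -[leRHS]mul1r ler_wpM2r ?exprn_ge0 ?divr_ge0 ?(ltW b0)//.
rewrite ler_pdivrMr ?exprn_gt0 ?powR_gt0// mul1r.
by rewrite -powR_mulrn ?powR_ge0// -powRrM -powR_mulrn ?(ltW t0)// ler_powR.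
Qed.

(** A negative upper limit gives some b > 0 with phi(t) <= exp(- b t^c) for large t, which is
    smaller than any power. *)
Lemma exponential_fast (phi : R -> R) (c : R) :
  (forall t, 0 <= t -> 0 <= phi t <= 1) ->
  (forall s t, 0 <= s -> s <= t -> phi t <= phi s) -> 0 < c ->
  (limf_esup (fun t : R => (t `^ (- c))%R%:E * lne (phi t)%:E) (pinfty_nbhs R) < 0)%E ->
  fast_decreasing phi.
Proof.
move=> phi01 phid c0 lim; split => // m m0.
have [b [b0 hb]] : exists b : R, 0 < b /\ \forall t \near +oo, phi t <= expR (- (b * t `^ c)).
  move: lim; rewrite /limf_esup => /ereal_inf_lt[_ [A FA <-] supA].
  have [b [b0 bA]] : exists b : R, 0 < b /\
      (ereal_sup [set ((t `^ (- c))%R%:E * lne (phi t)%:E)%E | t in A] <= (- b)%:E)%E.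
    (* If the supremum is -oo, any positive rate will do, for instance 1. *)
    move: supA; case: (ereal_sup _) => [r|//|] h; last by exists 1; split => //; rewrite leNye.
    by exists (- r); rewrite opprK lexx oppr_gt0 -lte_fin; split.
  exists b; split => //.
  near=> t.
  have t0 : 0 < t by near: t; exact: nbhs_pinfty_gt.
  have At : A t by near: t.
  have /andP[p0 _] := phi01 t (ltW t0).
  (* Where phi vanishes its logarithm is -oo, so this case is settled apart. *)
  move: p0; rewrite le_eqVlt => /orP[/eqP <-|p0]; first exact: expR_ge0.
  have : ((t `^ (- c))%R%:E * lne (phi t)%:E <= (- b)%:E)%E.
    by apply: le_trans bA; apply: ereal_sup_ubound; exists t.
  rewrite lne_EFin// -EFinM lee_fin powRN mulrC ler_pdivrMr ?powR_gt0// mulNr => h.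
  by rewrite -(lnK p0) ler_expR.
have [A [A0 hA]] := exp_power_decay m b0 c0.
apply/cvgrPdist_le => e e0.
near=> t.
have t1 : 1 <= t by near: t; apply: nbhs_pinfty_ge; rewrite num_real.
have t0 : 0 < t by exact: lt_le_trans t1.
have /andP[p0 _] := phi01 t (ltW t0).
rewrite sub0r normrN ger0_norm ?mulr_ge0 ?exprn_ge0 ?(ltW t0)//.
apply: (@le_trans _ _ (t ^+ m * expR (- (b * t `^ c)))).
  by rewrite ler_wpM2l ?exprn_ge0 ?(ltW t0)//; near: t.
apply: (le_trans (hA t t1)); rewrite ler_pdivrMr// mulrC -ler_pdivrMr//.
Unshelve. all: by end_near. Qed.

End exponential_decay.

(** * Effect of the window on the Palm means *)

Section truncation_error.
Context (R : realType) (d : nat) (disp : measure_display) (Omega : measurableType disp).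
Context (Pr : probability Omega R) (P : {RV Pr >-> config R d}).
Context (palm : forall k, k.-tuple 'rV[R]_d -> probability (config R d) R).
Context (xi : 'rV[R]_d -> config R d -> R).
Variables (a : nat -> R) (phi : R -> R) (p C : R).
Hypothesis st : stabilizing_with Pr P palm xi a phi.
Hypothesis C0 : 0 <= C.

Definition truncation_error l s M t :=
  2 * M * phi (a l * t) + M `^ (1 - p / s%:R) * (C + C).

Lemma truncation_error_small l s e : (0 < l)%N -> (0 < s)%N -> s%:R < p -> 0 < e ->
  exists2 M, 0 < M & exists2 k0 : nat, (0 < k0)%N &
    forall k : nat, (k0 <= k)%N -> truncation_error l s M k%:R <= e.
Proof.
move=> l0 s0 sp e0.
have ps1 : 1 < p / s%:R by rewrite ltr_pdivlMr ?ltr0n// mul1r.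
have e20 : 0 < e / 2 by lra.
have C20 : 0 < C + C + 1 by rewrite ltr_wpDl// addr_ge0.
have r0 : p / s%:R - 1 != 0 by rewrite subr_eq0 gt_eqF.
have e0' : 0 < e / 2 / (C + C + 1) by rewrite divr_gt0.
(* The solution of M^(1 - p/s) = (e / 2) / (2 C + 1), where the 1 covers the case C = 0. With M
   fixed, the term containing phi is then made small by taking k large. *)
pose M := (e / 2 / (C + C + 1)) `^ (- (p / s%:R - 1)^-1).
have M0 : 0 < M by exact: powR_gt0.
have hM : M `^ (1 - p / s%:R) * (C + C) <= e / 2.
  rewrite -powRrM (_ : - (p / s%:R - 1)^-1 * (1 - p / s%:R) = 1); last by move: r0; move: (p / s%:R)%R => r r0; field.
  rewrite (powRr1 (ltW e0')) -(mulrA (e / 2)) ler_piMr ?(ltW e20)// mulrC ler_pdivrMr// mul1r; lra.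
exists M => //.
have [ha _ hphi cphi _] := st; have al0 := ha l l0.
have M8 : 0 < e / 2 / (2 * M) by rewrite divr_gt0// mulr_gt0.
have /cvgrPdist_le/(_ _ M8)[T [Treal hT]] := cphi.
exists (Num.truncn (`|T| / a l)).+1 => // k kk.
have kT : T < a l * k%:R.
  rewrite mulrC -ltr_pdivrMr//; apply: (@lt_le_trans _ _ (Num.truncn (`|T| / a l)).+1%:R); last by rewrite ler_nat.
  apply: le_lt_trans (truncnS_gt _).
  by rewrite ler_wpM2r ?ler_norm// invr_ge0 ltW.
have := hT _ kT; rewrite sub0r normrN => /(le_trans (ler_norm _)).
rewrite ler_pdivlMr ?mulr_gt0// mulrC => h.
rewrite /truncation_error; lra.
Qed.

End truncation_error.

Section window_error.
Context (R : realType) (d : nat) (disp : measure_display) (Omega : measurableType disp).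
Hypothesis d_gt0 : (0 < d)%N.
Context (Pr : probability Omega R) (P : {RV Pr >-> config R d}).
Context (rho : forall k, k.-tuple 'rV[R]_d -> R).
Context (palm : forall k, k.-tuple 'rV[R]_d -> probability (config R d) R).
Context (xi : 'rV[R]_d -> config R d -> R).
Hypothesis hP : admissible Pr P rho.
Hypothesis hpalm : palm_probabilities Pr P palm.
Hypothesis hxi : score_function xi.
Notation E := 'rV[R]_d.
Notation cfg := (config R d).
Notation lam := (lebesgue_row R d).
Notation L := (side R d).
Notation palm1 := (palm1 palm).
Variables (p C : R).
Hypothesis hC : moment_bound P palm xi p C.
Variables (q : R -> R) (s : nat).
Hypotheses (mq : measurable_fun setT q) (s_gt0 : (0 < s)%N) (sp : s%:R < p)
  (p1 : (1 <= Num.truncn p)%N).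
Hypothesis qs : forall y, `|q y| <= Num.max `|y| 1 ^+ s.
Variables (a : nat -> R) (phi : R -> R).
Hypothesis st : stabilizing_with Pr P palm xi a phi.
Notation palm_diff := (palm_diff palm xi q).
Notation boundary_error := (boundary_error palm xi q).
Notation fscore := (fscore xi q).
Local Open Scope ereal_scope.

Let mfscore n (x : E) : measurable_fun setT (fun X => fscore n (x, X)).
Proof. exact: (measurableT_comp (measurable_fscore hxi mq n) (measurable_pair1 x)). Qed.

Lemma moment_bound_ge0 : (0 <= C)%R.
Proof.
have [y /(_ Logic.I) hy] := ae_exists d_gt0
  (ae_integral_fscore hP hxi hC mq sp p1 qs (isT : valid_index None)).
by rewrite -lee_fin; apply: le_trans hy; apply: integral_ge0 => X _; rewrite lee_fin.
Qed.

Lemma ae_palm_diff_window m : (0 < m)%N ->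
  {ae lam, forall x, window (Some m) x -> palm_diff m x <= (C + C)%:E}.
Proof.
move=> m0; have nv : valid_index (Some m) by [].
have h1 := ae_integral_fscore hP hxi hC mq sp p1 qs nv.
have h2 := ae_integral_fscore hP hxi hC mq sp p1 qs (isT : valid_index None).
apply: filterS2 h1 h2 => x /[swap] /(_ Logic.I) h2 h1 /h1 {}h1.
have mabs n : measurable_fun setT (fun X => `|fscore n (x, X)|%:E : \bar R).
  by apply/measurable_EFinP; exact: measurableT_comp.
apply: (@le_trans _ _ (\int[palm1 x]_X (`|fscore (Some m) (x, X)|%:E + `|fscore None (x, X)|%:E))).
  apply: ge0_le_integral => //.
  - by apply/measurable_EFinP; apply: measurableT_comp => //; exact: measurable_funB.
  - exact: emeasurable_funD.
  - by move=> X _; rewrite -EFinD lee_fin ler_normB.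
by rewrite ge0_integralD// EFinD; exact: leeD.
Qed.

Lemma ae_palm_diff_inner m (t M : R) : (0 < t)%R -> (0 < M)%R -> (0 < m)%N ->
  {ae lam, forall x, inner m t x -> palm_diff m x <=
    (truncation_error a phi p C 1 s M t)%:E}.
Proof.
move=> t0 M0 m0; have := ae_trunc_majorant1 hP hxi hC s st t0 M0 m0 p1.
apply: filterS => x h /h; apply: le_trans; apply: ge0_le_integral => //.
- by apply/measurable_EFinP; apply: measurableT_comp => //; exact: measurable_funB.
- apply/measurable_EFinP; exact: (measurableT_comp (measurable_trunc_majorant hxi p M s m) (measurable_pair1 x)).
- by move=> X _; rewrite lee_fin; exact: score_diff_le.
Qed.

Lemma boundary_error_bound (e : nat -> R) K n : (0 < n)%N -> (forall k, (0 <= e k)%R) ->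
  (forall k, {ae lam, forall x, inner n k%:R x -> palm_diff n x <= (e k)%:E}) ->
  boundary_error n <= (\sum_(k < K) e k * (d%:R * (2 * (n%:R / L n))))%R%:E + (e K)%:E * lam (inner n K%:R).
Proof.
move=> n0 e0 he; apply: layer_bound => //; first exact: (measurable_palm_diff hpalm hxi mq n).
by move=> x; exact: palm_diff_ge0.
Qed.

Let a1 : (0 < a 1%N)%R. Proof. by have [h _ _ _ _] := st; exact: h. Qed.
Let phi0 t : (0 <= t)%R -> (0 <= phi t)%R.
Proof. by have [_ h _ _ _] := st => /h/andP[]. Qed.
Let ps1 : (1 < p / s%:R)%R.
Proof. by rewrite ltr_pdivlMr ?ltr0n// mul1r. Qed.

Lemma boundary_error_cvg : ((n%:R^-1)%:E * boundary_error n) @[n --> \oo] --> 0.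
Proof.
have C0 := moment_bound_ge0.
apply: cvge0 => [n|e e0].
  rewrite mule_ge0 ?lee_fin//; apply: integral_ge0 => x _.
  by rewrite mule_ge0 ?palm_diff_ge0// lee_fin.
have e20 : (0 < e / 2)%R by lra.
have [M M0 [k0 k0_gt0 hk]] := truncation_error_small st C0 (ltn0Sn 0) s_gt0 sp e20.
(* The first [k0] layers only have the crude bound 2 C from the moments, but their total volume is
   O(n / n^(1/d)); further inside the truncation error is at most e / 2. *)
pose e_ k := if (k < k0)%N then (C + C)%R else (e / 2)%R.
have e_0 k : (0 <= e_ k)%R by rewrite /e_; case: ifP => _; lra.
pose B := (k0%:R * (C + C) * (d%:R * 2))%R.
have B0 : (0 <= B)%R by rewrite !mulr_ge0// addr_ge0.
have [N hN] := side_ge (B / (e / 2))%R d_gt0.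
exists N.+1 => // n /= Nn; have n0 : (0 < n)%N by exact: leq_ltn_trans Nn.
have nR : (0 < n%:R :> R)%R by rewrite ltr0n.
have L0 : (0 < L n)%R by exact: side_gt0.
have bnd := @boundary_error_bound e_ k0 n n0 e_0.
have {bnd} : boundary_error n <= (k0%:R * (C + C) * (d%:R * (2 * (n%:R / L n))) + e / 2 * n%:R)%:E.
  apply: (le_trans (bnd _)).
    move=> k; rewrite /e_; case: ifPn => kk.
      apply: filterS (ae_palm_diff_window n0) => x h xk; apply: h.
      exact: (inner_window (ler0n R k) xk).
    apply: filterS (ae_palm_diff_inner (t := k0%:R) _ M0 n0); last by rewrite ltr0n.
    move=> x h xk; apply: (@le_trans _ _ _ _ _ (h _)); last by rewrite lee_fin hk.
    by apply: subset_inner xk; rewrite ler_nat leqNgt.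
  rewrite EFinD; apply: leeD.
    rewrite lee_fin -mulr_suml ler_wpM2r//; first by rewrite !mulr_ge0// invr_ge0 ltW.
    rewrite (eq_bigr (fun=> (C + C)%R)) ?sumr_const ?card_ord ?mulr_natl//.
    by move=> i _; rewrite /e_ ltn_ord.
  rewrite /e_ ltnn (EFinM (e / 2)%R); apply: lee_wpmul2l; first by rewrite lee_fin; lra.
  rewrite -(lebesgue_window R d_gt0); apply: le_measure; rewrite ?inE.
  - exact: measurable_inner.
  - exact: measurable_window.
  - by apply: inner_window; rewrite ler0n.
have nV : 0 <= (n%:R^-1)%:E :> \bar R by rewrite lee_fin invr_ge0.
move=> h; apply: (le_trans (lee_wpmul2l nV h)).
rewrite -EFinM lee_fin.
have -> : (n%:R^-1 * (k0%:R * (C + C) * (d%:R * (2 * (n%:R / L n))) + e / 2 * n%:R) = B / L n + e / 2)%R.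
  by rewrite /B; field; rewrite !gt_eqF.
have : (B / L n <= e / 2)%R.
  by rewrite ler_pdivrMr// mulrC -ler_pdivrMr// hN// ltnW.
lra.
Qed.

Lemma boundary_error_rate : fast_decreasing phi ->
  exists A : R, (0 <= A)%R /\ forall n, (0 < n)%N -> (n%:R^-1)%:E * boundary_error n <= (A / L n)%:E.
Proof.
move=> phif; have C0 := moment_bound_ge0.
(* The truncation levels make [M k `^ (1 - p / s)] equal to (k + 1)^-2. *)
pose b := (2 / (p / s%:R - 1))%R.
have r0 : (0 < p / s%:R - 1)%R by rewrite subr_gt0.
have b0 : (0 <= b)%R by rewrite divr_ge0// ltW.
pose M (k : nat) : R := (k.+1%:R `^ b)%R.
have M0 k : (0 < M k)%R by rewrite powR_gt0.
pose e (k : nat) := (2 * M k * phi (a 1%N * k%:R) + M k `^ (1 - p / s%:R) * (C + C))%R.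
have ph0 k : (0 <= phi (a 1%N * k%:R))%R by apply: phi0; rewrite mulr_ge0// ltW.
have e0 k : (0 <= e k)%R.
  by rewrite addr_ge0 ?mulr_ge0 ?powR_ge0 ?addr_ge0//; exact: ltW.
(* An integer above b, so that M k = (k + 1)^b <= (2 (k + 1))^m, and [telescoping_fast] with
   exponent m sums M k phi(a k). *)
pose m := (Num.truncn b).+1.
have [A1 hA1] := telescoping_fast m a1 phif.
have A10 : (0 <= A1)%R.
  have := hA1 0%N; rewrite ler_pdivlMr ?mulr_gt0//; apply: le_trans.
  by rewrite !mulr_ge0// exprn_ge0.
have he k : (e k <= (2 * A1 + 4 * C) / (k.+1%:R * k.+2%:R))%R.
  have k0 : (0 < k.+1%:R * k.+2%:R :> R)%R by rewrite mulr_gt0.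
  have h1 : (M k * phi (a 1%N * k%:R) <= A1 / (k.+1%:R * k.+2%:R))%R.
    apply: le_trans (hA1 k); rewrite mulrC ler_wpM2l//.
    apply: (@le_trans _ _ (k.+1%:R ^+ m)%R).
      rewrite -powR_mulrn//; apply: ler_powR; first by rewrite ler1n.
      by rewrite ltW// truncnS_gt.
    by apply: lerXn2r; rewrite ?nnegrE ?mulr_ge0// ler_peMl// ler1n.
  have h2 : (M k `^ (1 - p / s%:R) <= 2 / (k.+1%:R * k.+2%:R))%R.
    rewrite /M -powRrM.
    have -> : (b * (1 - p / s%:R) = - 2%:R)%R.
      by rewrite /b; move: (lt0r_neq0 r0); move: (p / s%:R)%R => r r0'; field.
    rewrite powRN powR_mulrn// ler_pdivlMr//.
    rewrite mulrC ler_pdivrMr ?exprn_gt0// expr2 mulrCA ler_pM2l//.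
    by rewrite -natrM ler_nat; lia.
  have -> : ((2 * A1 + 4 * C) / (k.+1%:R * k.+2%:R) = 2 * (A1 / (k.+1%:R * k.+2%:R)) + 2 / (k.+1%:R * k.+2%:R) * (C + C))%R by ring.
  by rewrite /e -mulrA; apply: lerD; [rewrite ler_pM2l|rewrite ler_wpM2r// addr_ge0].
exists ((2 * A1 + 4 * C) * (d%:R * 2))%R; split.
  by rewrite !mulr_ge0// addr_ge0// mulr_ge0.
move=> n n0; have nR : (0 < n%:R :> R)%R by rewrite ltr0n.
have L0 : (0 < L n)%R by exact: side_gt0.
(* No point of the window has depth exceeding its side, so the box left after [K] layers is
   empty. *)
pose K := (Num.truncn (L n)).+1.
have inK : inner n K%:R = (set0 : set E).
  rewrite -subset0 => x /(_ (Ordinal d_gt0)) h.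
  have h2 : (L n < K%:R)%R by exact: truncnS_gt.
  have := normr_ge0 (x ord0 (Ordinal d_gt0)); lra.
have hae k : {ae lam, forall x, inner n k%:R x -> palm_diff n x <= (e k)%:E}.
  (* Stabilization speaks of t > 0 only. The outermost layer takes the crude bound 2 C, which [e 0]
     contains because [M 0] equals 1. *)
  case: k => [|k].
    apply: filterS (ae_palm_diff_window n0) => x h; rewrite inner0 => /h/le_trans; apply.
    by rewrite lee_fin /e /M powR1 powR1 mul1r lerDr mulr_ge0// mulr_ge0.
  by apply: ae_palm_diff_inner => //; rewrite ltr0n.
have := boundary_error_bound K n0 e0 hae; rewrite inK measure0 mule0 adde0.
have nV : 0 <= (n%:R^-1)%:E :> \bar R by rewrite lee_fin invr_ge0.
move=> h; apply: (le_trans (lee_wpmul2l nV h)).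
rewrite -EFinM lee_fin -mulr_suml.
have -> : (n%:R^-1 * ((\sum_(k < K) e k) * (d%:R * (2 * (n%:R / L n)))) = (\sum_(k < K) e k) * (d%:R * 2) / L n)%R.
  by field; rewrite !gt_eqF.
rewrite ler_pM2r ?invr_gt0// ler_wpM2r ?mulr_ge0//.
apply: (@le_trans _ _ (\sum_(k < K) (2 * A1 + 4 * C) / (k.+1%:R * k.+2%:R))%R); first exact: ler_sum.
rewrite -mulr_sumr sum_telescoping -[leRHS]mulr1 ler_wpM2l ?gerBl// addr_ge0// mulr_ge0//.
Qed.

End window_error.

Section cutoff.
Context (R : realType) (d : nat).
Notation E := 'rV[R]_d.
Notation W1 := (window (Some 1%N) : set E).

Lemma bounded_cutoff (f : E -> R) : bounded_measurable f ->
  exists K : R, [/\ measurable_fun setT (f \_ W1), (forall u, `|(f \_ W1) u| <= K) &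
    (forall u, ~ W1 u -> (f \_ W1) u = 0)].
Proof.
move=> [mf /pinfty_ex_gt0[K K0 fK]]; exists K; split.
- by apply/(measurable_restrict _ _ _).1; rewrite ?setTI//; exact: measurable_window.
- by move=> u; rewrite patchE; case: ifPn => [|_]; [rewrite inE; exact: fK|rewrite normr0 ltW].
- by move=> u nu; rewrite patchE memNset.
Qed.

End cutoff.

Section mean_asymptotics.
Context (R : realType) (d : nat) (disp : measure_display) (Omega : measurableType disp).
Hypothesis d_gt0 : (0 < d)%N.
Context (Pr : probability Omega R) (P : {RV Pr >-> config R d}).
Context (rho : forall k, k.-tuple 'rV[R]_d -> R).
Context (palm : forall k, k.-tuple 'rV[R]_d -> probability (config R d) R).
Context (xi : 'rV[R]_d -> config R d -> R).
Hypothesis hP : admissible Pr P rho.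
Hypothesis hpalm : palm_probabilities Pr P palm.
Hypothesis hxi : score_function xi.
Notation E := 'rV[R]_d.
Notation W1 := (window (Some 1%N) : set E).
Notation lam := (lebesgue_row R d).
Notation L := (side R d).
Notation r1 := (intensity rho).
Local Open Scope ereal_scope.

Lemma xi_sumE n (f : E -> R) : (0 < n)%N ->
  xi_sum P xi n f = point_sum P n (wscore xi id (f \_ W1) n).
Proof.
move=> n0; apply/funext => w; rewrite /xi_sum /point_sum.
apply: eq_fsbigr => x; rewrite inE => -[_ xW].
have e : (n%:R `^ (- d%:R^-1) = (L n)^-1 :> R)%R by rewrite powRN.
rewrite e /wscore /gscale patchE mem_set; last exact: window_scaleV.
exact: mulrC.
Qed.

Lemma integral_cutoff (h : E -> R) :
  \int[lam]_(x in W1) (h x)%:E = \int[lam]_x ((h \_ W1) x)%:E.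
Proof. by rewrite integral_mkcond; apply: eq_integral => x _; rewrite !patchE; case: ifP. Qed.

Lemma truncn_ge (k : nat) (p : R) : (k%:R < p)%R -> (k <= Num.truncn p)%N.
Proof.
move=> kp; case: k kp => // k kp.
by rewrite truncn_gt_nat ltW.
Qed.

Variables (p : R).
Hypothesis p1 : (1 < p)%R.
Hypothesis moment : moment_condition Pr P palm xi p.

Let id_le (y : R) : (`|y| <= Num.max `|y| 1 ^+ 1)%R.
Proof. by rewrite expr1 le_max lexx. Qed.

Let mid : measurable_fun setT (@id R). Proof. exact: measurable_id. Qed.
Let p11 : (1%:R < p)%R. Proof. exact: p1. Qed.

Lemma mean_error_le (f : E -> R) : bounded_measurable f -> exists2 K : R, (0 <= K)%R &
  forall n, (0 < n)%N ->
  mean_error Pr P rho palm xi n f <= K%:E * ((n%:R^-1)%:E * boundary_error palm xi id n).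
Proof.
have [C hC] := moment_boundP moment.
have tp := truncn_ge p11.
move=> /bounded_cutoff[K [mg gK gW]].
have K0 : (0 <= K)%R by exact: le_trans (gK 0%R).
have r10 := intensity_gt0 hP.
exists (r1 * K)%R; first by rewrite mulr_ge0// ltW.
move=> n n0.
have [mS IS bS] := mean_compare d_gt0 hP hpalm hxi hC mid p11 tp id_le mg gK gW n0.
have Ig := integrable_bounded_window d_gt0 mg gK gW.
rewrite /mean_error unlock xi_sumE// integral_cutoff.
have -> : \int[palm [tuple 0%R]]_X (xi 0%R X)%:E = (qmean palm xi id)%:E.
  rewrite /qmean kmeanE; last exact: (fscoreT_integrable d_gt0 hP hpalm hxi hC mid p11 tp id_le).
  by apply: eq_integral => X _; rewrite /fscore /= score_inT.
have nR : (n%:R != 0 :> R)%R by rewrite pnatr_eq0 -lt0n.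
set I := \int[lam]_x _ in bS *; have If : I \is a fin_num by exact: integrable_fin_num.
have Sf : \int[Pr]_w (point_sum P n (wscore xi id (f \_ W1) n) w)%:E \is a fin_num.
  exact: integrable_fin_num.
have -> : (qmean palm xi id)%:E * (@rho 1%N [tuple 0%R])%:E * I =
    (n%:R^-1)%:E * ((r1 * qmean palm xi id * n%:R)%:E * I).
  rewrite muleA -!EFinM; congr (_%:E * _); rewrite /intensity; field; exact: nR.
rewrite -muleBr//; last by apply: fin_num_adde_defr.
rewrite abseM gee0_abs ?lee_fin ?invr_ge0// muleCA.
by apply: lee_wpmul2l => //; rewrite lee_fin invr_ge0.
Qed.

Lemma mean_error_cvg (f : E -> R) : stabilizing Pr P palm xi -> bounded_measurable f ->
  mean_error Pr P rho palm xi n f @[n --> \oo] --> 0.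
Proof.
move=> [a [phi st]] /mean_error_le[K K0 h].
have [C hC] := moment_boundP moment.
have D0 := boundary_error_cvg d_gt0 hP hpalm hxi hC mid (ltn0Sn 0) p11 (truncn_ge p11) id_le st.
apply: (@squeeze_cvge _ _ _ _ (fun=> 0) _ (fun n => K%:E * ((n%:R^-1)%:E * boundary_error palm xi id n))).
- by exists 1%N => // n /= n0; rewrite abse_ge0 h.
- exact: cvg_cst.
- by rewrite -[X in _ --> X](mule0 K%:E); exact: cvgeZl.
Qed.

Lemma mean_error_rate (f : E -> R) : exponentially_stabilizing Pr P palm xi ->
  bounded_measurable f ->
  exists C : R, \forall n \near \oo,
       (mean_error Pr P rho palm xi n f <= (C * n%:R `^ (- d%:R^-1))%:E).
Proof.
move=> [a [phi [st [c [c0 hc]]]]] /mean_error_le[K K0 h].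
have [C hC] := moment_boundP moment.
have phif : fast_decreasing phi.
  by have [_ h1 h2 _ _] := st; move/andP: hc => [_ hc]; exact: (exponential_fast h1 h2 c0 hc).
have [A [A0 hA]] := boundary_error_rate d_gt0 hP hpalm hxi hC mid (ltn0Sn 0) p11 (truncn_ge p11) id_le st phif.
exists (K * A)%R; exists 1%N => // n /= n0.
apply: (le_trans (h n n0)); rewrite -mulrA EFinM; apply: lee_wpmul2l; first by rewrite lee_fin.
by rewrite powRN; exact: hA.
Qed.

End mean_asymptotics.

(** * Second-order correlations *)

Section fine_integral.
Context dT (T : measurableType dT) (R : realType) (mu : {measure set T -> \bar R}).
Local Open Scope ereal_scope.

(** At least one of the two parts has an infinite integral, and their extended difference is then
    infinite whatever the other part is. *)
Lemma fine_integral_nonintegrable (f : T -> R) : measurable_fun setT f ->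
  ~ mu.-integrable setT (EFin \o f) -> fine (\int[mu]_x (f x)%:E) = 0%R.
Proof.
move=> mf nf; have mEf : measurable_fun setT (EFin \o f) by exact/measurable_EFinP.
rewrite [X in fine X]integralE.
have p0 : 0 <= \int[mu]_x (EFin \o f)^\+ x by apply: integral_ge0 => x _.
have m0 : 0 <= \int[mu]_x (EFin \o f)^\- x by apply: integral_ge0 => x _.
have : ~ (\int[mu]_x (EFin \o f)^\+ x < +oo /\ \int[mu]_x (EFin \o f)^\- x < +oo).
  move=> [ip im]; apply: nf; apply/integrableP; split => //.
  rewrite (_ : \int[mu]_x _ = \int[mu]_x ((EFin \o f)^\+ x + (EFin \o f)^\- x)); last first.
    by apply: eq_integral => x _; rewrite -/((abse \o (EFin \o f)) x) fune_abse.
  rewrite ge0_integralD//; [exact: lte_add_pinfty|exact: measurable_funepos|exact: measurable_funeneg].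
move: p0 m0; case: (\int[mu]_x (EFin \o f)^\+ x) => [r| |] // _; case: (\int[mu]_x (EFin \o f)^\- x) => [s| |] // _.
by case; rewrite !ltry.
Qed.

(* When the right-hand side is finite, either both functions are integrable or
   neither is, and then both junk values are 0. *)
Lemma fine_integral_diff (f g : T -> R) : measurable_fun setT f -> measurable_fun setT g ->
  `|fine (\int[mu]_x (f x)%:E) - fine (\int[mu]_x (g x)%:E)|%:E <= \int[mu]_x `|f x - g x|%:E.
Proof.
move=> mf mg; have [fin|] := ltP (\int[mu]_x `|f x - g x|%:E) +oo; last first.
  by rewrite leye_eq => /eqP ->; rewrite leey.
have Id : mu.-integrable setT (fun x => (f x - g x)%:E).
  by apply/integrableP; split => //; apply/measurable_EFinP; exact: measurable_funB.
have [If|nf] := pselect (mu.-integrable setT (EFin \o f)).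
  have Ig : mu.-integrable setT (EFin \o g).
    rewrite (_ : EFin \o g = fun x => (f x)%:E - (f x - g x)%:E); first exact: integrableB.
    by apply/funext => x; rewrite -EFinB /=; congr (_%:E); ring.
  rewrite -abse_EFin EFinB !fineK; try exact: integrable_fin_num.
  rewrite -integralB_EFin//; apply: (le_trans (le_abse_integral _ _ _)) => //.
  by apply/measurable_EFinP; exact: measurable_funB.
have ng : ~ mu.-integrable setT (EFin \o g).
  move=> Ig; apply: nf; rewrite (_ : EFin \o f = fun x => (g x)%:E + (f x - g x)%:E); first exact: integrableD.
  by apply/funext => x; rewrite -EFinD /=; congr (_%:E); ring.
rewrite !fine_integral_nonintegrable// subrr normr0.
by apply: integral_ge0 => x _; rewrite lee_fin.
Qed.

Lemma fine_integralZ (f : T -> R) (k : R) : measurable_fun setT f ->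
  fine (\int[mu]_x (k * f x)%:E) = (k * fine (\int[mu]_x (f x)%:E))%R.
Proof.
move=> mf; have [->|k0] := eqVneq k 0%R.
  by rewrite mul0r; under eq_integral do rewrite mul0r; rewrite integral0.
have [If|nf] := pselect (mu.-integrable setT (EFin \o f)).
  under eq_integral do rewrite EFinM.
  by rewrite integralZl// fineM//; exact: integrable_fin_num.
rewrite [in RHS]fine_integral_nonintegrable// mulr0 fine_integral_nonintegrable//.
  exact: measurable_funM.
move=> Ik; apply: nf.
rewrite (_ : EFin \o f = fun x => (k^-1)%:E * (k * f x)%:E); first exact: integrableZl.
by apply/funext => x; rewrite -EFinM mulKf.
Qed.

End fine_integral.

Section product_integrals.
Context (R : realType) (d : nat).
Notation E := 'rV[R]_d.
Notation lam := (lebesgue_row R d).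
Local Open Scope ereal_scope.

Let mpair : measurable_fun setT (fun z : E * E => (z.1, z.1 + z.2)%R).
Proof.
apply/measurable_fun_pairP; split; first exact: measurable_fst.
exact: (measurable_rowD measurable_fst measurable_snd).
Qed.

Lemma measurable_sheared (dY : measure_display) (Y : measurableType dY) (F : E * E -> Y) :
  measurable_fun setT F -> measurable_fun setT (fun z : E * E => F (z.1, z.1 + z.2)%R).
Proof. by move=> mF; exact: (measurableT_comp mF mpair). Qed.

(** For each fixed first point, the shear (x, u) -> (x, x + u) is a translation of the second
    variable. It introduces the lag u as an integration variable. *)
Lemma ge0_integral_sheared (F : E * E -> \bar R) : measurable_fun setT F -> (forall z, 0 <= F z) ->
  \int[lam \x lam]_z F (z.1, z.1 + z.2)%R = \int[lam \x lam]_z F z.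
Proof.
move=> mF F0.
rewrite fubini_tonelli1//; last exact: measurable_sheared.
rewrite [RHS]fubini_tonelli1//; apply: eq_integral => x _.
rewrite -[RHS](ge0_integral_shift x)//; last exact: (measurableT_comp mF (measurable_pair1 x)).
by apply: eq_integral => z _; rewrite /= addrC.
Qed.

Lemma ge0_integral_diff (F : E * E -> \bar R) : measurable_fun setT F -> (forall z, 0 <= F z) ->
  \int[lam \x lam]_z F z = \int[lam]_z \int[lam]_x F (x, x + z)%R.
Proof.
move=> mF F0; rewrite -ge0_integral_sheared// fubini_tonelli2//.
exact: measurable_sheared.
Qed.

Lemma integral_diff (F : E * E -> \bar R) : (lam \x lam).-integrable setT F ->
  measurable_fun setT (fun z => \int[lam]_x F (x, x + z)%R) /\
  \int[lam \x lam]_z F z = \int[lam]_z \int[lam]_x F (x, x + z)%R.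
Proof.
move=> IF; have mF := measurable_int _ IF.
have IG : (lam \x lam).-integrable setT (fun z : E * E => F (z.1, z.1 + z.2)%R).
  apply/integrableP; split; first exact: measurable_sheared.
  have mabs : measurable_fun setT (abse \o F) by exact: measurableT_comp.
  have -> := ge0_integral_sheared mabs (fun z => abse_ge0 (F z)).
  by have /integrableP[] := IF.
split; first exact: (measurable_fubini_G IG).
transitivity (\int[lam \x lam]_z F (z.1, z.1 + z.2)%R); last by rewrite -fubini2.
rewrite integralE [RHS]integralE; congr (_ - _).
  rewrite -(ge0_integral_sheared (F := F^\+))//; last exact: measurable_funepos.
  by apply: eq_integral => z _; rewrite !funeposE.
rewrite -(ge0_integral_sheared (F := F^\-))//; last exact: measurable_funeneg.
by apply: eq_integral => z _; rewrite !funenegE.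
Qed.

Lemma integral_tensor (f g : E -> R) : lam.-integrable setT (EFin \o f) ->
  lam.-integrable setT (EFin \o g) ->
  (lam \x lam).-integrable setT (fun z => (f z.1 * g z.2)%:E) /\
  \int[lam \x lam]_z (f z.1 * g z.2)%:E = \int[lam]_x (f x)%:E * \int[lam]_x (g x)%:E.
Proof.
move=> If Ig.
have mf : measurable_fun setT f by apply/measurable_EFinP; exact: measurable_int If.
have mg : measurable_fun setT g by apply/measurable_EFinP; exact: measurable_int Ig.
have gfin : \int[lam]_x (g x)%:E \is a fin_num by exact: integrable_fin_num.
have I2 : (lam \x lam).-integrable setT (fun z => (f z.1 * g z.2)%:E).
  have mfg : measurable_fun setT (fun z : E * E => (f z.1 * g z.2)%R).
    by apply: measurable_funM; [exact: (measurableT_comp mf measurable_fst)|exact: (measurableT_comp mg measurable_snd)].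
  apply/integrableP; split; first exact/measurable_EFinP.
  have nf : measurable_fun setT (fun x => `|f x|%:E : \bar R) by apply/measurable_EFinP; exact: measurableT_comp.
  have ng : measurable_fun setT (fun x => `|g x|%:E : \bar R) by apply/measurable_EFinP; exact: measurableT_comp.
  have /integrableP[_ fF] := If; have /integrableP[_ gF] := Ig.
  rewrite fubini_tonelli1//; last by apply: measurableT_comp => //; exact/measurable_EFinP.
  rewrite (_ : \int[lam]_x _ = \int[lam]_x (`|f x|%:E * \int[lam]_y `|g y|%:E)).
    rewrite ge0_integralZr//; last by apply: integral_ge0 => y _; rewrite lee_fin.
    by rewrite lte_mul_pinfty//; [exact: integral_ge0|rewrite ge0_fin_numE//; exact: integral_ge0].
  apply: eq_integral => x _; rewrite /fubini_F /= -ge0_integralZl//.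
  by apply: eq_integral => y _; rewrite normrM.
split => //; rewrite -fubini1//; transitivity (\int[lam]_x ((f x)%:E * \int[lam]_y (g y)%:E)); last first.
  by rewrite -(fineK gfin); exact: (integralZr measurableT If).
apply: eq_integral => x _; rewrite /fubini_F /= -integralZl//.
Qed.

End product_integrals.

Section ereal_fine.
Context (R : realType).
Local Open Scope ereal_scope.

Lemma fine_mulr (a : \bar R) (r : R) : fine (a * r%:E) = (fine a * r)%R.
Proof.
case: a => [a| |] //=; rewrite mul0r; case: (ltgtP 0%R r) => [h|h|<-]; rewrite ?mule0//.
- by rewrite gt0_mulye// lte_fin.
- by rewrite lt0_mulye// lte_fin.
- by rewrite gt0_mulNye// lte_fin.
- by rewrite lt0_mulNye// lte_fin.
Qed.

(** The product of an infinite factor is finite only when the other factor is 0; then both sides are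
    0. *)
Lemma fin_num_mule (a b : \bar R) : a * b \is a fin_num -> a * b = (fine a * fine b)%:E.
Proof.
move=> h; rewrite -(fineK h); congr (_%:E).
case: b h => [b _| |] /=; first exact: fine_mulr.
- case: a => [a| |] //=; rewrite ?mulr0//.
  by rewrite muleC fine_mulr mul0r.
- case: a => [a| |] //=; rewrite ?mulr0//.
  by rewrite muleC fine_mulr mul0r.
Qed.

End ereal_fine.

Section second_order.
Context (R : realType) (d : nat) (disp : measure_display) (Omega : measurableType disp).
Hypothesis d_gt0 : (0 < d)%N.
Context (Pr : probability Omega R) (P : {RV Pr >-> config R d}).
Context (rho : forall k, k.-tuple 'rV[R]_d -> R).
Context (palm : forall k, k.-tuple 'rV[R]_d -> probability (config R d) R).
Context (xi : 'rV[R]_d -> config R d -> R).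
Hypothesis hP : admissible Pr P rho.
Hypothesis hpalm : palm_probabilities Pr P palm.
Hypothesis hxi : score_function xi.
Notation E := 'rV[R]_d.
Notation cfg := (config R d).
Notation lam := (lebesgue_row R d).
Notation palm1 := (palm1 palm).
Notation palm2 := (palm2 palm).
Notation r1 := (intensity rho).
Notation score_in := (score_in xi).
Local Open Scope ereal_scope.

Definition score_pair n (z : (E * E) * cfg) : R := (score_in n z.1.1 z.2 * score_in n z.1.2 z.2)%R.

Definition score_mean n : E -> R := kmean palm1 (fscore xi id n).

(** The real version of m_2 - m_1 m_1, measurable everywhere and equal to it wherever that
    difference is finite. *)
Definition score_cov n (z : E * E) : R :=
  (rho2 rho z * kmean palm2 (score_pair n) z - r1 * score_mean n z.1 * (r1 * score_mean n z.2))%R.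

Lemma measurable_score_pair n : measurable_fun setT (score_pair n).
Proof.
apply: measurable_funM; apply: (measurable_score_in hxi) => //.
- exact: (measurableT_comp measurable_fst measurable_fst).
- exact: (measurableT_comp measurable_snd measurable_fst).
Qed.

Lemma measurable_score_mean n : measurable_fun setT (score_mean n).
Proof.
by apply: (measurable_kmean (measurable_palm1 hpalm)); apply: measurable_fscore => //; exact: measurable_id.
Qed.

Lemma measurable_score_cov n : measurable_fun setT (score_cov n).
Proof.
have mm := measurable_score_mean n.
apply: measurable_funB; apply: measurable_funM.
- exact: (measurable_rho2 hP).
- by apply: (measurable_kmean (measurable_palm2 hpalm)); exact: measurable_score_pair.
- by apply: measurable_funM => //; exact: (measurableT_comp mm measurable_fst).
- by apply: measurable_funM => //; exact: (measurableT_comp mm measurable_snd).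
Qed.

Let mpair2 (z : E * E) n : measurable_fun setT (fun X => (score_pair n (z, X))%:E : \bar R).
Proof. by apply/measurable_EFinP; exact: (measurableT_comp (measurable_score_pair n) (measurable_pair1 z)). Qed.

Lemma integral_score_pair_shift (x y : E) :
  \int[palm2 (x, y)]_X (score_pair None ((x, y), X))%:E =
  \int[palm2 (0, y - x)%R]_X (score_pair None ((0, y - x)%R, X))%:E.
Proof.
rewrite (integral_palm2_shift hpalm)//; apply: eq_integral => X _; rewrite /score_pair /=.
have := score_inT_shift hxi x 0%R X; rewrite add0r => ->.
by have := score_inT_shift hxi x (y - x)%R X; rewrite subrK => ->.
Qed.

Lemma integral_score_shift (x : E) :
  \int[palm1 x]_X (score_in None x X)%:E = \int[palm1 0%R]_X (score_in None 0%R X)%:E.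
Proof.
rewrite (integral_palm1_shift hpalm); last first.
  by apply/measurable_EFinP; exact: measurable_score_in.
by apply: eq_integral => X _; have := score_inT_shift hxi x 0%R X; rewrite add0r => ->.
Qed.

Lemma score_cov_shift (x y : E) : score_cov None (x, y) = score_cov None (0, y - x)%R.
Proof.
rewrite /score_cov (rho2_shift hP) /score_mean /kmean /= integral_score_pair_shift.
by rewrite /fscore /= !integral_score_shift.
Qed.

Lemma second_order_shift (x y : E) :
  m2 rho palm xi None x y - m1 rho palm xi None x * m1 rho palm xi None y =
  m2 rho palm xi None 0%R (y - x)%R - m1 rho palm xi None 0%R ^+ 2.
Proof.
rewrite /m2 /m1 unlock expe2 !(rho1E hP); congr (_ * _%:E - _ * _ * (_ * _)).
- exact: integral_score_pair_shift.
- exact: (rho2_shift hP).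
- exact: integral_score_shift.
- exact: integral_score_shift.
Qed.

(** A finite extended difference has finite terms, and a finite product is the product of the values
    of [fine], even if a factor is infinite and the other one 0. *)
Lemma score_covE n (x y : E) :
  m2 rho palm xi n x y - m1 rho palm xi n x * m1 rho palm xi n y \is a fin_num ->
  m2 rho palm xi n x y - m1 rho palm xi n x * m1 rho palm xi n y = (score_cov n (x, y))%:E.
Proof.
rewrite fin_numB => /andP[/fin_num_mule e2 /fin_num_mule e1].
rewrite [m2 _ _ _ _ _ _]e2 e1 /m1 !fine_mulr unlock !(rho1E hP) -EFinB; congr (_%:E).
by rewrite /score_cov /rho2 /score_mean /kmean /= (mulrC (fine _)) ![(r1 * _)%R]mulrC.
Qed.

Lemma lebesgue_set0 : lam [set 0%R] = 0.
Proof.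
rewrite (_ : [set 0%R] = [set x : E | forall i, [set 0%R : R] (x ord0 i)]).
  rewrite (@lebesgue_row_box R d (fun=> [set 0%R]))//.
  by rewrite (bigD1 (Ordinal d_gt0))//= lebesgue_measure_set1 mul0e.
apply/seteqP; split => x /= => [-> i|h]; first by rewrite mxE.
by apply/rowP => i; rewrite h mxE.
Qed.

Variables (phi : R -> R) (D c : R).
Hypotheses (phif : fast_decreasing phi) (c0 : (0 < c)%R).
Hypothesis decay : forall n, valid_index n ->
  {ae tuple_measure lam 2, forall xs,
    let x1 := tnth xs ord0 in let x2 := tnth xs ord_max in
    x1 != x2 ->
    (`|m2 rho palm xi n x1 x2 - m1 rho palm xi n x1 * m1 rho palm xi n x2|
      <= (D * phi (c * enorm (x1 - x2)))%R%:E)%E}.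

(** The absolute value is there because the constant of the decay condition comes without a sign. *)
Definition cov_majorant (u : E) : \bar R := `|D|%:E * shell_majorant phi c u.
Notation H := cov_majorant.

Lemma measurable_cov_majorant : measurable_fun setT H.
Proof. by apply: measurable_funeM; exact: (measurable_shell_majorant c0 phif). Qed.

Lemma cov_majorant_ge0 u : 0 <= H u.
Proof. by rewrite mule_ge0// ?lee_fin// (shell_majorant_ge0 c0 phif). Qed.

Lemma integral_cov_majorant : \int[lam]_u H u < +oo.
Proof.
rewrite ge0_integralZl ?lee_fin//; last 2 first.
- exact: (measurable_shell_majorant c0 phif).
- by move=> u _; exact: (shell_majorant_ge0 c0 phif).
rewrite lte_mul_pinfty ?lee_fin//; exact: integral_shell_majorant.
Qed.

Lemma cov_majorant_tail :
  (\int[lam]_u (H u * (\1_(~` cube k%:R) u)%:E)) @[k --> \oo] --> 0.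
Proof.
rewrite (_ : (fun k : nat => _) = fun k : nat => `|D|%:E * \int[lam]_u (shell_majorant phi c u * (\1_(~` cube k%:R) u)%:E)).
  by rewrite -[X in _ --> X](mule0 `|D|%:E); apply: cvgeZl => //; exact: shell_majorant_tail.
apply/funext => k; rewrite -ge0_integralZl ?lee_fin//.
- by apply: eq_integral => u _; rewrite muleA.
- apply: emeasurable_funM; first exact: (measurable_shell_majorant c0 phif).
  by apply/measurable_EFinP/measurable_indicP; apply: measurableC; exact: measurable_cube.
- by move=> u _; rewrite mule_ge0 ?lee_fin// (shell_majorant_ge0 c0 phif).
Qed.

Lemma enormB (x y : E) : enorm (x - y) = enorm (y - x).
Proof. by rewrite /enorm; congr Num.sqrt; apply: eq_bigr => i _; rewrite !mxE -sqrrN opprB. Qed.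

Lemma ae_second_order n : valid_index n ->
  {ae lam \x lam, forall z,
    `|m2 rho palm xi n z.1 z.2 - m1 rho palm xi n z.1 * m1 rho palm xi n z.2| < +oo /\
    `|m2 rho palm xi n z.1 z.2 - m1 rho palm xi n z.1 * m1 rho palm xi n z.2| <= H (z.2 - z.1)%R}.
Proof.
move=> nv; have /ae_tuple2 h := decay nv.
(* Decay is assumed at distinct points; the diagonal is null, since the difference of a pair is
   almost everywhere non-zero. *)
have h0 : {ae lam, forall u : E, u != 0%R}.
  exists [set 0%R]; split => //; [exact: measurable_row_set1|exact: lebesgue_set0|].
  by move=> u /= /negP; rewrite negbK => /eqP.
apply: (@filterS2 _ _ _ _ _ _ _ h (ae_prod_diff h0)) => -[x y] /= h1 xy.
have {}h1 := h1 _; split.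
  by apply: le_lt_trans (h1 _) _; rewrite ?ltry// eq_sym -subr_eq0.
apply: (le_trans (h1 _)); first by rewrite eq_sym -subr_eq0.
apply: (@le_trans _ _ (`|D|%:E * (phi (c * enorm (y - x)%R))%:E)).
  rewrite enormB -EFinM lee_fin ler_wpM2r ?ler_norm//.
  have [ph _ _] := phif.
  by have /andP[] := ph _ (mulr_ge0 (ltW c0) (sqrtr_ge0 (\sum_i (y - x) ord0 i ^+ 2))).
by apply: lee_wpmul2l; [rewrite lee_fin|exact: (shell_majorant_ge d_gt0 c0 phif)].
Qed.

Lemma ae_score_cov n : valid_index n ->
  {ae lam \x lam, forall z, `|score_cov n z|%:E <= H (z.2 - z.1)%R}.
Proof.
move=> nv; apply: filterS (ae_second_order nv) => -[x y] /= [fin]; rewrite score_covE//.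
by rewrite fin_num_abs.
Qed.

(** In the whole space the second-order quantity depends on the difference of the two points only,
    so what holds for almost all pairs holds at (0, u) for almost all u. *)
Lemma ae_limit_cov : {ae lam, forall u,
  m2 rho palm xi None 0%R u - m1 rho palm xi None 0%R ^+ 2 = (score_cov None (0%R, u))%:E /\
  `|score_cov None (0%R, u)|%:E <= H u}.
Proof.
apply: (ae_diff_prod d_gt0).
apply: filterS (ae_second_order (isT : valid_index None)) => -[x y] /=.
rewrite second_order_shift.
have := @second_order_shift 0%R (y - x)%R; rewrite subr0 => <- [fin].
by rewrite score_covE// fin_num_abs.
Qed.

Lemma limit_cov_integrable : lam.-integrable setT (fun u => (score_cov None (0%R, u))%:E).
Proof.
have mc : measurable_fun setT (fun u => score_cov None (0%R, u)).
  exact: (measurableT_comp (measurable_score_cov None) (measurable_pair1 (0%R : E))).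
apply/integrableP; split; first exact/measurable_EFinP.
apply: le_lt_trans integral_cov_majorant; apply: ae_ge0_le_integral => //.
- by apply: measurableT_comp => //; exact/measurable_EFinP.
- by move=> u _; exact: cov_majorant_ge0.
- exact: measurable_cov_majorant.
- by apply: filterS ae_limit_cov => u [].
Qed.

End second_order.

(** * Covariance asymptotics *)

Lemma fsum_mul_diag (R : realType) (T : choiceType) (A : set T) (a b : T -> R) : finite_set A ->
  (\sum_(x \in A) a x) * (\sum_(y \in A) b y) = \sum_(x \in A) (a x * b x) +
    \sum_(x \in A) \sum_(y \in A) if x == y then 0 else a x * b y.
Proof.
move=> fA; rewrite !fsbig_finite//= mulr_suml -big_split /=; apply: eq_big_seq => x xA.
rewrite fsbig_finite// mulr_sumr (bigD1_seq x)//= [in RHS](bigD1_seq x)//= eqxx add0r.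
by congr (_ + _); apply: eq_bigr => y yx; rewrite eq_sym (negbTE yx).
Qed.

Section pair_moments.
Context (R : realType) (d : nat) (disp : measure_display) (Omega : measurableType disp).
Hypothesis d_gt0 : (0 < d)%N.
Context (Pr : probability Omega R) (P : {RV Pr >-> config R d}).
Context (rho : forall k, k.-tuple 'rV[R]_d -> R).
Context (palm : forall k, k.-tuple 'rV[R]_d -> probability (config R d) R).
Context (xi : 'rV[R]_d -> config R d -> R).
Hypothesis hP : admissible Pr P rho.
Hypothesis hpalm : palm_probabilities Pr P palm.
Hypothesis hxi : score_function xi.
Notation E := 'rV[R]_d.
Notation cfg := (config R d).
Notation lam := (lebesgue_row R d).
Notation L := (side R d).
Notation palm1 := (palm1 palm).
Notation palm2 := (palm2 palm).
Notation r1 := (intensity rho).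
Notation score_in := (score_in xi).
Notation score_max := (score_max xi).
Notation W n := (window (Some n) : set E).
Notation mix2r := (mix2 rho palm).
Local Open Scope ereal_scope.

Variable B : R.
Hypotheses (B0 : (0 <= B)%R) (hB : {ae lam \x lam, forall z, (rho2 rho z <= B)%R}).

Lemma mix2_first (S : set (E * E)) (G : E * cfg -> R) (b : R) :
  measurable S -> measurable_fun setT G -> (forall z, (0 <= G z)%R) -> (0 <= b)%R ->
  {ae lam \x lam, forall z, rho2 rho z != 0%R -> S z ->
    \int[palm2 z]_X (G (z.1, X))%:E <= b%:E} ->
  mix2r (fun z => (\1_S z.1 * G (z.1.1, z.2))%:E) <= (B * b)%:E * (lam \x lam) S.
Proof.
move=> mS mG G0 b0 hb.
have mF : measurable_fun setT (fun z : (E * E) * cfg => (\1_S z.1 * G (z.1.1, z.2))%:E : \bar R).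
  apply/measurable_EFinP; apply: measurable_funM.
    by apply: (measurableT_comp _ measurable_fst); apply/measurable_indicP.
  apply: (measurableT_comp mG); apply/measurable_fun_pairP; split; last exact: measurable_snd.
  exact: (measurableT_comp measurable_fst measurable_fst).
have F0 (z : (E * E) * cfg) : 0 <= (\1_S z.1 * G (z.1.1, z.2))%:E by rewrite lee_fin mulr_ge0.
apply: (@le_trans _ _ (\int[lam \x lam]_z ((B * b)%:E * (\1_S z)%:E))); last first.
  rewrite ge0_integralZl ?lee_fin ?mulr_ge0//; last by apply/measurable_EFinP/measurable_indicP.
  by rewrite integral_indic// setIT.
apply: ae_ge0_le_integral => //.
- by move=> z _; rewrite mule_ge0 ?lee_fin ?(rho2_ge0 hP)//; apply: integral_ge0 => X _; exact: (F0 (z, X)).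
- exact: (measurable_wkint (measurable_palm2 hpalm) (measurable_rho2 hP) mF F0).
- by move=> z _; rewrite -EFinM lee_fin !mulr_ge0.
- by apply: measurable_funeM; apply/measurable_EFinP/measurable_indicP.
apply: (@filterS2 _ _ _ _ _ _ _ hb hB) => z hbz hBz _.
(* Without a positive density nothing is known of the Palm mean, but its weight is zero. *)
have [->|r0] := eqVneq (rho2 rho z) 0%R.
  by rewrite mul0e -EFinM lee_fin !mulr_ge0.
rewrite indicE /=; have [zS|zS] := boolP (z \in S); last first.
  by under eq_integral do rewrite mul0r; rewrite integral0 !mule0.
under eq_integral do rewrite mul1r.
rewrite mule1 EFinM; apply: lee_pmul; rewrite ?lee_fin ?(rho2_ge0 hP)//.
- by apply: integral_ge0 => X _; rewrite lee_fin.
- by apply: hbz => //; rewrite -inE.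
Qed.

Lemma mixtureD (F G : (E * E) * cfg -> \bar R) : measurable_fun setT F -> measurable_fun setT G ->
  (forall z, 0 <= F z) -> (forall z, 0 <= G z) ->
  mix2r (fun z => F z + G z) = mix2r F + mix2r G.
Proof.
move=> mF mG F0 G0.
have kF := measurable_wkint (measurable_palm2 hpalm) (measurable_rho2 hP) mF F0.
have kG := measurable_wkint (measurable_palm2 hpalm) (measurable_rho2 hP) mG G0.
have kF0 z : 0 <= (rho2 rho z)%:E * \int[palm2 z]_X F (z, X) by exact: (wkint_ge0 _ (rho2_ge0 hP) z F0).
have kG0 z : 0 <= (rho2 rho z)%:E * \int[palm2 z]_X G (z, X) by exact: (wkint_ge0 _ (rho2_ge0 hP) z G0).
rewrite /mix2 /mixture -ge0_integralD//.
apply: eq_integral => z _; rewrite ge0_integralD//.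
- by rewrite ge0_muleDr//; exact: integral_ge0.
- exact: (measurableT_comp mF (measurable_pair1 z)).
- exact: (measurableT_comp mG (measurable_pair1 z)).
Qed.

(* Stabilization and the moment condition only control the score at the first
   point; the symmetry of the second factorial moment measure gives the other. *)
Lemma mix2_sym n (S : set (E * E)) (G : E * cfg -> R) (b : R) :
  measurable S -> measurable_fun setT G -> (forall z, (0 <= G z)%R) -> (0 <= b)%R ->
  S `<=` W n `*` W n -> (forall x y, S (x, y) -> S (y, x)) ->
  {ae lam \x lam, forall z, rho2 rho z != 0%R -> S z ->
    \int[palm2 z]_X (G (z.1, X))%:E <= b%:E} ->
  mix2r (fun z => (\1_S z.1 * (G (z.1.1, z.2) + G (z.1.2, z.2)))%:E) <=
    (2 * (B * b))%:E * (lam \x lam) S.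
Proof.
move=> mS mG G0 b0 SW Ssym hb.
pose F (z : (E * E) * cfg) := (\1_S z.1 * G (z.1.1, z.2))%:E : \bar R.
pose F' (z : (E * E) * cfg) := F ((z.1.2, z.1.1), z.2).
have mF : measurable_fun setT F.
  apply/measurable_EFinP; apply: measurable_funM.
    by apply: (measurableT_comp _ measurable_fst); apply/measurable_indicP.
  apply: (measurableT_comp mG); apply/measurable_fun_pairP; split; last exact: measurable_snd.
  exact: (measurableT_comp measurable_fst measurable_fst).
have F0 z : 0 <= F z by rewrite lee_fin mulr_ge0.
have mF' : measurable_fun setT F'.
  apply: (measurableT_comp mF); apply/measurable_fun_pairP; split; last exact: measurable_snd.
  apply/measurable_fun_pairP; split.
    exact: (measurableT_comp measurable_snd measurable_fst).
  exact: (measurableT_comp measurable_fst measurable_fst).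
have F'0 z : 0 <= F' z by exact: F0.
have FW x y X : ~ (W n x /\ W n y) -> F ((x, y), X) = 0.
  by move=> nW; rewrite /F indicE memNset ?mul0r// => /SW.
rewrite (_ : (fun z => _) = fun z => F z + F' z); last first.
  apply/funext => -[[x y] X]; rewrite /F' /F /= -EFinD mulrDr; congr (_ + _ * _)%:E.
  rewrite !indicE; congr (_ : bool)%:R.
  by apply/idP/idP; rewrite !inE; exact: Ssym.
rewrite mixtureD// (mix2_swap hP hpalm mF F0 FW).
have h := mix2_first mS mG G0 b0 hb.
rewrite (_ : (2 * (B * b))%:E * _ = (B * b)%:E * (lam \x lam) S + (B * b)%:E * (lam \x lam) S).
  exact: leeD.
by rewrite EFinM -muleA mule_natl mule2n.
Qed.

Variables (p C : R).
Hypothesis hC : moment_bound P palm xi p C.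
Hypotheses (p2 : (2 < p)%R) (tp : (2 <= Num.truncn p)%N).

Let C0 : (0 <= C)%R.
Proof.
apply: (moment_bound_ge0 d_gt0 hP hxi hC (measurable_id (D := setT)) (s := 1)).
- by apply: lt_trans p2; rewrite ltr_nat.
- exact: leq_trans tp.
- by move=> y; rewrite expr1 le_max lexx.
Qed.

Lemma mix2_pair_lty n (a : E * E -> R) (K : R) : (0 < n)%N -> measurable_fun setT a ->
  (forall z, (`|a z| <= K)%R) -> (forall z, ~ (W n z.1 /\ W n z.2) -> a z = 0%R) ->
  mix2r (fun z => `|a z.1 * score_pair xi (Some n) z|%:E) < +oo.
Proof.
move=> n0 ma aK aW; have K0 : (0 <= K)%R by exact: le_trans (aK (0%R, 0%R)).
have mW : measurable (W n) by exact: measurable_window.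
pose S := W n `*` W n.
have mS : measurable S by exact: measurableX.
pose G z := (K * score_max (Some n) z `^ p)%R.
have mG : measurable_fun setT G.
  by apply: measurable_funM => //; apply: (measurableT_comp (measurable_powR p)); exact: measurable_score_max.
have G0 z : (0 <= G z)%R by rewrite mulr_ge0// powR_ge0.
have KC0 : (0 <= K * C)%R by rewrite mulr_ge0.
have nv : valid_index (Some n) by [].
have hb : {ae lam \x lam, forall z, rho2 rho z != 0%R -> S z ->
    \int[palm2 z]_X (G (z.1, X))%:E <= (K * C)%:E}.
  apply: filterS (ae_moment2_bound hP hC tp nv) => z h r0 [W1 W2].
  rewrite /G; under eq_integral do rewrite EFinM.
  rewrite ge0_integralZl ?lee_fin//; last 2 first.
  - apply/measurable_EFinP; apply: (measurableT_comp (measurable_powR p)).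
    exact: (measurableT_comp (measurable_score_max hxi (Some n)) (measurable_pair1 z.1)).
  - by move=> X _; rewrite lee_fin powR_ge0.
  by rewrite EFinM; apply: lee_wpmul2l; rewrite ?lee_fin//; exact: h.
have Ssym x y : S (x, y) -> S (y, x) by move=> [].
have := mix2_sym mS mG G0 KC0 (@subset_refl _ S) Ssym hb => h.
have {h}h : mix2r (fun z => (\1_S z.1 * (G (z.1.1, z.2) + G (z.1.2, z.2)))%:E) < +oo.
  apply: (le_lt_trans h); rewrite lte_mul_pinfty ?lee_fin ?mulr_ge0//.
  have -> : (lam \x lam) S = lam (W n) * lam (W n) by exact: product_measure1E.
  by rewrite (lebesgue_window R d_gt0) -EFinM ltry.
apply: le_lt_trans h; apply: le_mixture.
- exact: (measurable_palm2 hpalm).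
- exact: (measurable_rho2 hP).
- exact: (rho2_ge0 hP).
- apply/measurable_EFinP; apply: measurableT_comp => //; apply: measurable_funM; last exact: measurable_score_pair.
  exact: (measurableT_comp ma measurable_fst).
- apply/measurable_EFinP; apply: measurable_funM.
    by apply: (measurableT_comp _ measurable_fst); apply/measurable_indicP.
  apply: measurable_funD; apply: (measurableT_comp mG); apply/measurable_fun_pairP; split; try exact: measurable_snd.
    exact: (measurableT_comp measurable_fst measurable_fst).
  exact: (measurableT_comp measurable_snd measurable_fst).
- by move=> z; rewrite lee_fin.
move=> [[x y] X] /=; rewrite lee_fin indicE.
have [xyS|xyS] := boolP ((x, y) \in S); last first.
  rewrite aW ?mul0r ?normr0// => -[W1 W2]; move: xyS; rewrite notin_setE; apply.
  by split.
rewrite mul1r /G -mulrDr normrM; apply: ler_pM => //.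
rewrite /score_pair /= normrM.
have := score_max_ge xi (Some n) (x, X); have := score_max_ge xi (Some n) (y, X) => /= h1 h2.
have pw z : (score_max (Some n) z ^+ 2 <= score_max (Some n) z `^ p)%R.
  have b1 := score_max_ge1 xi (Some n) z.
  by rewrite -powR_mulrn ?(le_trans _ b1)//; apply: ler_powR => //; exact: ltW.
have := pw (x, X); have := pw (y, X).
have := score_max_ge1 xi (Some n) (x, X); have := score_max_ge1 xi (Some n) (y, X).
move: h1 h2; move: (score_max _ (x, X)) (score_max _ (y, X)) (_ `^ p)%R (_ `^ p)%R => u v u' v' h1 h2 v1 u1 h3 h4.
(* The scores are replaced by their maxima with 1, and then u v <= u^2 + v^2 <= u^p + v^p. *)
apply: (@le_trans _ _ (u * v)%R); first exact: ler_pM.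
nra.
Qed.

End pair_moments.

Section covariance_formula.
Context (R : realType) (d : nat) (disp : measure_display) (Omega : measurableType disp).
Hypothesis d_gt0 : (0 < d)%N.
Context (Pr : probability Omega R) (P : {RV Pr >-> config R d}).
Context (rho : forall k, k.-tuple 'rV[R]_d -> R).
Context (palm : forall k, k.-tuple 'rV[R]_d -> probability (config R d) R).
Context (xi : 'rV[R]_d -> config R d -> R).
Hypothesis hP : admissible Pr P rho.
Hypothesis hpalm : palm_probabilities Pr P palm.
Hypothesis hxi : score_function xi.
Notation E := 'rV[R]_d.
Notation cfg := (config R d).
Notation lam := (lebesgue_row R d).
Notation palm1 := (palm1 palm).
Notation palm2 := (palm2 palm).
Notation r1 := (intensity rho).
Notation W1 := (window (Some 1%N) : set E).
Local Open Scope ereal_scope.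

Variable B : R.
Hypotheses (B0 : (0 <= B)%R) (hB : {ae lam \x lam, forall z, (rho2 rho z <= B)%R}).
Variables (p C : R).
Hypothesis hC : moment_bound P palm xi p C.
Hypotheses (p2 : (2 < p)%R) (tp : (2 <= Num.truncn p)%N).

Let id_le (y : R) : (`|y| <= Num.max `|y| 1 ^+ 1)%R.
Proof. by rewrite expr1 le_max lexx. Qed.
Let sq_le (y : R) : (`|y ^+ 2| <= Num.max `|y| 1 ^+ 2)%R.
Proof. by rewrite normrX; apply: lerXn2r; rewrite ?nnegrE ?le_max ?normr_ge0 ?lexx. Qed.
Let mid : measurable_fun setT (@id R). Proof. exact: measurable_id. Qed.
Let msq : measurable_fun setT (fun y : R => y ^+ 2)%R. Proof. exact: exprn_measurable. Qed.
Let p11 : (1%:R < p)%R. Proof. by apply: lt_trans p2; rewrite ltr_nat. Qed.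
Let tp1 : (1 <= Num.truncn p)%N. Proof. exact: leq_trans tp. Qed.

Lemma kmean_wscore (g : E -> R) n x :
  kmean palm1 (wscore xi id g n) x = (gscale g n x * score_mean palm xi (Some n) x)%R.
Proof.
rewrite /score_mean /kmean -fine_integralZ//.
exact: (measurableT_comp (measurable_fscore hxi mid (Some n)) (measurable_pair1 x)).
Qed.

Variables (f g : E -> R) (K : R).
Hypotheses (mf : measurable_fun setT f) (fK : forall u, (`|f u| <= K)%R)
  (fW : forall u, ~ W1 u -> f u = 0%R).
Hypotheses (mg : measurable_fun setT g) (gK : forall u, (`|g u| <= K)%R)
  (gW : forall u, ~ W1 u -> g u = 0%R).

Let fg (x : E) : R := (f x * g x)%R.
Let K2 : R := (K ^+ 2)%R.
Let K0 : (0 <= K)%R. Proof. exact: le_trans (fK 0%R). Qed.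
Let mfg : measurable_fun setT fg. Proof. exact: measurable_funM. Qed.
Let fgK u : (`|fg u| <= K2)%R.
Proof. by rewrite /fg normrM /K2 expr2; exact: ler_pM. Qed.
Let fgW u : ~ W1 u -> fg u = 0%R. Proof. by move=> /fW h; rewrite /fg h mul0r. Qed.

Notation S h n := (point_sum P n (wscore xi id h n)).
Notation T n := (point_sum P n (wscore xi (fun y : R => y ^+ 2)%R fg n)).

Definition pair_weight n (z : E * E) : R := (gscale f n z.1 * gscale g n z.2)%R.

Lemma measurable_pair_weight n : measurable_fun setT (pair_weight n).
Proof.
apply: measurable_funM.
- exact: (measurableT_comp (measurable_gscale mf n) measurable_fst).
- exact: (measurableT_comp (measurable_gscale mg n) measurable_snd).
Qed.

Lemma pair_weight_le n z : (`|pair_weight n z| <= K2)%R.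
Proof. by rewrite /pair_weight normrM /K2 expr2; apply: ler_pM => //; [exact: fK|exact: gK]. Qed.

Lemma pair_weight_out n z : (0 < n)%N -> ~ (window (Some n) z.1 /\ window (Some n) z.2) ->
  pair_weight n z = 0%R.
Proof.
move=> n0 nz; rewrite /pair_weight.
have [z1|nz1] := pselect (window (Some n) z.1); last by rewrite (gscale_out fW)// mul0r.
by rewrite (gscale_out gW) ?mulr0// => z2; apply: nz.
Qed.

Lemma covariance_formula n : (0 < n)%N ->
  (lam \x lam).-integrable setT (fun z => (pair_weight n z * score_cov rho palm xi (Some n) z)%:E) /\
  covariance Pr (S f n) (S g n) = \int[Pr]_w (T n w)%:E +
    \int[lam \x lam]_z (pair_weight n z * score_cov rho palm xi (Some n) z)%:E.
Proof.
move=> n0; have r10 := intensity_gt0 hP.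
have outq (h : E -> R) (q : R -> R) : (forall u, ~ W1 u -> h u = 0%R) ->
    forall x X, ~ window (Some n) x -> wscore xi q h n (x, X) = 0%R.
  by move=> hW x X nx; rewrite /wscore /= gscale_out// mul0r.
have first_order (h : E -> R) : measurable_fun setT h -> (forall u, (`|h u| <= K)%R) ->
    (forall u, ~ W1 u -> h u = 0%R) ->
    [/\ Pr.-integrable setT (EFin \o S h n),
      lam.-integrable setT (EFin \o (fun x => (r1 * (gscale h n x * score_mean palm xi (Some n) x))%R)) &
      \int[Pr]_w (S h n w)%:E = \int[lam]_x (r1 * (gscale h n x * score_mean palm xi (Some n) x))%:E].
  move=> mh hK hW; have mwscore := measurable_wscore hxi mid mh n.
  have fin := mix1_wscore d_gt0 hP hpalm hxi hC mid p11 tp1 id_le mh hK hW n0.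
  have [_ IS ->] := signed_campbell1 hP hpalm mwscore (outq h id hW) fin.
  have [Ik _] := mixture_signed (measurable_palm1 hpalm) (@measurable_cst _ _ E R setT r1)
    (fun=> ltW r10) mwscore fin.
  split => //; last by apply: eq_integral => x _; rewrite kmean_wscore.
  by move: Ik; apply: eq_integrable => // x _ /=; rewrite kmean_wscore.
have [If If1 Ef] := first_order f mf fK fW.
have [Ig Ig1 Eg] := first_order g mg gK gW.
have [_ IT _] := mean_compare d_gt0 hP hpalm hxi hC msq p2 tp1 sq_le mfg fgK fgW n0.
pose F (z : (E * E) * cfg) := (pair_weight n z.1 * score_pair xi (Some n) z)%R.
have mF : measurable_fun setT F.
  apply: measurable_funM; last exact: measurable_score_pair.
  exact: (measurableT_comp (measurable_pair_weight n) measurable_fst).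
have finF : mix2 rho palm (fun z => `|F z|%:E) < +oo.
  apply: (mix2_pair_lty d_gt0 hP hpalm hxi B0 hB hC p2 tp n0 (measurable_pair_weight n) (pair_weight_le n)).
  by move=> z; exact: pair_weight_out.
have FW x y X : ~ (window (Some n) x /\ window (Some n) y) -> F ((x, y), X) = 0%R.
  by move=> nW; rewrite /F pair_weight_out// mul0r.
have [IF EF] := signed_campbell2 hP hpalm mF FW finF.
have [IF2 _] := mixture_signed (measurable_palm2 hpalm) (measurable_rho2 hP) (rho2_ge0 hP) mF finF.
have kF z : kmean palm2 F z = (pair_weight n z * kmean palm2 (score_pair xi (Some n)) z)%R.
  rewrite /kmean -fine_integralZ//.
  exact: (measurableT_comp (measurable_score_pair hxi (Some n)) (measurable_pair1 z)).
have prodE w : (S f n w * S g n w = T n w + pair_sum P n F w)%R.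
  rewrite /point_sum fsum_mul_diag; last exact: finite_window.
  congr (_ + _)%R; first by apply: eq_fsbigr => x _; rewrite /wscore /gscale /fg /fscore /=; ring.
  apply: eq_fsbigr => x _; apply: eq_fsbigr => y _; case: ifP => // _.
  by rewrite /wscore /F /pair_weight /score_pair /fscore /=; ring.
have IP : Pr.-integrable setT (EFin \o (S f n * S g n)%R).
  move: (integrableD measurableT IT IF); apply: eq_integrable => // w _ /=.
  by rewrite -EFinD -prodE.
have [It Et] := integral_tensor If1 Ig1.
(* The product of the two means is itself a double integral, so it can be subtracted under the
   integral sign from the contribution of the pairs. *)
have cE z : (pair_weight n z * score_cov rho palm xi (Some n) z)%:E =
  (rho2 rho z * kmean palm2 F z)%:E -
  (r1 * (gscale f n z.1 * score_mean palm xi (Some n) z.1) *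
   (r1 * (gscale g n z.2 * score_mean palm xi (Some n) z.2)))%:E.
  by rewrite -EFinB kF /score_cov /pair_weight; congr (_%:E); ring.
split.
  by move: (integrableB measurableT IF2 It); apply: eq_integrable => // z _; rewrite cE.
rewrite covarianceE; [|exact/Lfun1_integrable|exact/Lfun1_integrable|exact/Lfun1_integrable].
rewrite unlock Ef Eg -Et.
have -> : \int[Pr]_w ((S f n * S g n)%R w)%:E = \int[Pr]_w ((T n w)%:E + (pair_sum P n F w)%:E).
  by apply: eq_integral => w _; rewrite -EFinD -prodE.
rewrite integralD//= EF -addeA; congr (_ + _).
by under [RHS]eq_integral do rewrite cE; rewrite integralB.
Qed.

End covariance_formula.

(** * Replacing the covariance kernel of the window by its stationary limit *)

Section difference_kernel.
Context (R : realType) (d : nat).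
Notation E := 'rV[R]_d.
Notation lam := (lebesgue_row R d).
Local Open Scope ereal_scope.

Lemma ge0_integral_diff_kernel (A : E -> \bar R) (V : set E) : measurable_fun setT A ->
  (forall u, 0 <= A u) -> measurable V ->
  \int[lam \x lam]_z (A (z.2 - z.1)%R * (\1_V z.1)%:E) = \int[lam]_u A u * lam V.
Proof.
move=> mA A0 mV.
have mI : measurable_fun setT (fun x : E => (\1_V x)%:E : \bar R).
  exact/measurable_EFinP/measurable_indicP.
rewrite ge0_integral_diff; last first.
- by move=> z; rewrite mule_ge0// lee_fin.
- apply: emeasurable_funM; first exact: (measurableT_comp mA (@measurable_diff R d)).
  exact: (measurableT_comp mI measurable_fst).
rewrite -ge0_integralZr//; apply: eq_integral => u _ /=.
transitivity (\int[lam]_x (A u * (\1_V x)%:E)).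
  by apply: eq_integral => x _; rewrite addrAC subrr add0r.
by rewrite ge0_integralZl// integral_indic// setIT.
Qed.

End difference_kernel.

Section pair_error.
Context (R : realType) (d : nat) (disp : measure_display) (Omega : measurableType disp).
Hypothesis d_gt0 : (0 < d)%N.
Context (Pr : probability Omega R) (P : {RV Pr >-> config R d}).
Context (rho : forall k, k.-tuple 'rV[R]_d -> R).
Context (palm : forall k, k.-tuple 'rV[R]_d -> probability (config R d) R).
Context (xi : 'rV[R]_d -> config R d -> R).
Hypothesis hP : admissible Pr P rho.
Hypothesis hpalm : palm_probabilities Pr P palm.
Hypothesis hxi : score_function xi.
Notation E := 'rV[R]_d.
Notation cfg := (config R d).
Notation lam := (lebesgue_row R d).
Notation L := (side R d).
Notation palm1 := (palm1 palm).
Notation palm2 := (palm2 palm).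
Notation r1 := (intensity rho).
Notation W n := (window (Some n) : set E).
Notation score_mean := (score_mean palm xi).
Notation scov := (score_cov rho palm xi).
Local Open Scope ereal_scope.

Variable B : R.
Hypotheses (B0 : (0 <= B)%R) (hB : {ae lam \x lam, forall z, (rho2 rho z <= B)%R}).
Variables (p C : R).
Hypothesis hC : moment_bound P palm xi p C.
Hypotheses (p2 : (2 < p)%R) (tp : (2 <= Num.truncn p)%N).
Variables (a : nat -> R) (phi : R -> R).
Hypothesis st : stabilizing_with Pr P palm xi a phi.
Variable H : E -> \bar R.
Hypotheses (mH : measurable_fun setT H) (H0 : forall u, 0 <= H u)
  (IH : \int[lam]_u H u < +oo)
  (Htail : (\int[lam]_u (H u * (\1_(~` cube k%:R) u)%:E)) @[k --> \oo] --> 0)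
  (covH : forall n, valid_index n ->
    {ae lam \x lam, forall z, `|scov n z|%:E <= H (z.2 - z.1)%R}).
Notation err := (truncation_error a phi p C).

Let id_le (y : R) : (`|y| <= Num.max `|y| 1 ^+ 1)%R.
Proof. by rewrite expr1 le_max lexx. Qed.
Let mid : measurable_fun setT (@id R). Proof. exact: measurable_id. Qed.
Let p11 : (1%:R < p)%R. Proof. by apply: lt_trans p2; rewrite ltr_nat. Qed.
Let tp1 : (1 <= Num.truncn p)%N. Proof. exact: leq_trans tp. Qed.
Let C0 : (0 <= C)%R. Proof. exact: (moment_bound_ge0 d_gt0 hP hxi hC mid p11 tp1 id_le). Qed.

Lemma ae_score_mean n : valid_index n ->
  {ae lam, forall x, window n x -> (`|score_mean n x| <= C)%R}.
Proof.
move=> nv; apply: filterS (ae_integral_fscore hP hxi hC mid p11 tp1 id_le nv) => x h /h hx.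
rewrite -lee_fin; apply: le_trans (hx); apply: le_kmean; first exact: (measurable_fscore hxi mid n).
have mq := measurableT_comp (measurable_fscore hxi mid n) (measurable_pair1 x).
apply/integrableP; split; first exact/measurable_EFinP.
exact: le_lt_trans hx (ltry C).
Qed.

Lemma score_meanT x : score_mean None x = qmean palm xi id.
Proof. exact: (kmean_fscoreT hpalm hxi mid). Qed.

Lemma qmean_le : (`|qmean palm xi id| <= C)%R.
Proof.
have [y /(_ Logic.I)] := ae_exists d_gt0 (ae_score_mean (isT : valid_index None)).
by rewrite score_meanT.
Qed.

Lemma ae_score_mean_diff m (t M : R) : (0 < t)%R -> (0 < M)%R -> (0 < m)%N ->
  {ae lam, forall x, inner m t x ->
    (`|score_mean (Some m) x - qmean palm xi id| <= err 1 1 M t)%R}.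
Proof.
move=> t0 M0 m0.
have := ae_palm_diff_inner hP hxi hC mid (ltn0Sn 0) p11 tp1 id_le st t0 M0 m0.
apply: filterS => x h /h {}h; rewrite -lee_fin; apply: le_trans h.
rewrite -(score_meanT x); apply: fine_integral_diff.
- exact: (measurableT_comp (measurable_fscore hxi mid (Some m)) (measurable_pair1 x)).
- exact: (measurableT_comp (measurable_fscore hxi mid None) (measurable_pair1 x)).
Qed.

Definition cov_diff n z : R := `|scov (Some n) z - scov None z|%R.

Let mcov n : measurable_fun setT (scov n). Proof. exact: (measurable_score_cov hP hpalm hxi). Qed.

Lemma measurable_cov_diff n : measurable_fun setT (cov_diff n).
Proof. by apply: measurableT_comp => //; apply: measurable_funB. Qed.

(* Pairs far from the boundary and close to each other: outside of this set the
   majorant [H] suffices. *)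
Definition core n (k K : nat) : set (E * E) :=
  [set z | [/\ inner n k%:R z.1, inner n k%:R z.2 & cube K%:R (z.2 - z.1)%R]].

Lemma measurable_core n k K : measurable (core n k K).
Proof.
rewrite (_ : core n k K = (inner n k%:R `*` inner n k%:R) `&` (fun z : E * E => z.2 - z.1)%R @^-1` cube K%:R).
  apply: measurableI; first by apply: measurableX; exact: measurable_inner.
  by apply: measurable_pushforwardP; [exact: measurable_diff|exact: measurable_cube].
by apply/seteqP; split => z /=; [move=> [? ? ?]|move=> [[? ?] ?]].
Qed.

Lemma core_sym n k K x y : core n k K (x, y) -> core n k K (y, x).
Proof. by move=> [/= h1 h2 h3]; split => //= i; have := h3 i; rewrite !mxE distrC. Qed.

Lemma core_window n k K : core n k K `<=` W n `*` W n.
Proof. by move=> z [h1 h2 _]; split; exact: (inner_window (ler0n _ k)). Qed.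

(** In the coordinates (x, u = y - x), x ranges over the window, of volume n, and u over a cube of
    volume (2 K)^d. *)
Lemma lebesgue_core n k K : (lam \x lam) (core n k K) <= (n%:R * (2 * K%:R) ^+ d)%:E.
Proof.
have mc := measurable_core n k K.
have mW : measurable (W n) by exact: measurable_window.
have mI : measurable_fun setT (fun u : E => (\1_(cube K%:R) u)%:E : \bar R).
  by apply/measurable_EFinP/measurable_indicP; exact: measurable_cube.
have mIW : measurable_fun setT (fun x : E => (\1_(W n) x)%:E : \bar R).
  exact/measurable_EFinP/measurable_indicP.
have -> : (lam \x lam) (core n k K) = \int[lam \x lam]_z (\1_(core n k K) z)%:E.
  by rewrite integral_indic// setIT.
apply: (@le_trans _ _ (\int[lam \x lam]_z ((\1_(cube K%:R) (z.2 - z.1)%R)%:E * (\1_(W n) z.1)%:E))).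
  apply: ge0_le_integral => //.
  - exact/measurable_EFinP/measurable_indicP.
  - apply: emeasurable_funM; first exact: (measurableT_comp mI (@measurable_diff R d)).
    exact: (measurableT_comp mIW measurable_fst).
  move=> z _; rewrite -EFinM lee_fin indicE; have [zc|zc] := boolP (z \in core n k K); last by rewrite mulr_ge0.
  move: zc; rewrite inE => -[h1 _ h3]; rewrite !indicE !mem_set ?mulr1//.
  exact: (inner_window (ler0n _ k)).
have I0 (u : E) : 0 <= (\1_(cube K%:R) u)%:E :> \bar R by rewrite lee_fin.
rewrite (ge0_integral_diff_kernel mI I0 mW) integral_indic ?setIT//; last exact: measurable_cube.
rewrite (lebesgue_window R d_gt0) muleC EFinM; apply: lee_wpmul2l; first by rewrite lee_fin.
exact: lebesgue_cube.
Qed.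

(** The levels [M] and [M'] differ because the means are truncated with s = 1 under one-point Palm
    laws, the products of scores with s = 2 under two-point ones. The factor 2 B stems from
    controlling the scores at both points, 2 C from comparing a product of two means. *)
Lemma integral_core n k K (M M' e : R) : (0 < n)%N -> (0 < k)%N -> (0 < M)%R -> (0 < M')%R ->
  (0 <= e)%R -> (err 1 1 M k%:R <= e)%R -> (err 2 2 M' k%:R <= e)%R ->
  \int[lam \x lam]_z (cov_diff n z * \1_(core n k K) z)%:E <=
  ((2 * (B * e) + r1 ^+ 2 * (2 * C * e)) * (n%:R * (2 * K%:R) ^+ d))%:E.
Proof.
move=> n0 k0 M0 M'0 e0 he he'; have r10 := intensity_gt0 hP.
have kR : (0 < k%:R :> R)%R by rewrite ltr0n.
pose S := core n k K; have mS : measurable S by exact: measurable_core.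
pose G := trunc_majorant xi p M' 2 n.
have mG : measurable_fun setT G by exact: measurable_trunc_majorant.
have G0 z : (0 <= G z)%R by exact: trunc_majorant_ge0.
have hb : {ae lam \x lam, forall z, rho2 rho z != 0%R -> S z ->
    \int[palm2 z]_X (G (z.1, X))%:E <= e%:E}.
  apply: filterS (ae_trunc_majorant2 hP hxi hC 2 st kR M'0 n0 tp) => z h r0 [z1 z2 _].
  apply: (le_trans (h r0 z1 _)); last by rewrite lee_fin.
  exact: (inner_window (ler0n _ k)).
have mGG : measurable_fun setT (fun z : (E * E) * cfg => (\1_S z.1 * (G (z.1.1, z.2) + G (z.1.2, z.2)))%:E : \bar R).
  apply/measurable_EFinP; apply: measurable_funM.
    by apply: (measurableT_comp _ measurable_fst); apply/measurable_indicP.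
  apply: measurable_funD; apply: (measurableT_comp mG); apply/measurable_fun_pairP; split; try exact: measurable_snd.
    exact: (measurableT_comp measurable_fst measurable_fst).
  exact: (measurableT_comp measurable_snd measurable_fst).
have GG0 (z : (E * E) * cfg) : 0 <= (\1_S z.1 * (G (z.1.1, z.2) + G (z.1.2, z.2)))%:E.
  by rewrite lee_fin mulr_ge0// addr_ge0.
pose c := (r1 ^+ 2 * (2 * C * e))%R.
have c0 : (0 <= c)%R by rewrite !mulr_ge0// ?exprn_ge0 ?ltW.
have mIS : measurable_fun setT (fun z : E * E => (\1_S z)%:E : \bar R).
  exact/measurable_EFinP/measurable_indicP.
have mk := measurable_wkint (measurable_palm2 hpalm) (measurable_rho2 hP) mGG GG0.
have k0' z := wkint_ge0 palm2 (rho2_ge0 hP) z GG0.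
have nv : valid_index (Some n) by [].
apply: (@le_trans _ _ (\int[lam \x lam]_z ((rho2 rho z)%:E * (\int[palm2 z]_X
   (\1_S z * (G (z.1, X) + G (z.2, X)))%:E) + c%:E * (\1_S z)%:E))).
  apply: ae_ge0_le_integral => //.
  - by move=> z _; rewrite lee_fin mulr_ge0// normr_ge0.
  - apply/measurable_EFinP; apply: measurable_funM; first exact: measurable_cov_diff.
    exact/measurable_indicP.
  - by move=> z _; apply: adde_ge0; [exact: k0'|rewrite mule_ge0 ?lee_fin].
  - by apply: emeasurable_funD; [exact: mk|exact: measurable_funeM].
  have h1 := ae_prod_fst (ae_score_mean_diff kR M0 n0).
  have h2 := ae_prod_snd (ae_score_mean_diff kR M0 n0).
  have h3 := ae_prod_snd (ae_score_mean nv).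
  apply: (@filterS3 _ _ _ _ _ _ _ _ h1 h2 h3) => z {}h1 {}h2 {}h3 _.
  rewrite !indicE; have [zS|zS] := boolP (z \in S); last first.
    by under eq_integral do rewrite mul0r; rewrite integral0 mulr0 !mule0 adde0.
  rewrite mulr1 mule1; move: zS; rewrite inE => -[z1 z2 _].
  have {}h1 := le_trans (h1 z1) he; have {}h2 := le_trans (h2 z2) he.
  have {}h3 := h3 (inner_window (ler0n _ k) z2); have h4 := qmean_le.
  pose kd := `|kmean palm2 (score_pair xi (Some n)) z - kmean palm2 (score_pair xi None) z|%R.
  apply: (@le_trans _ _ ((rho2 rho z * kd)%:E + c%:E)); last first.
    apply: leeD => //; rewrite EFinM; apply: lee_wpmul2l; first by rewrite lee_fin (rho2_ge0 hP).
    have mp m := measurableT_comp (measurable_score_pair hxi m) (measurable_pair1 z).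
    apply: (le_trans (fine_integral_diff _ (mp (Some n)) (mp None))).
    apply: ge0_le_integral => //.
    - by apply/measurable_EFinP; apply: measurableT_comp => //; exact: measurable_funB.
    - apply/measurable_EFinP; apply: measurable_funM => //.
      by apply: measurable_funD; exact: (measurableT_comp mG (measurable_pair1 _)).
    - by move=> X _; rewrite mul1r lee_fin; exact: score_pair_diff_le.
  rewrite -EFinD lee_fin /cov_diff /score_cov !score_meanT.
  set s1 := score_mean _ _ in h1 *; set s2 := score_mean _ _ in h2 h3 *; set q := qmean _ _ _ in h1 h2 h4 *.
  (* The density [rho2] is common to both kernels. The product of means changes one factor at a
     time, the other one being at most C in absolute value. *)
  rewrite (_ : (_ - _ - (_ - _) = rho2 rho z * (kmean palm2 (score_pair xi (Some n)) z - kmean palm2 (score_pair xi None) z)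
    - r1 ^+ 2 * ((s1 - q) * s2 + q * (s2 - q)))%R); last by ring.
  apply: (le_trans (ler_normB _ _)); rewrite (normrM (rho2 rho z)) (normrM (r1 ^+ 2)%R) (ger0_norm (rho2_ge0 hP z)); apply: lerD => //.
  rewrite (ger0_norm (exprn_ge0 _ (ltW r10))) ler_wpM2l ?exprn_ge0 ?(ltW r10)//.
  apply: (le_trans (ler_normD _ _)); rewrite !normrM.
  have -> : (2 * C * e = e * C + C * e)%R by ring.
  by apply: lerD; apply: ler_pM.
rewrite ge0_integralD//; last first.
- exact: measurable_funeM.
- by move=> z _; rewrite mule_ge0 ?lee_fin.
rewrite ge0_integralZl ?lee_fin// integral_indic// setIT mulrDl EFinD.
have lc := lebesgue_core n k K.
apply: leeD; last by rewrite (EFinM c); apply: lee_wpmul2l; rewrite ?lee_fin.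
apply: (le_trans (mix2_sym hP hpalm B0 hB mS mG G0 e0 (@core_window n k K) (@core_sym n k K) hb)).
by rewrite (EFinM (2 * (B * e))%R); apply: lee_wpmul2l; rewrite ?lee_fin ?mulr_ge0.
Qed.

(** Three kinds of pairs: lag outside the cube K ([T1]), first point at depth less than K + k
    ([T2]), and the others, whose second point is still at depth k because the lag moves it by less
    than K in each coordinate ([T3]). On the first two, the difference of kernels is at most 2 H,
    whence the doubled sum. *)
Lemma pair_error_bound n k K (e t : R) : (0 < n)%N -> (0 < k)%N -> (0 <= e)%R ->
  (exists2 M, (0 < M)%R & (err 1 1 M k%:R <= e)%R) ->
  (exists2 M, (0 < M)%R & (err 2 2 M k%:R <= e)%R) ->
  \int[lam]_u (H u * (\1_(~` cube K%:R) u)%:E) <= t%:E ->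
  \int[lam \x lam]_z (cov_diff n z * \1_(W n `*` W n) z)%:E <=
  (2 * (t * n%:R + fine (\int[lam]_u H u) * (d%:R * (2 * (K + k)%:R * (n%:R / L n)))) +
   (2 * (B * e) + r1 ^+ 2 * (2 * C * e)) * (n%:R * (2 * K%:R) ^+ d))%:E.
Proof.
move=> n0 k0 e0 [M M0 hM] [M' M'0 hM'] ht.
have mW : measurable (W n) by exact: measurable_window.
have mcK : measurable (~` cube K%:R : set E) by apply: measurableC; exact: measurable_cube.
pose V : set E := W n `\` inner n (K + k)%:R.
have mV : measurable V by apply: measurableD => //; exact: measurable_inner.
have mI (D : set E) : measurable D -> measurable_fun setT (fun x : E => (\1_D x)%:E : \bar R).
  by move=> mD; exact/measurable_EFinP/measurable_indicP.
pose A u := H u * (\1_(~` cube K%:R) u)%:E.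
have mA : measurable_fun setT A by apply: emeasurable_funM => //; exact: mI.
have A0 u : 0 <= A u by rewrite mule_ge0// lee_fin.
pose T1 (z : E * E) := A (z.2 - z.1)%R * (\1_(W n) z.1)%:E.
pose T2 (z : E * E) := H (z.2 - z.1)%R * (\1_V z.1)%:E.
pose T3 (z : E * E) := (cov_diff n z * \1_(core n k K) z)%:E.
have mT1 : measurable_fun setT T1.
  apply: emeasurable_funM; first exact: (measurableT_comp mA (@measurable_diff R d)).
  exact: (measurableT_comp (mI _ mW) measurable_fst).
have mT2 : measurable_fun setT T2.
  apply: emeasurable_funM; first exact: (measurableT_comp mH (@measurable_diff R d)).
  exact: (measurableT_comp (mI _ mV) measurable_fst).
have mT3 : measurable_fun setT T3.
  apply/measurable_EFinP; apply: measurable_funM; first exact: measurable_cov_diff.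
  by apply/measurable_indicP; exact: measurable_core.
have T10 z : 0 <= T1 z by rewrite mule_ge0// lee_fin.
have T20 z : 0 <= T2 z by rewrite mule_ge0// lee_fin.
have T30 z : 0 <= T3 z by rewrite lee_fin mulr_ge0// normr_ge0.
have mT12 : measurable_fun setT (fun z => T1 z + T2 z) by exact: emeasurable_funD.
have T120 z : 0 <= T1 z + T2 z by exact: adde_ge0.
apply: (@le_trans _ _ (\int[lam \x lam]_z (T1 z + T2 z + (T1 z + T2 z) + T3 z))).
  apply: ae_ge0_le_integral => //.
  - by move=> z _; rewrite lee_fin mulr_ge0// normr_ge0.
  - apply/measurable_EFinP; apply: measurable_funM; first exact: measurable_cov_diff.
    by apply/measurable_indicP; exact: measurableX.
  - by move=> z _; rewrite !adde_ge0.
  - by apply: emeasurable_funD => //; exact: emeasurable_funD.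
  have nv : valid_index (Some n) by [].
  apply: (@filterS2 _ _ _ _ _ _ _ (covH nv) (covH (isT : valid_index None))) => -[x y] h1 h2 _.
  rewrite [X in (_ * X)%R]indicE; have [xyW|xyW] := boolP ((x, y) \in _); last by rewrite mulr0 !adde_ge0.
  have [Wx Wy] : W n x /\ W n y by move: xyW; rewrite inE => -[].
  have hH : (cov_diff n (x, y))%:E <= H (y - x)%R + H (y - x)%R.
    apply: (@le_trans _ _ (`|scov (Some n) (x, y)|%:E + `|scov None (x, y)|%:E)).
      by rewrite -EFinD lee_fin ler_normB.
    exact: leeD.
  rewrite mulr1; have [xyK|xyK] := pselect (cube K%:R (y - x)%R : Prop); last first.
    have -> : T1 (x, y) = H (y - x)%R.
      by rewrite /T1 /A !indicE !mem_set// !mule1.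
    apply: (le_trans hH); rewrite -[leLHS]adde0; apply: leeD => //.
    by apply: leeD; rewrite leeDl.
  have [xi'|xi'] := pselect (inner n (K + k)%:R x); last first.
    have -> : T2 (x, y) = H (y - x)%R.
      by rewrite /T2 indicE mem_set ?mule1.
    apply: (le_trans hH); rewrite -[leLHS]adde0; apply: leeD => //.
    by apply: leeD; rewrite leeDr.
  rewrite -[leLHS]add0e; apply: leeD; first by rewrite adde_ge0.
  rewrite /T3 indicE mem_set ?mulr1//; split => /= [i|i|//].
    by have := xi' i; rewrite natrD; have := ler0n R K; lra.
  have := xi' i; have := xyK i; rewrite !mxE natrD => /ltW h3 h4.
  have := ler_normD (y ord0 i - x ord0 i)%R (x ord0 i); rewrite subrK; lra.
have mD : measurable_fun setT (fun z => T1 z + T2 z + (T1 z + T2 z)) by exact: emeasurable_funD.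
have D0 z : 0 <= T1 z + T2 z + (T1 z + T2 z) by exact: adde_ge0.
rewrite (ge0_integralD _ measurableT (fun z _ => D0 z) mD (fun z _ => T30 z) mT3).
rewrite EFinD; apply: leeD; last exact: (integral_core K n0 k0 M0 M'0 e0 hM hM').
rewrite ge0_integralD// ge0_integralD// (ge0_integral_diff_kernel mA A0 mW) (ge0_integral_diff_kernel mH H0 mV).
rewrite (lebesgue_window R d_gt0) -mule2n -mule_natl EFinM; apply: lee_wpmul2l; first by rewrite lee_fin.
rewrite EFinD; apply: leeD.
  by rewrite EFinM; apply: lee_wpmul2r => //; rewrite lee_fin.
rewrite EFinM fineK; last by rewrite ge0_fin_numE//; exact: integral_ge0.
apply: lee_wpmul2l; first exact: integral_ge0.
have Kk : (0 <= (K + k)%:R :> R)%R by [].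
have := lebesgue_layer d n (lexx 0%R) Kk; rewrite inner0 subr0 side_pow_pred//.
Qed.

(** The order of choice matters: [K] from the tail of H, then the tolerance [u] on the core, whose
    volume factor depends on [K], then the truncation levels and the depth [k], and n last, to make
    the boundary layer of width K + k negligible. *)
Lemma pair_error_cvg :
  ((n%:R^-1)%:E * \int[lam \x lam]_z (cov_diff n z * \1_(W n `*` W n) z)%:E) @[n --> \oo] --> 0.
Proof.
apply: cvge0 => [n|e e0].
  rewrite mule_ge0 ?lee_fin//; apply: integral_ge0 => z _.
  by rewrite lee_fin mulr_ge0// normr_ge0.
have e80 : (0 < e / 8)%R by lra.
have [K _ /(_ K (leqnn K)) hK] := cvge0_le Htail e80.
pose Q := ((2 * B + r1 ^+ 2 * (2 * C)) * (2 * K%:R) ^+ d)%R.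
have Q0 : (0 <= Q)%R.
  have r10 := ltW (intensity_gt0 hP).
  by apply: mulr_ge0; [apply: addr_ge0; rewrite !mulr_ge0|rewrite exprn_ge0// mulr_ge0].
have Q10 : (0 < Q + 1)%R by lra.
pose u := (e / 4 / (Q + 1))%R.
have u0 : (0 < u)%R by rewrite !divr_gt0//.
have [M M0 [k1 k10 h1]] := truncation_error_small st C0 (ltn0Sn 0) (ltn0Sn 0) p11 u0.
have [M' M'0 [k2 k20 h2]] := truncation_error_small st C0 (ltn0Sn 1) (ltn0Sn 1) p2 u0.
pose k := maxn k1 k2.
have k0 : (0 < k)%N by rewrite (leq_trans k10)// leq_maxl.
pose J := (fine (\int[lam]_u H u) * (d%:R * (2 * (K + k)%:R)))%R.
have [N hN] := side_ge (J / (e / 8))%R d_gt0.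
exists N.+1 => // n /= Nn; have n0 : (0 < n)%N by exact: leq_ltn_trans Nn.
have nR : (0 < n%:R :> R)%R by rewrite ltr0n.
have L0 : (0 < L n)%R by exact: side_gt0.
have nV : 0 <= (n%:R^-1)%:E :> \bar R by rewrite lee_fin invr_ge0.
have := @pair_error_bound n k K u (e / 8) n0 k0 (ltW u0) _ _ hK => bnd.
apply: (le_trans (lee_wpmul2l nV (bnd _ _))).
- by exists M => //; apply: h1; exact: leq_maxl.
- by exists M' => //; apply: h2; exact: leq_maxr.
rewrite -EFinM lee_fin.
have -> : (n%:R^-1 * (2 * (e / 8 * n%:R + fine (\int[lam]_u0 H u0) * (d%:R * (2 * (K + k)%:R * (n%:R / L n)))) +
   (2 * (B * u) + r1 ^+ 2 * (2 * C * u)) * (n%:R * (2 * K%:R) ^+ d)) = e / 4 + 2 * (J / L n) + Q * u)%R.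
  by rewrite /J /Q; field; rewrite !gt_eqF.
have hJ : (J / L n <= e / 8)%R by rewrite ler_pdivrMr// mulrC -ler_pdivrMr// hN// ltnW.
have hQ : (Q * u <= e / 4)%R.
  rewrite /u mulrCA ler_piMr//; first by lra.
  by rewrite ler_pdivrMr// mul1r; lra.
lra.
Qed.

End pair_error.

(** * Limit of the double integral in lag coordinates *)

Section kernel_limit.
Context (R : realType) (d : nat).
Hypothesis d_gt0 : (0 < d)%N.
Notation E := 'rV[R]_d.
Notation lam := (lebesgue_row R d).
Notation L := (side R d).
Notation W n := (window (Some n) : set E).
Notation W1 := (window (Some 1%N) : set E).
Local Open Scope ereal_scope.

Variables (f g : E -> R) (K : R).
Hypotheses (mf : measurable_fun setT f) (fK : forall u, (`|f u| <= K)%R)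
  (fW : forall u, ~ W1 u -> f u = 0%R).
Hypotheses (mg : measurable_fun setT g) (gK : forall u, (`|g u| <= K)%R)
  (gW : forall u, ~ W1 u -> g u = 0%R).
Notation w := (pair_weight f g).

Let K0 : (0 <= K)%R. Proof. exact: le_trans (fK 0%R). Qed.

(* Correlation of the test functions at lag [u], on the scale of the window. *)
Definition overlap n (u : E) : R := fine (\int[lam]_v (f v * g (v + (L n)^-1 *: u))%:E).

Let mshift (b : E) : measurable_fun setT (fun v : E => g (v + b)%R).
Proof. by apply: measurableT_comp => //; exact: measurable_rowD. Qed.

Let mfg (b : E) : measurable_fun setT (fun v : E => f v * g (v + b))%R.
Proof. exact: measurable_funM. Qed.

Let fgK (b v : E) : (`|f v * g (v + b)| <= K ^+ 2)%R.
Proof. by rewrite normrM expr2; exact: ler_pM. Qed.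

Let fgW (b v : E) : ~ W1 v -> (f v * g (v + b) = 0)%R.
Proof. by move=> /fW ->; rewrite mul0r. Qed.

Let Ifg (b : E) : lam.-integrable setT (EFin \o (fun v : E => f v * g (v + b))%R).
Proof. exact: (integrable_bounded_window d_gt0 (mfg b) (fgK b) (@fgW b)). Qed.

Lemma overlap_le n u : (`|overlap n u| <= K ^+ 2)%R.
Proof.
rewrite -lee_fin -abse_EFin /overlap fineK; last exact: integrable_fin_num (Ifg _).
apply: (le_trans (le_abse_integral _ measurableT _)); first exact: measurable_int (Ifg _).
have mI : measurable_fun setT (fun x : E => (\1_W1 x)%:E : \bar R).
  by apply/measurable_EFinP/measurable_indicP; exact: measurable_window.
apply: (@le_trans _ _ (\int[lam]_v ((K ^+ 2)%:E * (\1_W1 v)%:E))); last first.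
  by rewrite ge0_integralZl ?lee_fin ?exprn_ge0// integral_indic_window// mule1.
apply: ge0_le_integral => //.
- by apply: measurableT_comp => //; exact: measurable_int (Ifg _).
- exact: measurable_funeM.
move=> v _; rewrite indicE; have [vW|vW] := boolP (v \in W1); first by rewrite mule1 lee_fin.
have nv : ~ W1 v by move: vW; rewrite notin_setE.
by rewrite mule0 abse_EFin (fgW _ nv) normr0.
Qed.

Lemma sideV_cvg : (fun n => (L n.+1)^-1)%R @ \oo --> (0 : R)%R.
Proof.
apply/cvgrPdist_le => e e0; have [N hN] := side_ge (e^-1)%R d_gt0.
exists N => // n /= Nn; rewrite sub0r normrN ger0_norm ?invr_ge0 ?side_ge0//.
rewrite -[leRHS]invrK lef_pV2 ?posrE ?invr_gt0// ?side_gt0//.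
by apply: hN; exact: leqW.
Qed.

(** The difference from the limit is at most K times the L^1 translation error of g along the
    vectors u / [L n], which shrink to 0. *)
Lemma overlap_cvg u : overlap n.+1 u @[n --> \oo] --> fine (\int[lam]_v (f v * g v)%:E).
Proof.
have a01 n : (0 <= (L n.+1)^-1 <= 1)%R.
  rewrite invr_ge0 side_ge0/= invf_le1 ?side_gt0//.
  apply: (@le_trans _ _ (1 `^ d%:R^-1)%R); first by rewrite powR1.
  by apply: ge0_ler_powR; rewrite ?nnegrE ?invr_ge0 ?ler1n.
have [_ tau0] := translation_continuous_bounded d_gt0 u a01 sideV_cvg mg gK gW.
have K10 : (0 < K + 1)%R by rewrite ltr_wpDl.
apply/cvgrPdist_le => e e0.
have eK : (0 < e / (K + 1))%R by rewrite divr_gt0.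
apply: filterS (cvge0_le tau0 eK) => n hn.
rewrite -lee_fin; apply: (le_trans (fine_integral_diff _ _ _)); [exact: measurable_funM|exact: mfg|].
apply: (@le_trans _ _ (K%:E * translation_error (fun n => (L n.+1)^-1)%R u g n)).
  rewrite /translation_error -ge0_integralZl ?lee_fin//; last first.
    by apply/measurable_EFinP; apply: measurableT_comp => //; exact: measurable_funB.
  apply: ge0_le_integral => //.
  - apply/measurable_EFinP; apply: measurableT_comp => //; apply: measurable_funB => //.
    exact: measurable_funM.
  - by apply: measurable_funeM; apply/measurable_EFinP; apply: measurableT_comp => //; exact: measurable_funB.
  by move=> v _; rewrite -EFinM lee_fin -mulrBr normrM distrC ler_wpM2r.
have K0E : 0 <= K%:E by rewrite lee_fin.
apply: (le_trans (lee_wpmul2l K0E hn)); rewrite -EFinM lee_fin mulrCA ler_piMr ?ltW//.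
by rewrite ltr_pdivrMr// mul1r; lra.
Qed.

Variables (cn : nat -> E * E -> R) (c : E -> R).
Hypotheses (mcn : forall n, measurable_fun setT (cn n))
  (Ic : lam.-integrable setT (EFin \o c))
  (Icn : forall n, (0 < n)%N -> (lam \x lam).-integrable setT (fun z => (w n z * cn n z)%:E))
  (cnc : (n%:R^-1)%:E * \int[lam \x lam]_z (`|cn n z - c (z.2 - z.1)| * \1_(W n `*` W n) z)%:E
    @[n --> \oo] --> 0).

Let mc : measurable_fun setT c.
Proof. by apply/measurable_EFinP; exact: measurable_int Ic. Qed.

Let mcd : measurable_fun setT (fun z : E * E => c (z.2 - z.1)%R).
Proof. exact: (measurableT_comp mc (@measurable_diff R d)). Qed.

Let mw n : measurable_fun setT (w n). Proof. exact: measurable_pair_weight. Qed.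

Lemma limit_kernel_integrable n : (0 < n)%N ->
  (lam \x lam).-integrable setT (fun z => (w n z * c (z.2 - z.1))%:E).
Proof.
move=> n0; apply/integrableP; split.
  by apply/measurable_EFinP; exact: measurable_funM.
have mW : measurable (W n) by exact: measurable_window.
pose A u := (K ^+ 2 * `|c u|)%:E.
have mA : measurable_fun setT A.
  by apply/measurable_EFinP; apply: measurable_funM => //; exact: measurableT_comp.
have A0 u : 0 <= A u by rewrite lee_fin mulr_ge0// exprn_ge0.
apply: (@le_lt_trans _ _ (\int[lam \x lam]_z (A (z.2 - z.1)%R * (\1_(W n) z.1)%:E))).
  apply: ge0_le_integral => //.
  - by apply: measurableT_comp => //; apply/measurable_EFinP; exact: measurable_funM.
  - apply: emeasurable_funM; first exact: (measurableT_comp mA (@measurable_diff R d)).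
    have mI : measurable_fun setT (fun x : E => (\1_(W n) x)%:E : \bar R).
      exact/measurable_EFinP/measurable_indicP.
    exact: (measurableT_comp mI measurable_fst).
  move=> z _; rewrite abse_EFin normrM indicE; have [zW|zW] := boolP (z.1 \in W n).
    by rewrite mule1 lee_fin ler_wpM2r//; exact: pair_weight_le.
  rewrite (pair_weight_out fW gW)// ?normr0 ?mul0r ?mule0// => -[].
  by move: zW; rewrite notin_setE.
rewrite ge0_integral_diff_kernel// (lebesgue_window R d_gt0).
have /integrableP[_ cfin] := Ic.
have Afin : \int[lam]_u A u < +oo.
  rewrite /A; under eq_integral do rewrite EFinM.
  rewrite ge0_integralZl ?lee_fin ?exprn_ge0//; last by apply/measurable_EFinP; exact: measurableT_comp.
  by rewrite lte_mul_pinfty ?lee_fin ?exprn_ge0.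
by rewrite muleC lte_mul_pinfty ?lee_fin.
Qed.

(** At a fixed lag the kernel is constant, and rescaling the window to unit size gives the Jacobian
    n. *)
Lemma limit_kernel_section n u : (0 < n)%N ->
  \int[lam]_x (w n (x, x + u) * c ((x, x + u).2 - (x, x + u).1))%:E =
  (n%:R * (c u * overlap n u))%:E.
Proof.
move=> n0; set b := ((L n)^-1 *: u)%R.
transitivity (\int[lam]_x ((c u)%:E * (gscale (fun v => f v * g (v + b)) n x)%:E)).
  apply: eq_integral => x _; rewrite -EFinM /pair_weight /gscale /= [(x + u)%R]addrC addrK.
  by rewrite scalerDr mulrC [(_ *: u + _)%R]addrC.
have Ig := integrable_gscale d_gt0 (mfg b) (fgK b) (@fgW b) n0.
rewrite integralZl// (integral_gscale d_gt0 (mfg b) (fgK b) (@fgW b) n0).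
have -> : \int[lam]_v (f v * g (v + b))%:E = (overlap n u)%:E.
  by rewrite fineK//; exact: (integrable_fin_num measurableT (Ifg b)).
by rewrite -!EFinM; congr (_%:E); rewrite mulrCA.
Qed.

Lemma limit_kernel_cvg :
  (n%:R^-1)%:E * \int[lam \x lam]_z (w n z * c (z.2 - z.1))%:E @[n --> \oo] -->
  \int[lam]_u (c u)%:E * \int[lam]_v (f v * g v)%:E.
Proof.
pose J := fine (\int[lam]_v (f v * g v)%:E).
have JE : \int[lam]_v (f v * g v)%:E = J%:E.
  rewrite fineK//; have := integrable_fin_num measurableT (Ifg 0%R).
  by under eq_integral do rewrite /= addr0.
(* The change of scale is made for n >= 1, hence the shifted index. *)
rewrite -cvg_shiftS JE.
have -> : \int[lam]_u (c u)%:E * J%:E = \int[lam]_u (c u * J)%:E.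
  by under [RHS]eq_integral do rewrite EFinM; rewrite integralZr.
pose F n u := (c u * overlap n.+1 u)%:E.
pose G n u := \int[lam]_x (w n.+1 (x, x + u) * c ((x, x + u).2 - (x, x + u).1))%:E.
have eqF n u : (n.+1%:R^-1)%:E * G n u = F n u.
  by rewrite /G limit_kernel_section// -EFinM mulKf.
have mF n : measurable_fun setT (F n).
  have [m _] := integral_diff (limit_kernel_integrable (ltn0Sn n)).
  rewrite (_ : F n = fun u => (n.+1%:R^-1)%:E * G n u); first exact: measurable_funeM.
  by apply/funext => u; rewrite eqF.
have -> : (fun n => (n.+1%:R^-1)%:E * \int[lam \x lam]_z (w n.+1 z * c (z.2 - z.1))%:E) =
    fun n => \int[lam]_u F n u.
  apply/funext => n; have [m ->] := integral_diff (limit_kernel_integrable (ltn0Sn n)).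
  have IF : lam.-integrable setT (fun u => (c u * overlap n.+1 u)%:E).
    apply: (@le_integrable _ _ _ _ _ measurableT _ (fun u => (K ^+ 2 * c u)%:E)) => //.
    - exact: mF.
    - move=> u _; rewrite !abse_EFin lee_fin normrM (normrM (K ^+ 2)%R) mulrC ler_wpM2r// (ger0_norm (exprn_ge0 2 K0)).
      exact: overlap_le.
    - by under eq_fun do rewrite EFinM; exact: integrableZl.
  have IG : lam.-integrable setT (G n).
    rewrite (_ : G n = fun u => n.+1%:R%:E * (c u * overlap n.+1 u)%:E); first exact: integrableZl.
    by apply/funext => u; rewrite /G limit_kernel_section// EFinM.
  by rewrite -integralZl//; apply: eq_integral => u _; rewrite eqF.
have Ib : lam.-integrable setT (fun u => (K ^+ 2 * `|c u|)%:E).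
  by under eq_fun do rewrite EFinM; apply: integrableZl => //; exact: integrable_norm.
have [] // := @dominated_convergence _ _ R lam setT measurableT F (fun u => (c u * J)%:E)
  (fun u => (K ^+ 2 * `|c u|)%:E) mF.
- by apply/measurable_EFinP; exact: measurable_funM.
- apply: aeW => u _; apply: cvg_EFin; first exact: nearW.
  by apply: cvgMr; exact: overlap_cvg.
- apply: aeW => u n _; rewrite abse_EFin lee_fin normrM mulrC ler_wpM2r//.
  exact: overlap_le.
Qed.

(** Since the weights are at most K^2 and vanish outside the square of the window, replacing [cn] by
    the limit kernel costs at most K^2 times the error assumed to vanish. *)
Lemma pair_kernel_cvg :
  (n%:R^-1)%:E * \int[lam \x lam]_z (w n z * cn n z)%:E @[n --> \oo] -->
  \int[lam]_u (c u)%:E * \int[lam]_v (f v * g v)%:E.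
Proof.
pose X n := (n%:R^-1)%:E * \int[lam \x lam]_z (w n z * cn n z)%:E.
pose Y n := (n%:R^-1)%:E * \int[lam \x lam]_z (w n z * c (z.2 - z.1))%:E.
have XY : X n - Y n @[n --> \oo] --> 0.
  apply/cvg_abse0P.
  apply: (@squeeze_cvge _ _ _ _ (fun=> 0) _ (fun n => (K ^+ 2)%:E * ((n%:R^-1)%:E *
    \int[lam \x lam]_z (`|cn n z - c (z.2 - z.1)| * \1_(W n `*` W n) z)%:E))); last 2 first.
  - exact: cvg_cst.
  - by rewrite -[X in _ --> X](mule0 (K ^+ 2)%:E); exact: cvgeZl.
  exists 1%N => // n /= n0; rewrite abse_ge0 /= /X /Y.
  have IT := limit_kernel_integrable n0; have In := Icn n0.
  have mW : measurable (W n) by exact: measurable_window.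
  have mWW : measurable (W n `*` W n) by exact: measurableX.
  rewrite -muleBr//; last by apply: fin_num_adde_defr; exact: integrable_fin_num.
  rewrite -integralB_EFin// abseM gee0_abs ?lee_fin ?invr_ge0// muleCA.
  apply: lee_wpmul2l; first by rewrite lee_fin invr_ge0.
  apply: (le_trans (le_abse_integral _ measurableT _)).
    by apply: emeasurable_funB; [exact: measurable_int In|exact: measurable_int IT].
  have mD : measurable_fun setT (fun z : E * E => `|cn n z - c (z.2 - z.1)| * \1_(W n `*` W n) z)%R.
    apply: measurable_funM; last exact/measurable_indicP.
    by apply: measurableT_comp => //; exact: measurable_funB.
  have mDE : measurable_fun setT (fun z : E * E => (`|cn n z - c (z.2 - z.1)| * \1_(W n `*` W n) z)%:E : \bar R).
    exact/measurable_EFinP.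
  have D0 (z : E * E) : 0 <= (`|cn n z - c (z.2 - z.1)| * \1_(W n `*` W n) z)%:E.
    by rewrite lee_fin mulr_ge0.
  rewrite -ge0_integralZl ?lee_fin ?exprn_ge0//.
  apply: ge0_le_integral => //.
  - apply: measurableT_comp => //.
    by apply: emeasurable_funB; [exact: measurable_int In|exact: measurable_int IT].
  - exact: measurable_funeM.
  move=> z _; rewrite -EFinB abse_EFin -EFinM lee_fin -mulrBr normrM indicE.
  have [zW|zW] := boolP (z \in _).
    by rewrite mulr1 ler_wpM2r//; exact: pair_weight_le.
  rewrite (pair_weight_out fW gW)// ?normr0 ?mul0r ?mulr0// => -[z1 z2].
  by move: zW; rewrite notin_setE; apply.
have Yc := limit_kernel_cvg.
apply: (@cvg_trans _ ((X n - Y n + Y n) @[n --> \oo])).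
  apply: near_eq_cvg; exists 1%N => // n /= n0.
  have Yf : Y n \is a fin_num.
    by rewrite fin_numM//; apply: integrable_fin_num => //; exact: limit_kernel_integrable.
  by rewrite subeK.
have h := cvgeD _ XY Yc; rewrite add0e in h; apply: h.
exact: fin_num_adde_defr.
Qed.

End kernel_limit.

Lemma cvge_dist_squeeze (R : realType) (u v : nat -> \bar R) (l : R) :
  (\forall n \near \oo, `|u n - l%:E| <= v n)%E -> v @ \oo --> 0%E -> u @ \oo --> l%:E.
Proof.
move=> uv v0; have h : (u n - l%:E)%E @[n --> \oo] --> 0%E.
  apply/cvg_abse0P; apply: squeeze_cvge v0; last exact: cvg_cst.
  by apply: filterS uv => n; rewrite abse_ge0.
have h2 := cvgeD _ h (cvg_cst l%:E); rewrite add0e in h2.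
have {}h2 : (u n - l%:E + l%:E)%E @[n --> \oo] --> l%:E by apply: h2.
apply: cvg_trans h2.
by apply: near_eq_cvg; apply: nearW => n; rewrite subeK.
Qed.

(** * Limits of the variance and of the covariance *)

Section covariance_limit.
Context (R : realType) (d : nat) (disp : measure_display) (Omega : measurableType disp).
Hypothesis d_gt0 : (0 < d)%N.
Context (Pr : probability Omega R) (P : {RV Pr >-> config R d}).
Context (rho : forall k, k.-tuple 'rV[R]_d -> R).
Context (palm : forall k, k.-tuple 'rV[R]_d -> probability (config R d) R).
Context (xi : 'rV[R]_d -> config R d -> R).
Hypothesis hP : admissible Pr P rho.
Hypothesis hpalm : palm_probabilities Pr P palm.
Hypothesis hxi : score_function xi.
Notation E := 'rV[R]_d.
Notation lam := (lebesgue_row R d).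
Notation r1 := (intensity rho).
Notation W1 := (window (Some 1%N) : set E).
Notation score_cov := (score_cov rho palm xi).
Local Open Scope ereal_scope.

Variable p : R.
Hypotheses (p2 : (2 < p)%R) (moment : moment_condition Pr P palm xi p)
  (stab : stabilizing Pr P palm xi) (bounded : bounded_correlation rho 2%N)
  (decay : fast_decay2 rho palm xi).

Let sq (y : R) : R := (y ^+ 2)%R.
Let sq_le (y : R) : (`|sq y| <= Num.max `|y| 1 ^+ 2)%R.
Proof. by rewrite normrX; apply: lerXn2r; rewrite ?nnegrE ?le_max ?normr_ge0 ?lexx. Qed.
Let msq : measurable_fun setT sq. Proof. exact: exprn_measurable. Qed.
Let tp : (2 <= Num.truncn p)%N. Proof. exact: truncn_ge. Qed.
Let tp1 : (1 <= Num.truncn p)%N. Proof. exact: leq_trans tp. Qed.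

Definition limit_cov (u : E) : R := score_cov None (0%R, u).

Lemma limit_covE (z : E * E) : score_cov None z = limit_cov (z.2 - z.1)%R.
Proof. by case: z => x y; rewrite (score_cov_shift hP hpalm hxi). Qed.

Lemma integrable_limit_cov : lam.-integrable setT (EFin \o limit_cov).
Proof.
have [phi [D [c [phif c0 hD]]]] := decay.
exact: (limit_cov_integrable d_gt0 hP hpalm hxi phif c0 hD).
Qed.

(** Shows that the limit constant is a finite real number: the extended integrand equals the real
    integrable kernel almost everywhere, and the diagonal term is the Palm mean of the square. *)
Lemma sigma2E : sigma2 rho palm xi = (r1 * qmean palm xi sq)%:E + \int[lam]_u (limit_cov u)%:E.
Proof.
have [C hC] := moment_boundP moment.
rewrite /sigma2 unlock; congr (_ + _).
  rewrite EFinM muleC; congr (_ * _).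
  rewrite /qmean kmeanE; last exact: (fscoreT_integrable d_gt0 hP hpalm hxi hC msq p2 tp1 sq_le).
  by apply: eq_integral => X _; rewrite /fscore /= score_inT.
have [phi [D [c [phif c0 hD]]]] := decay.
have mpair0 : measurable_fun setT (fun u : E => (0%R, u) : E * E) by exact: measurable_pair1.
apply: ae_eq_integral => //.
- apply: emeasurable_funB => //; rewrite /m2 unlock; apply: emeasurable_funM.
    have mk := measurable_kint_signed (measurable_palm2 hpalm) (measurable_score_pair hxi None).
    exact: (measurableT_comp mk mpair0).
  by apply/measurable_EFinP; exact: (measurableT_comp (measurable_rho2 hP) mpair0).
- exact: measurable_int integrable_limit_cov.
by apply: filterS (ae_limit_cov d_gt0 hP hpalm hxi phif c0 hD) => u [e _] _.
Qed.

Lemma covariance_cvg (f g : E -> R) : bounded_measurable f -> bounded_measurable g ->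
  ((n%:R^-1)%:E * covariance Pr (xi_sum P xi n f) (xi_sum P xi n g)) @[n --> \oo] -->
  sigma2 rho palm xi * \int[lam]_(x in W1) (f x * g x)%:E.
Proof.
move=> /bounded_cutoff[Kf [mf fK fW]] /bounded_cutoff[Kg [mg gK gW]].
pose K := Num.max Kf Kg.
have {}fK u : (`|(f \_ W1) u| <= K)%R by rewrite (le_trans (fK u))// le_max lexx.
have {}gK u : (`|(g \_ W1) u| <= K)%R by rewrite (le_trans (gK u))// le_max lexx orbT.
have [C hC] := moment_boundP moment.
have [a [phi st]] := stab.
(* The constant bounding the correlation function comes without a sign, while the volume estimates
   multiply by a non-negative one. *)
have [b hb] := bounded; pose B := Num.max b 0%R.
have B0 : (0 <= B)%R by rewrite le_max lexx orbT.
have hB : {ae lam \x lam, forall z, (rho2 rho z <= B)%R}.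
  by have /ae_tuple2 := hb; apply: filterS => z /le_trans; apply; rewrite le_max lexx.
have [psi [D [c [psif c0 hD]]]] := decay.
pose fg (x : E) : R := ((f \_ W1) x * (g \_ W1) x)%R.
have mfg : measurable_fun setT fg by exact: measurable_funM.
have fgK u : (`|fg u| <= K ^+ 2)%R by rewrite /fg normrM expr2; exact: ler_pM.
have fgW u : ~ W1 u -> fg u = 0%R by move=> /fW h; rewrite /fg h mul0r.
have Ifg := integrable_bounded_window d_gt0 mfg fgK fgW.
have -> : \int[lam]_(x in W1) (f x * g x)%:E = \int[lam]_x (fg x)%:E.
  rewrite integral_cutoff; apply: eq_integral => x _; rewrite /fg !patchE.
  by case: ifP => // _; rewrite mul0r.
have Jf : \int[lam]_x (fg x)%:E \is a fin_num by exact: integrable_fin_num.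
have formula n n0 := covariance_formula d_gt0 hP hpalm hxi B0 hB hC p2 tp mf fK fW mg gK gW (n := n) n0.
(* The mean asymptotics for the squared score with test function f g: the growth exponent is s = 2,
   which is where p > 2 enters the diagonal term. *)
have diag : (n%:R^-1)%:E * \int[Pr]_w (point_sum P n (wscore xi sq fg n) w)%:E @[n --> \oo] -->
    (r1 * qmean palm xi sq)%:E * \int[lam]_x (fg x)%:E.
  rewrite -(fineK Jf) -EFinM.
  have D0 := boundary_error_cvg d_gt0 hP hpalm hxi hC msq (ltn0Sn 1) p2 tp1 sq_le st.
  apply: (@cvge_dist_squeeze _ _ (fun n => (r1 * K ^+ 2)%:E * ((n%:R^-1)%:E * boundary_error palm xi sq n))); last first.
    by rewrite -[X in _ --> X](mule0 (r1 * K ^+ 2)%:E); exact: cvgeZl.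
  exists 1%N => // n n0; have {}n0 : (0 < n)%N := n0.
  have nR : (n%:R != 0 :> R)%R by rewrite pnatr_eq0 -lt0n.
  have [_ IT bT] := mean_compare d_gt0 hP hpalm hxi hC msq p2 tp1 sq_le mfg fgK fgW n0.
  have -> : (r1 * qmean palm xi sq * fine (\int[lam]_x (fg x)%:E))%:E =
      (n%:R^-1)%:E * ((r1 * qmean palm xi sq * n%:R)%:E * \int[lam]_x (fg x)%:E).
    rewrite -[in RHS](fineK Jf) -!EFinM; congr (_%:E); field; exact: nR.
  rewrite -muleBr//; last by apply: fin_num_adde_defr; exact: integrable_fin_num IT.
  rewrite abseM gee0_abs ?lee_fin ?invr_ge0// muleCA.
  by apply: lee_wpmul2l => //; rewrite lee_fin invr_ge0.
have pair : (n%:R^-1)%:E * \int[lam \x lam]_z (pair_weight (f \_ W1) (g \_ W1) n z * score_cov (Some n) z)%:E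
    @[n --> \oo] --> \int[lam]_u (limit_cov u)%:E * \int[lam]_x (fg x)%:E.
  apply: (pair_kernel_cvg d_gt0 mf fK fW mg gK gW (cn := fun n => score_cov (Some n))).
  - by move=> n; exact: (measurable_score_cov hP hpalm hxi).
  - exact: integrable_limit_cov.
  - by move=> n n0; have [] := formula n n0.
  have err := pair_error_cvg d_gt0 hP hpalm hxi B0 hB hC p2 tp st
    (measurable_cov_majorant D psif c0) (cov_majorant_ge0 D psif c0)
    (integral_cov_majorant d D psif c0) (cov_majorant_tail d_gt0 D psif c0)
    (@ae_score_cov _ _ _ _ d_gt0 _ _ _ _ _ hP _ _ _ psif c0 hD).
  apply: cvg_trans err; apply: near_eq_cvg; apply: nearW => n; congr (_ * _).
  by apply: eq_integral => z _; rewrite /cov_diff limit_covE.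
have Sf : \int[lam]_u (limit_cov u)%:E \is a fin_num by exact: integrable_fin_num integrable_limit_cov.
have Tf : (r1 * qmean palm xi sq)%:E +? \int[lam]_u (limit_cov u)%:E by exact: fin_num_adde_defr.
rewrite sigma2E muleDl//.
have Tf2 : (r1 * qmean palm xi sq)%:E * \int[lam]_x (fg x)%:E +?
    \int[lam]_u (limit_cov u)%:E * \int[lam]_x (fg x)%:E.
  by apply: fin_num_adde_defr; rewrite fin_numM.
have add (u v : nat -> \bar R) x y : x +? y -> u @ \oo --> x -> v @ \oo --> y ->
    u n + v n @[n --> \oo] --> x + y by move=> ? ? ?; exact: cvgeD.
apply: cvg_trans (add _ _ _ _ Tf2 diag pair).
apply: near_eq_cvg; exists 1%N => // n n0; have {}n0 : (0 < n)%N := n0.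
have [I CE] := formula n n0; rewrite !xi_sumE//.
have [_ IT _] := mean_compare d_gt0 hP hpalm hxi hC msq p2 tp1 sq_le mfg fgK fgW n0.
rewrite -muleDr//; last by apply: fin_num_adde_defr; exact: (integrable_fin_num measurableT IT).
by congr (_ * _); rewrite CE.
Qed.

(** Non-negativity of the limit is not visible in the formula for [sigma2]; it is inherited from the
    variances. Finiteness comes from [sigma2E]. *)
Lemma variance_cvg (f : E -> R) : bounded_measurable f ->
  let limit := sigma2 rho palm xi * \int[lam]_(x in W1) (f x ^+ 2)%:E in
  ((n%:R^-1)%:E * 'V_Pr[xi_sum P xi n f]) @[n --> \oo] --> limit /\ (0 <= limit < +oo).
Proof.
move=> bf limit.
have cv : ((n%:R^-1)%:E * 'V_Pr[xi_sum P xi n f]) @[n --> \oo] --> limit.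
  rewrite /limit; under eq_integral do rewrite expr2.
  exact: covariance_cvg.
split => //; apply/andP; split.
  rewrite -(cvg_lim (@ereal_hausdorff R) cv); apply: lime_ge; first by apply/cvg_ex; exists limit.
  by apply: nearW => n; rewrite mule_ge0// ?lee_fin ?invr_ge0// variance_ge0.
have [K [mf fK fW]] := bounded_cutoff bf.
rewrite ltey_eq /limit sigma2E; apply/orP; left; apply: fin_numM.
  by rewrite fin_numD /=; exact: integrable_fin_num integrable_limit_cov.
rewrite integral_cutoff.
apply: integrable_fin_num => //; apply: (integrable_bounded_window d_gt0 (K := (K ^+ 2)%R)).
- rewrite (_ : _ \_ _ = fun x => ((f \_ W1) x ^+ 2)%R); first exact: measurable_funX.
  by apply/funext => x; rewrite !patchE; case: ifP => //; rewrite expr0n.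
- move=> u; have := fK u; rewrite !patchE; case: ifP => _ h; last by rewrite normr0 exprn_ge0// (le_trans _ h).
  by rewrite normrX; apply: lerXn2r; rewrite ?nnegrE// (le_trans _ h).
- by move=> u nu; rewrite patchE memNset.
Qed.

End covariance_limit.

Theorem theorem1p12 (R : realType) (d : nat) (hd : (2 <= d)%N)
    (disp : measure_display) (Omega : measurableType disp)
    (Pr : probability Omega R) (P : {RV Pr >-> config R d})
    (rho : forall k, k.-tuple 'rV[R]_d -> R)
    (palm : forall k, k.-tuple 'rV[R]_d -> probability (config R d) R)
    (xi : 'rV[R]_d -> config R d -> R)
    (hP : admissible Pr P rho)
    (hpalm : palm_probabilities Pr P palm)
    (hxi : score_function xi) :
  (exponentially_stabilizing Pr P palm xi ->
   (exists2 p : R, 1 < p & moment_condition Pr P palm xi p) ->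
   forall f, bounded_measurable f ->
     exists C : R, \forall n \near \oo,
       (mean_error Pr P rho palm xi n f <= (C * n%:R `^ (- d%:R^-1))%:E)%E)
  /\
  (stabilizing Pr P palm xi ->
   (exists2 p : R, 1 < p & moment_condition Pr P palm xi p) ->
   forall f, bounded_measurable f ->
     mean_error Pr P rho palm xi n f @[n --> \oo] --> 0%E)
  /\
  (bounded_correlation rho 2%N ->
   stabilizing Pr P palm xi ->
   (exists2 p : R, 2 < p & moment_condition Pr P palm xi p) ->
   fast_decay2 rho palm xi ->
   (forall f, bounded_measurable f ->
     let limit := (sigma2 rho palm xi
       * \int[lebesgue_row R d]_(x in window (Some 1%N)) (f x ^+ 2)%:E)%E in
     ((n%:R^-1)%:E * 'V_Pr[xi_sum P xi n f])%E @[n --> \oo] --> limit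
     /\ (0 <= limit < +oo)%E)
   /\
   (forall f g, bounded_measurable f -> bounded_measurable g ->
     ((n%:R^-1)%:E * covariance Pr (xi_sum P xi n f) (xi_sum P xi n g))%E
       @[n --> \oo] -->
     (sigma2 rho palm xi
       * \int[lebesgue_row R d]_(x in window (Some 1%N)) (f x * g x)%:E)%E)).
Proof.
have d_gt0 : (0 < d)%N by exact: ltnW.
split; [|split].
- by move=> stab [p p1 moment] f; exact: (mean_error_rate d_gt0 hP hpalm hxi p1 moment).
- by move=> stab [p p1 moment] f; exact: (mean_error_cvg d_gt0 hP hpalm hxi p1 moment).
move=> bounded stab [p p2 moment] decay; split.
  by move=> f; exact: (variance_cvg d_gt0 hP hpalm hxi p2 moment).
by move=> f g; exact: (covariance_cvg d_gt0 hP hpalm hxi p2 moment).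
Qed.
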